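(* Let $R>0$, $h_0\in(0,1)$ and $h\in[h_0,1)$. At every point $W^h\in K^h(2R)$ and for all $\lambda>0$, $\gamma\in(0,1)$ the functional $J_{\lambda,\gamma}(W^h)$ has the Fréchet derivative $J'_{\lambda,\gamma}(W^h)\in H^{1,h}_{0,N}(\Omega_1^h)$. Furthermore, this derivative is Lipschitz continuous on $K^h(2R)$: there exists a constant $\overline{C}>0$, depending only on $$h_0,\ A,\ \sigma,\ R,\ N,\ \Omega^h,\ \|G^h\|_{C_N^h(\overline{\Omega}_1^h)},\ \|F^h\|_{C_N^h(\overline{\Omega}_1^h)}\qquad( * )$$ and on $\lambda$, such that for all $W^{(1),h},W^{(2),h}\in K^h(2R)$ $$\|J'_{\lambda,\gamma}(W^{(2),h})-J'_{\lambda,\gamma}(W^{(1),h})\|_{H^{1,h}_{0,N}(\Omega_1^h)}\le\overline{C}\,\|W^{(2),h}-W^{(1),h}\|_{H^{1,h}_{0,N}(\Omega_1^h)}.$$ In addition, there exists a sufficiently large number $\lambda_0>1$, depending on the parameters $( * )$, such that for every $\lambda\ge\lambda_0$ and every $\gamma\in(0,1)$ the functional $J_{\lambda,\gamma}$ is strictly convex on the closed set $\overline{K^h(R)}$. More precisely, for all $W^{(1),h},W^{(2),h}\in\overline{K^h(R)}$ $$J_{\lambda,\gamma}(W^{(2),h})-J_{\lambda,\gamma}(W^{(1),h})-J'_{\lambda,\gamma}(W^{(1),h})(W^{(2),h}-W^{(1),h})\ge\frac18\|W^{(2),h}-W^{(1),h}\|^2_{L^h_{2,N}(\Omega^h)}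+\gamma\|W^{(2),h}-W^{(1),h}\|^2_{H^{1,h}_{0,N}(\Omega_1^h)}.$$
   Context: **Grid.** Fix $A,\sigma>0$, an integer $N\ge1$, $a>0$, $h_0\in(0,1)$ and a grid step $h\in[h_0,1)$ with $B=1/h$ an integer. Put $x_i=ih$, $y_j=jh$, $0\le i,j\le B$. $\Omega^h$ is the set of points $(x_i,y_j,z)$ with $1\le i,j\le B-1$, $z\in(A,A+\sigma)$; $\Omega_1^h$ is the same with $0\le i,j\le B$; for $\overline{\Omega}^h,\overline{\Omega}_1^h$ one takes $z\in[A,A+\sigma]$. Write $\mathbf{x}^h(z)$ for the collection of grid points at height $z$. The lateral boundary $\Gamma$ corresponds to $i\in\{0,B\}$ or $j\in\{0,B\}$; $B_A$ corresponds to $z=A$. **Basis.** $\{\Psi_n\}_{n\ge1}$ is the orthonormal system in $L_2(0,1)$ obtained by Gram-Schmidt orthonormalization of $\xi_n(\alpha)=(\alpha+a)^{n-1}e^{\alpha}$, $n\ge1$. $M_N=(a_{mn})_{m,n=1}^N$, $a_{mn}=\int_0^1\Psi_n'\Psi_m\,d\alpha$; this matrix is invertible. **Semidiscrete functions and spaces.** A semidiscrete ($N$-component) function is $Q^h=(Q_k^{i,j}(z))$, $k=1,\dots,N$, $0\le i,j\le B$, $z\in[A,A+\sigma]$. $C_N^h(\overline{\Omega}_1^h)$ consists of those continuous in $z$, with norm $\max_{z}\max_k\max_{0\le i,j\le B}|Q_k^{i,j}(z)|$. $\|Q^h\|^2_{L^h_{2,N}(\Omega^h)}=\int_A^{A+\sigma}h^2\sum_{k=1}^N\sum_{i,j=1}^{B-1}(Q_k^{i,j}(z))^2dz$.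 $H^{1,h}_{0,N}(\Omega_1^h)$ is the (Hilbert) space of $Q^h$ vanishing on $\Gamma\cup B_A$ with finite norm $\|Q^h\|^2_{H^{1,h}_{0,N}(\Omega_1^h)}=\|Q^h\|^2_{L^h_{2,N}(\Omega^h)}+\|\partial_zQ^h\|^2_{L^h_{2,N}(\Omega^h)}$. The subscripts $x,y$ denote central differences at interior nodes: $Q_{x}^{i,j}=(Q^{i+1,j}-Q^{i-1,j})/(2h)$, $Q_{y}^{i,j}=(Q^{i,j+1}-Q^{i,j-1})/(2h)$, $1\le i,j\le B-1$. **Data and the operator $P$.** Data are $G^h=(g_1^h,\dots,g_N^h)^T$ and $F^h=(f_1^h,\dots,f_N^h)^T$ in $C_N^h(\overline{\Omega}_1^h)$, $F^h$ being given at $z=A+\sigma$ only (independent of $z$). $\Phi^h=(G^h,G_x^h,G_y^h,F^h,F_x^h,F_y^h)$. For $W^h=(w_1^h,\dots,w_N^h)^T$ put $$w^h=\sum_{n=1}^Nw_n^h\Psi_n(\alpha),\quad g^h=\sum_{n=1}^Ng_n^h\Psi_n(\alpha),\quad f^h=\sum_{n=1}^Nf_n^h\Psi_n(\alpha),$$ $$u_0^h=\frac{A^2}{(x_i-\alpha)^2+(y_j-1/2)^2+A^2},\qquad u^h=u_0^h+w^h+g^h .$$ $P=(P_1,\dots,P_N)^T$ is defined at interior nodes, whenever $u^h>0$, by $$P_n=\int_0^1\Psi_n(\alpha)\,\partial_\alpha\Big(-\int_z^{A+\sigma}\frac{u_x^h}{2\sqrt{u^h}}(\mathbf{x}^h(t),\alpha)\,dt+f_x^h\Big)^2d\alpha+\int_0^1\Psi_n(\alpha)\,\partial_\alpha\Big(-\int_z^{A+\sigma}\frac{u_y^h}{2\sqrt{u^h}}(\mathbf{x}^h(t),\alpha)\,dt+f_y^h\Big)^2d\alpha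 .$$ **The sets $K^h(R)$.** $K^h(R)$ is the set of $W^h\in H^{1,h}_{0,N}(\Omega_1^h)$ with $\|W^h\|_{H^{1,h}_{0,N}(\Omega_1^h)}<R$ and $(w^h+g^h)(\mathbf{x}^h(z),\alpha)>0$ on $\overline{\Omega}_1^h\times[0,1]$; $\overline{K^h(R)}$ is its closure in $H^{1,h}_{0,N}(\Omega_1^h)$. **The functional.** For $\lambda>0$ and the regularization parameter $\gamma>0$, $$J_{\lambda,\gamma}(W^h)=e^{-2\lambda A}\left\|\left[W^h-M_N^{-1}P(W^h,W_x^h,W_y^h,\Phi^h,\mathbf{x}^h(z))\right]e^{\lambda z}\right\|^2_{L^h_{2,N}(\Omega^h)}+\gamma\|W^h\|^2_{H^{1,h}_{0,N}(\Omega_1^h)}.$$ The Fréchet derivative $J'_{\lambda,\gamma}(W^h)$ is identified with an element of $H^{1,h}_{0,N}(\Omega_1^h)$ by the Riesz theorem, and $J'_{\lambda,\gamma}(W^h)(V)$ denotes its action on $V$ (scalar product in $H^{1,h}_{0,N}(\Omega_1^h)$). *)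

(* Defs.v *)
From HB Require Import structures.
From mathcomp Require Import all_boot all_order all_algebra.
From mathcomp Require Import all_classical all_reals all_analysis.

Set Implicit Arguments.
Unset Strict Implicit.
Unset Printing Implicit Defensive.

Import Order.TTheory GRing.Theory Num.Theory.
Import numFieldNormedType.Exports.

Local Open Scope classical_set_scope.
Local Open Scope ring_scope.

(* Semidiscrete functions [Q k i j z].  Components are numbered from 0; the
   node [(i, j)] is the grid point [(i * h, j * h)], and only the values at
   [i, j <= B] and [z] in [[A, A + sigma]] are ever used. *)
Definition sdfun (R : realType) (N : nat) : Type := 'I_N -> nat -> nat -> R -> R.

Section Basis.
Variables (R : realType) (a : R).
Implicit Types f g : R -> R.

Definition dot01 f g : R :=
  \int[lebesgue_measure]_(x in `[0, 1]) (f x * g x).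

Definition xi (n : nat) : R -> R := fun x => (x + a) ^+ n * expR x.

Definition normalize01 f : R -> R := fun x => f x / Num.sqrt (dot01 f f).

(* The first [n] functions produced by the Gram-Schmidt process. *)
Fixpoint gram_schmidt (n : nat) : seq (R -> R) :=
  if n is m.+1 then
    let s := gram_schmidt m in
    rcons s (normalize01 (fun x => xi m x - \sum_(f <- s) dot01 (xi m) f * f x))
  else [::].

(* [Psi n] is the function written Psi_(n+1) when counting from 1. *)
Definition Psi (n : nat) : R -> R := nth (fun=> 0) (gram_schmidt n.+1) n.

Definition MN (N : nat) : 'M[R]_N :=
  \matrix_(m, n) dot01 (derive1 (Psi n)) (Psi m).

Definition expansion (N : nat) (c : 'I_N -> R) (x : R) : R :=
  \sum_(k < N) c k * Psi k x.

End Basis.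

Section Spaces.
Variables (R : realType) (A sigma h : R) (B N : nat).
Implicit Types (Q V W : sdfun R N) (S : set (sdfun R N)).

Let I : set R := `[A, A + sigma].

Definition CN_space : set (sdfun R N) :=
  [set Q | forall k i j, (i <= B)%N -> (j <= B)%N ->
    {within I, continuous (Q k i j)}].

Definition CN_norm Q : R :=
  sup [set y | exists k i j z,
    [/\ (i <= B)%N, (j <= B)%N, I z & y = `|Q k i j z|] ].

Definition L2_dot Q V : R :=
  \int[lebesgue_measure]_(z in I)
    (h ^+ 2 * \sum_(k < N) \sum_(1 <= i < B) \sum_(1 <= j < B)
       (Q k i j z * V k i j z)).

Definition L2_norm Q : R := Num.sqrt (L2_dot Q Q).

(* [q] is a square integrable weak derivative of [f] on [[A, A + sigma]], [f]
   being the absolutely continuous representative of its Sobolev class. *)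
Definition is_weak_deriv (f q : R -> R) : Prop :=
  [/\ measurable_fun I q,
      lebesgue_measure.-integrable I (fun t => (q t ^+ 2)%:E) &
      forall z, I z ->
        f z = f A + \int[lebesgue_measure]_(t in `[A, z]) q t].

(* The weak derivative is unique up to a null set; one version is chosen. *)
Definition dz Q : sdfun R N :=
  fun k i j => xget (fun=> 0) [set q | is_weak_deriv (Q k i j) q].

Definition H10 : set (sdfun R N) :=
  [set Q | [/\ forall k i j, (i <= B)%N -> (j <= B)%N ->
                 exists q, is_weak_deriv (Q k i j) q,
               forall k i j z, (i <= B)%N -> (j <= B)%N -> I z ->
                 [|| i == 0%N, i == B, j == 0%N | j == B] -> Q k i j z = 0 &
               forall k i j, (i <= B)%N -> (j <= B)%N -> Q k i j A = 0] ].

Definition H1_dot Q V : R := L2_dot Q V + L2_dot (dz Q) (dz V).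

Definition H1_norm Q : R := Num.sqrt (H1_dot Q Q).

Definition H10_closure S : set (sdfun R N) :=
  [set W | H10 W /\
     forall e, 0 < e -> exists V, [/\ S V, H10 V & H1_norm (V - W) < e] ].

(* Frechet differentiability at [W] in the Hilbert space [H10], the derivative
   being represented by [D] as in the Riesz theorem.  Only the values of [J]
   near [W] matter. *)
Definition is_frechet (J : sdfun R N -> R) W (D : sdfun R N) : Prop :=
  H10 D /\
  forall e, 0 < e -> exists2 d, 0 < d &
    forall V, H10 V -> H1_norm V < d ->
      `|J (W + V) - J W - H1_dot D V| <= e * H1_norm V.

Definition frechet_differentiable (J : sdfun R N -> R) W : Prop :=
  exists D, is_frechet J W D.

Definition frechet (J : sdfun R N -> R) W : sdfun R N :=
  xget 0 [set D | is_frechet J W D].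

(* Elements of [H10] are distinct when their distance is positive, since values
   outside the grid and outside [[A, A + sigma]] are irrelevant. *)
Definition strictly_convex_on S (J : sdfun R N -> R) : Prop :=
  forall V W (t : R), S V -> S W -> 0 < t < 1 ->
    S (t *: V + (1 - t) *: W) /\
    (0 < H1_norm (V - W) ->
     J (t *: V + (1 - t) *: W) < t * J V + (1 - t) * J W).

End Spaces.

Section Functional.
Variables (R : realType) (A sigma h : R) (B N : nat) (a : R).
Variables (G : sdfun R N) (F : 'I_N -> nat -> nat -> R).
Implicit Types W : sdfun R N.

Definition diff_x (v : nat -> nat -> R) (i j : nat) : R :=
  (v i.+1 j - v i.-1 j) / (2 * h).

Definition diff_y (v : nat -> nat -> R) (i j : nat) : R :=
  (v i j.+1 - v i j.-1) / (2 * h).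

Definition u0 (i j : nat) (x : R) : R :=
  A ^+ 2 / ((i%:R * h - x) ^+ 2 + (j%:R * h - 2^-1) ^+ 2 + A ^+ 2).

Definition wg W (z x : R) (i j : nat) : R :=
  expansion a (fun k => W k i j z) x + expansion a (fun k => G k i j z) x.

Definition u W (z x : R) (i j : nat) : R := u0 i j x + wg W z x i j.

Definition fser (x : R) (i j : nat) : R := expansion a (fun k => F k i j) x.

(* The expression squared in [P], for the difference operator [d] = [diff_x]
   or [diff_y]. *)
Definition flux (d : (nat -> nat -> R) -> nat -> nat -> R) W
    (i j : nat) (z x : R) : R :=
  - (\int[lebesgue_measure]_(t in `[z, A + sigma])
       (d (u W t x) i j / (2 * Num.sqrt (u W t x i j))))
  + d (fser x) i j.

(* Meaningful when [u] is positive; elsewhere the square root and the division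
   take the default values of the library. *)
Definition P W : sdfun R N := fun n i j z =>
  dot01 (Psi a n) (derive1 (fun x => flux diff_x W i j z x ^+ 2)) +
  dot01 (Psi a n) (derive1 (fun x => flux diff_y W i j z x ^+ 2)).

Definition residual W : sdfun R N := fun k i j z =>
  W k i j z - (invmx (MN a N) *m \col_n P W n i j z) k 0.

Definition J (lambda gamma : R) W : R :=
  expR (- (2 * lambda * A)) *
    L2_norm A sigma h B
      (fun k i j z => residual W k i j z * expR (lambda * z)) ^+ 2
  + gamma * H1_norm A sigma h B W ^+ 2.

Definition K (r : R) : set (sdfun R N) :=
  [set W | [/\ H10 A sigma B W, H1_norm A sigma h B W < r &
     forall i j z x, (i <= B)%N -> (j <= B)%N ->
       z \in `[A, A + sigma] -> x \in `[0, 1] -> 0 < wg W z x i j] ].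

Definition Kbar (r : R) : set (sdfun R N) := H10_closure A sigma h B (K r).

End Functional.

(* A function of the nodes seen as a semidiscrete function constant in [z]. *)
Definition const_z (R : realType) (N : nat) (F : 'I_N -> nat -> nat -> R) :
  sdfun R N := fun k i j _ => F k i j.

(* Submission.v *)
(* For a fixed step the grid has finitely many nodes, so the H1 norm controls
   the sup norm and W |-> M_N^{-1} P(W) is, at each node, a sum of quadratic
   expressions in tail integrals int_z^(A + sigma).  Nonnegativity of w + g
   keeps u away from 0, since u0 has a positive minimum; hence these
   expressions are twice differentiable with uniform bounds on a neighbourhood
   of the admissible set.  This gives the gradient and its Lipschitz estimate.

   Strict convexity is a Carleman estimate.  The first-order and second-order
   increments of M_N^{-1} P are dominated by int_z^(A + sigma) |W2 - W1|^2, and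
   integrating exp (2 lambda z) int_z^(A + sigma) r against z gains a factor
   1 / (2 lambda).  For large lambda they are absorbed by the square of the
   leading term W2 - W1.

   The basis does not depend on a: translating a amounts to a triangular change
   of the generators (x + a)^n exp x with unit diagonal, which Gram-Schmidt does
   not see.  So all constants may be computed for a = 1. *)

Require Import Defs.
From mathcomp Require Import all_boot all_order all_algebra.
From mathcomp Require Import all_classical all_reals all_analysis.
From mathcomp Require Import measurable_realfun ring lra.

Import Order.TTheory GRing.Theory Num.Theory.
Import numFieldNormedType.Exports.

Local Open Scope classical_set_scope.
Local Open Scope ring_scope.

(** [P] differentiates a square in [alpha], while bounds in terms of nodal values of [W] are wanted.
    Integrating by parts once moves the derivative onto [Psi n] ([by_parts]), so sup bounds of the
    flux control [P] and its increments. Three further choices shape the text. Functions given on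
    [[A, A + sigma]] and [[0, 1]] are composed with [clamp]: they become continuous on the line or
    plane and are unchanged where integrals are taken. Weak derivatives are arbitrary versions and
    [frechet] is an arbitrary representer, so identities about them are proved after pairing with a
    test function. The gradient is constructed: exchanging integrals writes the differential as a
    sum over nodes of integrals of a continuous density [m] against [V], and solving [f'' = f - m],
    [f(A) = 0], [f'(A + sigma) = 0] at each node turns the densities into an element of the Hilbert
    space. One exact second-order expansion of [J] serves both differentiability and convexity. *)

Lemma max_lip (R : realFieldType) (a x y : R) : `|Num.max a x - Num.max a y| <= `|x - y|.
Proof.
have [h1 h2] : x - y <= `|x - y| /\ - (x - y) <= `|x - y|.
  by rewrite ler_norm -normrN ler_norm.
rewrite ler_norml; move: `|x - y| h1 h2 => d h1 h2.
by case: (leP a x) => ?; case: (leP a y) => ?; apply/andP; split; lra.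
Qed.

Lemma min_lip (R : realFieldType) (b x y : R) : `|Num.min x b - Num.min y b| <= `|x - y|.
Proof. by rewrite !(minC _ b) -normrN opprD !oppr_min -[leRHS]normrN opprD; exact: max_lip. Qed.

(** * Integrals over compact intervals and the clamping of arguments *)

Section Integrals.
Context {R : realType}.
Implicit Types (f g : R -> R) (a b c : R).
Local Notation mu := (@lebesgue_measure R).

Definition itg a b f := mu.-integrable `[a, b] (EFin \o f).

Lemma continuous_itg f a b : continuous f -> itg a b f.
Proof.
move=> cf; apply: continuous_compact_integrable; first exact: segment_compact.
exact: continuous_subspaceT.
Qed.

Lemma within_itg f a b : {within `[a, b], continuous f} -> itg a b f.
Proof.
by move=> cf; apply: continuous_compact_integrable => //; exact: segment_compact.
Qed.

Lemma eq_itg f g a b : {in `[a, b], f =1 g} -> itg a b f -> itg a b g.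
Proof.
move=> fg; apply: eq_integrable => // x xab.
by rewrite /= fg// -inE.
Qed.

Lemma itgD f g a b : itg a b f -> itg a b g -> itg a b (fun x => f x + g x).
Proof.
move=> fi gi; have := integrableD _ fi gi.
by apply; exact: measurable_itv.
Qed.

Lemma itgZ f a b k : itg a b f -> itg a b (fun x => k * f x).
Proof.
move=> fi; have := @integrableZl _ _ _ mu _ _ k _ fi.
by apply; exact: measurable_itv.
Qed.

Lemma itg_cst a b k : itg a b (fun=> k).
Proof. by apply: continuous_itg => x; exact: cvg_cst. Qed.

Lemma itgS f a b a' b' : a <= a' -> b' <= b -> itg a b f -> itg a' b' f.
Proof.
move=> aa bb; apply: integrableS => // x /=; rewrite !in_itv/= => /andP[ax xb].
by rewrite (le_trans aa ax) (le_trans xb bb).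
Qed.

Lemma itg_sum (T : Type) (s : seq T) (f : T -> R -> R) a b :
  (forall i, itg a b (f i)) -> itg a b (fun x => \sum_(i <- s) f i x).
Proof.
move=> fi; elim: s => [|i s IH].
  by under eq_fun do rewrite big_nil; exact: itg_cst.
by under eq_fun do rewrite big_cons; exact: itgD.
Qed.

Lemma Rint_sum (T : Type) (s : seq T) (f : T -> R -> R) a b :
  (forall i, itg a b (f i)) ->
  \int[mu]_(x in `[a, b]) (\sum_(i <- s) f i x) =
  \sum_(i <- s) \int[mu]_(x in `[a, b]) f i x.
Proof.
move=> fi; elim: s => [|i s IH].
  rewrite big_nil -[RHS](mul0r (fine (mu `[a, b]%classic))).
  by rewrite -Rintegral_cst//; apply: eq_Rintegral => x _; rewrite big_nil.
rewrite big_cons -IH -RintegralD //; first last.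
- exact: itg_sum.
- exact: fi.
by apply: eq_Rintegral => x _; rewrite big_cons.
Qed.

Lemma itgD_E f g a b : itg a b f -> itg a b g ->
  \int[mu]_(x in `[a, b]) (f x + g x) =
  \int[mu]_(x in `[a, b]) f x + \int[mu]_(x in `[a, b]) g x.
Proof. by move=> fi gi; rewrite RintegralD. Qed.

Lemma itgZ_E f a b k : itg a b f ->
  \int[mu]_(x in `[a, b]) (k * f x) = k * \int[mu]_(x in `[a, b]) f x.
Proof. by move=> fi; rewrite RintegralZl. Qed.

Lemma itgB f g a b : itg a b f -> itg a b g -> itg a b (fun x => f x - g x).
Proof.
move=> fi gi; apply: (@eq_itg (fun x => f x + -1 * g x)).
  by move=> x _ /=; rewrite mulN1r.
by apply: itgD => //; exact: itgZ.
Qed.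

Lemma itgB_E f g a b : itg a b f -> itg a b g ->
  \int[mu]_(x in `[a, b]) (f x - g x) =
  \int[mu]_(x in `[a, b]) f x - \int[mu]_(x in `[a, b]) g x.
Proof. by move=> fi gi; rewrite RintegralB. Qed.

Lemma itgN_E f a b : itg a b f ->
  \int[mu]_(x in `[a, b]) (- f x) = - \int[mu]_(x in `[a, b]) f x.
Proof.
move=> fi; rewrite -mulN1r -itgZ_E//.
by apply: eq_Rintegral => x _; rewrite mulN1r.
Qed.

Lemma le_itg f g a b : itg a b f -> itg a b g ->
  (forall x, a <= x <= b -> f x <= g x) ->
  \int[mu]_(x in `[a, b]) f x <= \int[mu]_(x in `[a, b]) g x.
Proof.
move=> fi gi fg; apply: le_Rintegral => // x /=; rewrite in_itv/=; exact: fg.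
Qed.

Lemma Rint_cst a b k : a <= b -> \int[mu]_(x in `[a, b]) k = k * (b - a).
Proof.
move=> ab; have E : mu `[a, b]%classic = (b - a)%:E.
  rewrite lebesgue_measure_itv/= lte_fin.
  by case: ltgtP ab => // -> _; rewrite subrr.
by rewrite Rintegral_cst//= E.
Qed.

Lemma norm_itg_le f g a b : itg a b f -> itg a b g ->
  (forall x, a <= x <= b -> `|f x| <= g x) ->
  `|\int[mu]_(x in `[a, b]) f x| <= \int[mu]_(x in `[a, b]) g x.
Proof.
move=> fi gi fg; rewrite ler_norml -itgN_E//; apply/andP; split.
  apply: le_itg => //.
    by apply: (eq_itg _ _ _ _ _ (itgZ _ _ _ (-1) gi)) => x _; rewrite mulN1r.
  by move=> x /fg; rewrite ler_norml => /andP[].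
by apply: le_itg => // x /fg; rewrite ler_norml => /andP[].
Qed.

Lemma itg_split f a c b : a <= c -> c <= b -> itg a b f ->
  \int[mu]_(x in `[a, b]) f x =
  \int[mu]_(x in `[a, c]) f x + \int[mu]_(x in `[c, b]) f x.
Proof.
move=> ac cb fi.
have := @Rintegral_itvB _ f (BLeft a) (BRight b) c fi.
rewrite !bnd_simp => /(_ ac cb) E.
rewrite -(@Rintegral_itv_obnd_cbnd _ c (BRight b)); last first.
  apply: integrableS fi => //; apply: subset_itvr.
  by rewrite bnd_simp.
by rewrite -E addrC subrK.
Qed.

Lemma Rint_point f a : \int[mu]_(x in `[a, a]) f x = 0.
Proof. by rewrite set_itv1 Rintegral_set1. Qed.

(* Composing with [clamp a b] turns a function continuous within [[a, b]] into a
   continuous function on the line, and leaves its integrals over [[a, b]] alone. *)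
Definition clamp a b x := Num.max a (Num.min x b).

Lemma clamp_itv a b x : a <= b -> a <= clamp a b x <= b.
Proof. by move=> ab; rewrite /clamp le_max lexx/= ge_max ab/= ge_min lexx orbT. Qed.

Lemma clamp_id a b x : a <= x <= b -> clamp a b x = x.
Proof. by move=> /andP[ax xb]; rewrite /clamp min_l// max_r. Qed.

Lemma clamp_lip a b x y : `|clamp a b x - clamp a b y| <= `|x - y|.
Proof. by rewrite /clamp; apply: (le_trans (max_lip _ _ _ _)); exact: min_lip. Qed.

Lemma clamp_continuous a b : continuous (clamp a b).
Proof.
move=> x; apply/cvgrPdist_le => e e0.
have : \forall y \near x, `|x - y| <= e by exact: (@cvgr_dist_le _ _ _ (nbhs x) _ id x (@cvg_id _ (nbhs x)) e e0).
by apply: filterS => y; exact: le_trans (clamp_lip _ _ _ _).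
Qed.

Lemma clamp_comp_continuous a b f : a <= b -> {within `[a, b], continuous f} ->
  continuous (f \o clamp a b).
Proof.
move=> ab cf x.
have /subspace_continuousP/(_ (clamp a b x)) := cf.
rewrite /= in_itv/= clamp_itv// => /(_ isT) /cvgrPdist_le H.
apply/cvgrPdist_le => e e0; have := H e e0.
move=> /(clamp_continuous a b x) Hx.
near=> y; have : `[a, b]%classic (clamp a b y) by rewrite /= in_itv/= clamp_itv.
rewrite /=; near: y; exact: Hx.
Unshelve. all: by end_near. Qed.

End Integrals.

(** * Continuous real functions on a topological space *)

Section ContinuousRealValued.
Context {R : realType} {T : topologicalType}.
Implicit Types (f g : T -> R).

Lemma ct_cst (k : R) : continuous (fun _ : T => k).
Proof. by move=> x; exact: cvg_cst. Qed.

Lemma ctD f g : continuous f -> continuous g -> continuous (fun x => f x + g x).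
Proof. by move=> cf cg x; apply: cvgD; [exact: cf|exact: cg]. Qed.

Lemma ctB f g : continuous f -> continuous g -> continuous (fun x => f x - g x).
Proof. by move=> cf cg x; apply: cvgB; [exact: cf|exact: cg]. Qed.

Lemma ctN f : continuous f -> continuous (fun x => - f x).
Proof. by move=> cf x; apply: cvgN; exact: cf. Qed.

Lemma ctM f g : continuous f -> continuous g -> continuous (fun x => f x * g x).
Proof. by move=> cf cg x; apply: cvgM; [exact: cf|exact: cg]. Qed.

Lemma ctZ (k : R) f : continuous f -> continuous (fun x => k * f x).
Proof. by move=> cf; apply: ctM => //; exact: ct_cst. Qed.

Lemma ctX f n : continuous f -> continuous (fun x => f x ^+ n).
Proof.
move=> cf; elim: n => [|n IH].
  by under eq_fun do rewrite expr0; exact: ct_cst.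
by under eq_fun do rewrite exprS; exact: ctM.
Qed.

Lemma ctV f : continuous f -> (forall x, f x != 0) ->
  continuous (fun x => (f x)^-1).
Proof. by move=> cf f0 x; apply: cvgV => //; exact: cf. Qed.

Lemma ct_sqrt f : continuous f -> continuous (fun x => Num.sqrt (f x)).
Proof.
by move=> cf x; apply: continuous_comp; [exact: cf|exact: sqrt_continuous].
Qed.

Lemma ct_comp (T' : topologicalType) (g : T' -> T) f :
  continuous g -> continuous f -> continuous (fun x => f (g x)).
Proof. by move=> cg cf x; apply: continuous_comp; [exact: cg|exact: cf]. Qed.

Lemma ct_sum (I : Type) (s : seq I) (f : I -> T -> R) :
  (forall i, continuous (f i)) -> continuous (fun x => \sum_(i <- s) f i x).
Proof.
move=> cf; elim: s => [|i s IH].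
  by under eq_fun do rewrite big_nil; exact: ct_cst.
by under eq_fun do rewrite big_cons; exact: ctD.
Qed.

End ContinuousRealValued.

Lemma ct_pair (T U V : topologicalType) (f : T -> U) (g : T -> V) :
  continuous f -> continuous g -> continuous (fun x => (f x, g x)).
Proof. by move=> cf cg x; exact: (cvg_pair (cf x) (cg x)). Qed.

(** * Jointly continuous functions and parameter integrals *)

Section JointlyContinuous.
Context {R : realType}.
Implicit Types (f g : R -> R -> R) (a b c d : R).
Local Notation mu := (@lebesgue_measure R).

(** Stated on the whole plane: clamped data qualify, and the closure rules are instances of those
    for real functions on the topological space [R * R]. *)
Definition joint_cont f := continuous (fun y : R * R => f y.1 y.2).

Lemma jc_cst (k : R) : joint_cont (fun _ _ => k).
Proof. exact: ct_cst. Qed.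

Lemma jcD f g : joint_cont f -> joint_cont g -> joint_cont (fun t x => f t x + g t x).
Proof. exact: ctD. Qed.

Lemma jcB f g : joint_cont f -> joint_cont g -> joint_cont (fun t x => f t x - g t x).
Proof. exact: ctB. Qed.

Lemma jcM f g : joint_cont f -> joint_cont g -> joint_cont (fun t x => f t x * g t x).
Proof. exact: ctM. Qed.

Lemma jcN f : joint_cont f -> joint_cont (fun t x => - f t x).
Proof. exact: ctN. Qed.

Lemma jcZ k f : joint_cont f -> joint_cont (fun t x => k * f t x).
Proof. exact: ctZ. Qed.

Lemma jc1 (f : R -> R) : continuous f -> joint_cont (fun t _ => f t).
Proof. by move=> cf; apply: ct_comp cf => y; exact: cvg_fst. Qed.

Lemma jc2 (f : R -> R) : continuous f -> joint_cont (fun _ x => f x).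
Proof. by move=> cf; apply: ct_comp cf => y; exact: cvg_snd. Qed.

Lemma jc_sum (I : Type) (s : seq I) (f : I -> R -> R -> R) :
  (forall i, joint_cont (f i)) -> joint_cont (fun t x => \sum_(i <- s) f i t x).
Proof. exact: (@ct_sum R _ I s (fun i y => f i y.1 y.2)). Qed.

Lemma jc_swap f : joint_cont f -> joint_cont (fun x t => f t x).
Proof.
move=> cf y; apply: (@continuous_comp _ _ _ (fun z : R * R => (z.2, z.1))
  (fun z : R * R => f z.1 z.2)); last exact: cf.
by apply: ct_pair => z; [exact: cvg_snd|exact: cvg_fst].
Qed.

Lemma jc_slice1 f x : joint_cont f -> continuous (fun t => f t x).
Proof.
move=> cf t; apply: (@continuous_comp _ _ _ (fun t : R => (t, x))
  (fun z : R * R => f z.1 z.2)); last exact: cf.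
by apply: ct_pair => z; [exact: cvg_id|exact: cvg_cst].
Qed.

Lemma jc_slice2 f t : joint_cont f -> continuous (f t).
Proof. by move=> /jc_swap /jc_slice1; exact. Qed.

Lemma jc_bound f a b c d : joint_cont f -> exists2 K, 0 <= K &
  forall t x, a <= t <= b -> c <= x <= d -> `|f t x| <= K.
Proof.
move=> cf; have [ab|ba] := leP a b; last first.
  by exists 0 => // t x /andP[/le_trans h /h]; rewrite leNgt ba.
have [cd|dc] := leP c d; last first.
  by exists 0 => // t x _ /andP[/le_trans h /h]; rewrite leNgt dc.
have K : compact (`[a, b]%classic `*` `[c, d]%classic : set (R * R)).
  by apply: compact_setX; exact: segment_compact.
have cn : continuous (fun y : R * R => `|f y.1 y.2|).
  by move=> y; apply: continuous_comp; [exact: cf|exact: norm_continuous].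
have ne : (`[a, b]%classic `*` `[c, d]%classic : set (R * R)) !=set0.
  by exists (a, c); split; rewrite /= in_itv/= lexx.
have [y _ yP] := compact_EVT_max ne K (continuous_subspaceT cn).
exists `|f y.1 y.2| => // t x tab xcd.
by apply: (yP (t, x)); rewrite inE; split; rewrite /= in_itv.
Qed.

Lemma bounded_itg a b (f : R -> R) : continuous f ->
  exists2 K, 0 <= K & forall t, a <= t <= b -> `|f t| <= K.
Proof.
move=> /jc1/(jc_bound _ a b 0 0)[K K0 H]; exists K => // t tab.
by apply: (H t 0 tab); rewrite lexx.
Qed.

(** Dominated convergence: near [x] the integrand is bounded by a constant, obtained by compactness
    on [[a, b]] times the interval of half-width 1 about [x]. *)
Lemma continuous_int f a b : joint_cont f ->
  continuous (fun x => \int[mu]_(t in `[a, b]) f t x).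
Proof.
move=> cf x.
have [K K0 HK] := jc_bound _ a b (x - 1) (x + 1) cf.
have mab : measurable (`[a, b]%classic : set (measurableTypeR R)) by [].
pose f' (x : R) (t : R) := f t x.
have xI : x \in `](x - 1), (x + 1)[%classic by rewrite inE/= in_itv/=; apply/andP; split; lra.
apply: (@continuity_under_integral _ _ _ mu f' _ mab (x - 1) (x + 1) _ _
  (cst K) _ _ x xI).
- by move=> y _; apply: continuous_itg; exact: jc_slice1.
- by apply: aeW => t _ y _; exact: jc_slice2.
- by apply: continuous_itg; exact: ct_cst.
move=> y; rewrite /= in_itv/= => /andP[y1 y2]; apply: aeW => t.
by rewrite /= in_itv/= => tab; apply: HK => //; rewrite !ltW.
Qed.

Lemma int_lipl (f : R -> R) a b c c' K : continuous f ->
  (forall t, a <= t <= b -> `|f t| <= K) -> a <= c <= b -> a <= c' <= b ->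
  `|\int[mu]_(t in `[c, b]) f t - \int[mu]_(t in `[c', b]) f t| <=
  K * `|c - c'|.
Proof.
move=> cf HK; wlog cc : c c' / c <= c'.
  move=> H; have [/H//|/ltW c'c h h'] := leP c c'.
  by rewrite distrC (distrC c) H.
move=> /andP[ac cb] /andP[ac' c'b].
rewrite (itg_split _ _ _ _ cc c'b); last exact: continuous_itg.
rewrite addrK (distrC c) [`|c' - c|]ger0_norm ?subr_ge0//.
rewrite -[leRHS](Rint_cst c c' K)//; apply: norm_itg_le.
- exact: continuous_itg.
- exact: itg_cst.
by move=> t /andP[ct tc']; apply: HK; rewrite (le_trans ac ct) (le_trans tc').
Qed.

(** The two variables are moved one after the other: first [x] at the fixed height [z0], by
    continuity of a parameter integral, then the lower limit, where a bound [K] valid for all [x]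
    within 1 of [x0] gives a Lipschitz estimate. The clamp keeps the lower limit in [[a, b]], so the
    statement holds for every [z]. *)
Lemma jc_int_tail f a b : a <= b -> joint_cont f ->
  joint_cont (fun z x => \int[mu]_(t in `[clamp a b z, b]) f t x).
Proof.
move=> ab cf [z0 x0].
have [K K0 HK] := jc_bound _ a b (x0 - 1) (x0 + 1) cf.
set g := fun z x : R => \int[mu]_(t in `[clamp a b z, b]) f t x.
apply/cvgrPdist_le => e e0 /=.
have c0 : continuous (g z0) by exact: continuous_int.
have e2 : 0 < e / 2 by rewrite divr_gt0.
have H1 : \forall x \near x0, `|g z0 x0 - g z0 x| <= e / 2.
  by exact: (@cvgr_dist_le _ _ _ (nbhs x0) _ (g z0) _ (c0 x0) (e / 2) e2).
have H2 : \forall x \near x0, `|x0 - x| <= 1.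
  by exact: (@cvgr_dist_le _ _ _ (nbhs x0) _ id x0 (@cvg_id _ (nbhs x0)) 1 ltr01).
(* [K + 1] keeps the quotient meaningful when [K = 0]. *)
have ek : 0 < e / 2 / (K + 1) by rewrite divr_gt0// ltr_wpDl.
have H3 : \forall z \near z0, `|z0 - z| <= e / 2 / (K + 1).
  by exact: (@cvgr_dist_le _ _ _ (nbhs z0) _ id z0 (@cvg_id _ (nbhs z0)) _ ek).
have H12 := filterI H1 H2.
exists ([set z : R | `|z0 - z| <= e / 2 / (K + 1)],
        [set x : R | `|g z0 x0 - g z0 x| <= e / 2] `&` [set x : R | `|x0 - x| <= 1]).
  by split; [exact: H3|exact: H12].
move=> [z x] /= [zz [xx x1]].
have -> : g z0 x0 - g z x = (g z0 x0 - g z0 x) + (g z0 x - g z x).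
  by rewrite addrA subrK.
rewrite (le_trans (ler_normD _ _))// [leRHS](splitr e) lerD//.
apply: (le_trans (int_lipl (fun t => f t x) a b _ _ K _ _ _ _)).
- exact: jc_slice1.
- by move=> t tab; apply: HK => //; move: x1; rewrite ler_norml; lra.
- exact: clamp_itv.
- exact: clamp_itv.
apply: (@le_trans _ _ (K * (e / 2 / (K + 1)))).
  by rewrite ler_wpM2l// (le_trans (clamp_lip _ _ _ _)).
have K1 : 0 < K + 1 by rewrite ltr_wpDl.
rewrite mulrA ler_pdivrMr//; nra.
Qed.

End JointlyContinuous.

(** * Fundamental theorem of calculus and exchange of integrals *)

Section Calculus.
Context {R : realType}.
Implicit Types (f g F : R -> R) (a b c d : R).
Local Notation mu := (@lebesgue_measure R).

Lemma derivable_is_derive F (x l : R) : derivable F x 1 -> derive1 F x = l -> is_derive x 1 F l.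
Proof. by move=> dF <-; rewrite derive1E; apply: DeriveDef. Qed.

Lemma is_derive_continuous F (x l : R) : is_derive x 1 F l -> {for x, continuous F}.
Proof. by move=> [dF _]; apply: differentiable_continuous; exact/derivable1_diffP. Qed.

(** The derivative is two-sided, hence the strict inequality. This is why primitives on [[a, b]] are
    started at [a - 1] below: they are then differentiable at [a] as well. *)
Lemma ftc1 f a (x : R) : continuous f -> a < x ->
  is_derive x 1 (fun y => \int[mu]_(t in `[a, y]) f t) (f x).
Proof.
move=> cf ax; have x1 : x < x + 1 by rewrite ltrDl.
have [dF FE] := continuous_FTC1_closed x1 (continuous_itg f a (x + 1) cf) ax (cf x).
exact: derivable_is_derive.
Qed.

Lemma ftc2 F f a b : a <= b -> {within `[a, b], continuous f} ->
  (forall x, a < x < b -> is_derive x 1 F (f x)) ->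
  {within `[a, b], continuous F} ->
  \int[mu]_(x in `[a, b]) f x = F b - F a.
Proof.
rewrite le_eqVlt => /predU1P[->|ab] cf dF cF; first by rewrite Rint_point subrr.
have [c1 c2 c3] := (continuous_within_itvP _ ab).1 cF.
have Foo : derivable_oo_LRcontinuous F a b.
  split => // x; rewrite in_itv/= => xab.
  by have [] := dF x xab.
rewrite /Rintegral (continuous_FTC2 ab cf Foo)// => x.
by rewrite in_itv/= => /dF xab; rewrite derive1E; exact: derive_val.
Qed.

Lemma ftc2T F f a b : a <= b -> continuous f ->
  (forall x, a <= x <= b -> is_derive x 1 F (f x)) ->
  \int[mu]_(x in `[a, b]) f x = F b - F a.
Proof.
move=> ab cf dF; apply: ftc2 => //.
- exact: continuous_subspaceT.
- by move=> x /andP[? ?]; apply: dF; rewrite !ltW.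
apply/subspace_continuousP => x; rewrite /= in_itv/= => /dF/is_derive_continuous.
exact: cvg_within_filter.
Qed.

Lemma prim_sub f a c b : continuous f -> a <= c -> c <= b ->
  \int[mu]_(t in `[a, b]) f t - \int[mu]_(t in `[a, c]) f t =
  \int[mu]_(t in `[c, b]) f t.
Proof.
by move=> cf ac cb; rewrite (itg_split f a c b)//; [ring|exact: continuous_itg].
Qed.

(** Both sides are compared through [G s], the integral over [y] of the primitive in [x] up to [s]:
    differentiating under the integral sign gives the inner integral at [s], and the fundamental
    theorem of calculus integrates it back from [a] to [b]. *)
Lemma fubini_jc (f : R -> R -> R) a b c d : joint_cont f -> a <= b ->
  \int[mu]_(x in `[a, b]) (\int[mu]_(y in `[c, d]) f x y) =
  \int[mu]_(y in `[c, d]) (\int[mu]_(x in `[a, b]) f x y).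
Proof.
move=> cf ab.
pose G (s : R) := \int[mu]_(y in `[c, d]) (\int[mu]_(x in `[(a - 1), s]) f x y).
have cs := jc_swap _ cf.
have jt s : continuous (fun y => \int[mu]_(x in `[(a - 1), s]) f x y).
  exact: continuous_int.
have -> : \int[mu]_(y in `[c, d]) (\int[mu]_(x in `[a, b]) f x y) = G b - G a.
  rewrite /G -itgB_E//; try exact: continuous_itg.
  apply: eq_Rintegral => y _; rewrite prim_sub//; last lra.
  by move=> t; exact: (jc_slice1 _ _ cf).
apply: ftc2T => //.
  have := continuous_int _ c d cs; exact.
move=> s /andP[as_ sb].
pose f' (s : R) (y : R) := \int[mu]_(x in `[(a - 1), s]) f x y.
have [K K0 HK] := jc_bound _ (a - 1) (b + 1) c d cf.
have mcd : measurable (`[c, d]%classic : set (measurableTypeR R)) by [].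
have Is : `]a - 1, b + 1[%classic s by rewrite /= in_itv/=; apply/andP; split; lra.
have df' x y : x \in `]a - 1, b + 1[ -> is_derive x 1 (f'^~ y) (f x y).
  rewrite in_itv/= => /andP[ax xb]; apply: ftc1 => //.
  exact: (jc_slice1 _ _ cf).
have i1 x : `]a - 1, b + 1[%classic x -> mu.-integrable `[c, d] (EFin \o f' x).
  by move=> _; apply: continuous_itg; exact: jt.
have i2 x y : `]a - 1, b + 1[%classic x -> `[c, d]%classic y -> derivable (f'^~ y) x 1.
  by move=> /df' H _; case: (H y).
have i3 x y : `]a - 1, b + 1[%classic x -> `[c, d]%classic y -> `|partial1of2 f' x y| <= K.
  move=> xI; rewrite /= in_itv/= => ycd; rewrite partial1of2E.
  rewrite (@derive_val _ _ _ _ _ _ _ (df' x y xI)); apply: HK => //.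
  by move: xI; rewrite /= in_itv/= => /andP[? ?]; rewrite !ltW.
have K0' (y : R) : 0 <= cst K y by [].
have iK : mu.-integrable `[c, d] (EFin \o cst K) by apply: continuous_itg; exact: ct_cst.
have D := derivable_under_integral mcd Is i1 i2 K0' iK i3.
have E := differentiation_under_integral mcd Is i1 i2 K0' iK i3.
apply: derivable_is_derive; first exact: D.
rewrite -[LHS]/(derive1 (fun x => \int[mu]_(y in `[c, d]) f' x y) s) E.
apply: eq_Rintegral => y _; rewrite partial1of2E.
by rewrite (@derive_val _ _ _ _ _ _ _ (df' s y Is)).
Qed.

(** Fubini on the triangle [a <= t <= z <= b], obtained by integrating a derivative: with primitives
    [A] of [s] and [Q] of [r], the product [(A b - A z) * (Q z - Q a)] vanishes at both ends, and
    the two terms of its derivative are, up to sign, the two integrands. *)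
Lemma triangle_continuous (r s : R -> R) a b : continuous r -> continuous s -> a <= b ->
  \int[mu]_(z in `[a, b]) (s z * \int[mu]_(t in `[a, z]) r t) =
  \int[mu]_(t in `[a, b]) (r t * \int[mu]_(z in `[t, b]) s z).
Proof.
move=> cr cs ab.
pose A z := \int[mu]_(t in `[a - 1, z]) s t.
pose Q z := \int[mu]_(t in `[a - 1, z]) r t.
have dA z : a <= z <= b -> is_derive z 1 A (s z).
  by move=> /andP[az _]; apply: ftc1 => //; lra.
have dQ z : a <= z <= b -> is_derive z 1 Q (r z).
  by move=> /andP[az _]; apply: ftc1 => //; lra.
have ftail (f : R -> R) : continuous f ->
    continuous (fun z => \int[mu]_(t in `[clamp a b z, b]) f t).
  move=> cf; have := jc_int_tail (fun t _ => f t) _ _ ab (jc1 _ cf).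
  by move/jc_slice1 => /(_ 0).
have cA : continuous (fun z => s z * (A b - A a - \int[mu]_(t in `[clamp a b z, b]) s t)).
  by apply: ctM => //; apply: ctB; [exact: ct_cst|exact: ftail].
have cE : continuous (fun z => r z * \int[mu]_(t in `[clamp a b z, b]) s t
   - s z * (Q b - Q a - \int[mu]_(t in `[clamp a b z, b]) r t)).
  apply: ctB; apply: ctM => //; first exact: ftail.
  by apply: ctB; [exact: ct_cst|exact: ftail].
have c1 : continuous (fun z => r z * \int[mu]_(t in `[clamp a b z, b]) s t).
  by apply: ctM => //; exact: ftail.
have c2 : continuous (fun z => s z * (Q b - Q a - \int[mu]_(t in `[clamp a b z, b]) r t)).
  by apply: ctM => //; apply: ctB; [exact: ct_cst|exact: ftail].
have tl (f : R -> R) z : continuous f -> a <= z <= b ->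
   \int[mu]_(t in `[a - 1, b]) f t - \int[mu]_(t in `[a - 1, z]) f t =
   \int[mu]_(t in `[clamp a b z, b]) f t.
  by move=> cf zab; rewrite (clamp_id a b)// prim_sub//; move: zab; lra.
have := @ftc2T (fun z => (A b - A z) * (Q z - Q a)) _ a b ab cE.
have dE z : a <= z <= b -> is_derive z 1 (fun z => (A b - A z) * (Q z - Q a))
   (r z * \int[mu]_(t in `[clamp a b z, b]) s t
   - s z * (Q b - Q a - \int[mu]_(t in `[clamp a b z, b]) r t)).
  move=> zab; have [d1 d2] := (dA z zab, dQ z zab).
  apply: is_derive_eq.
  rewrite -(tl s)// -(tl r)// /A /Q /GRing.scale/=; ring.
move=> /(_ dE); rewrite !subrr mulr0 mul0r subrr.
rewrite itgB_E; [|exact: continuous_itg..].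
move/eqP; rewrite subr_eq0 eq_sym => /eqP E.
transitivity (\int[mu]_(z in `[a, b]) (s z * (Q b - Q a - \int[mu]_(t in `[clamp a b z, b]) r t))).
  apply: eq_Rintegral => z; rewrite inE/= in_itv/= => zab; congr (_ * _).
  have /andP[az zb] := zab.
  rewrite -(tl r)// -(prim_sub r (a - 1) a z)//; last by lra.
  by rewrite /Q; ring.
rewrite E; apply: eq_Rintegral => z; rewrite inE/= in_itv/= => zab.
by rewrite clamp_id.
Qed.

End Calculus.

(** * Square integrable functions and the Carleman weight *)

Section SquareIntegrable.
Context {R : realType}.
Implicit Types (f g : R -> R) (a b c d : R).
Local Notation mu := (@lebesgue_measure R).

Definition sq_integrable a b f := measurable_fun `[a, b] f /\ itg a b (fun t => f t ^+ 2).

Lemma itg_measurable a b f : itg a b f -> measurable_fun `[a, b] f.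
Proof. by move=> /integrableP[/measurable_EFinP]. Qed.

Lemma sqi_mul a b f g : sq_integrable a b f -> sq_integrable a b g -> itg a b (fun t => f t * g t).
Proof.
move=> [mf f2] [mg g2]; have fg := itgD _ _ _ _ f2 g2.
have mab : measurable (`[a, b]%classic : set (measurableTypeR R)) by [].
apply: (le_integrable mab _ _ fg).
  by apply/measurable_EFinP; exact: measurable_funM.
move=> x _ /=; rewrite lee_fin [leRHS]ger0_norm ?addr_ge0 ?sqr_ge0//.
by rewrite ler_norml; apply/andP; split; nra.
Qed.

Lemma sqiD a b f g : sq_integrable a b f -> sq_integrable a b g -> sq_integrable a b (fun t => f t + g t).
Proof.
move=> sf sg; have fg := sqi_mul _ _ _ _ sf sg.
case: sf sg => [mf f2] [mg g2]; split; first exact: measurable_funD.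
apply: (@eq_itg _ (fun t => f t ^+ 2 + (2 * (f t * g t) + g t ^+ 2))).
  by move=> t _ /=; ring.
by apply: itgD => //; apply: itgD => //; exact: itgZ.
Qed.

Lemma sqiZ a b k f : sq_integrable a b f -> sq_integrable a b (fun t => k * f t).
Proof.
move=> [mf f2]; split; first by apply: measurable_funM => //.
apply: (@eq_itg _ (fun t => k ^+ 2 * f t ^+ 2)); last exact: itgZ.
by move=> t _ /=; ring.
Qed.

Lemma sqi_within a b f : {within `[a, b], continuous f} -> sq_integrable a b f.
Proof.
move=> cf; split; first exact: itg_measurable (within_itg _ _ _ cf).
apply: within_itg => x; apply: (@continuousM R (subspace `[a, b])); exact: cf.
Qed.

Lemma sqi_continuous a b f : continuous f -> sq_integrable a b f.
Proof. by move=> cf; apply: sqi_within; exact: continuous_subspaceT. Qed.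

Lemma sqi_itg a b f : sq_integrable a b f -> itg a b f.
Proof.
move=> sf; have := sqi_mul _ _ _ _ sf (sqi_continuous a b _ (ct_cst 1)).
by apply: eq_itg => t _; rewrite mulr1.
Qed.

Lemma sqiS a b a' b' f : a <= a' -> b' <= b -> sq_integrable a b f -> sq_integrable a' b' f.
Proof.
move=> aa bb [mf f2]; split; last exact: itgS f2.
apply: measurable_funS mf => // x /=; rewrite !in_itv/= => /andP[ax xb].
by rewrite (le_trans aa ax) (le_trans xb bb).
Qed.

(** Cauchy-Schwarz against the constant 1: expand the nonnegative integral of [(f - k) ^+ 2], where
    [k] is the mean of [f] over [[a, b]]. *)
Lemma int_sqr_le a b f : a <= b -> sq_integrable a b f ->
  (\int[mu]_(t in `[a, b]) f t) ^+ 2 <=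
  (b - a) * \int[mu]_(t in `[a, b]) f t ^+ 2.
Proof.
rewrite le_eqVlt => /predU1P[<- _|ab sf].
  by rewrite !Rint_point subrr mul0r expr0n.
have [fi [_ f2]] := (sqi_itg _ _ _ sf, sf).
set m := \int[mu]_(t in _) f t; set n := \int[mu]_(t in _) (f t ^+ 2).
have L0 : 0 < b - a by rewrite subr_gt0.
pose k := m / (b - a).
have E : \int[mu]_(t in `[a, b]) (f t ^+ 2 + (- (2 * k) * f t + k ^+ 2)) =
   n + (- (2 * k) * m + k ^+ 2 * (b - a)).
  have i1 := itgZ _ a b (- (2 * k)) fi.
  have i2 := @itg_cst _ a b (k ^+ 2); have i3 := itgD _ _ _ _ i1 i2.
  by rewrite (itgD_E _ _ _ _ f2 i3) (itgD_E _ _ _ _ i1 i2) (itgZ_E _ _ _ _ fi) (Rint_cst a b)// ltW.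
have : 0 <= n + (- (2 * k) * m + k ^+ 2 * (b - a)).
  rewrite -E; apply: Rintegral_ge0 => t _.
  have -> : f t ^+ 2 + (- (2 * k) * f t + k ^+ 2) = (f t - k) ^+ 2 by ring.
  exact: sqr_ge0.
have mE : m = k * (b - a) by rewrite /k divfK// gt_eqF.
rewrite mE; nra.
Qed.

Lemma itg_mulc a b f g : itg a b f -> continuous g -> itg a b (fun t => f t * g t).
Proof.
move=> fi cg.
have mab : measurable (`[a, b]%classic : set (measurableTypeR R)) by [].
have [K K0 HK] := bounded_itg a b g cg.
apply: (integrableMl mab fi).
  exact: itg_measurable (continuous_itg g a b cg).
exists K; split; first exact: num_real.
move=> M KM t /=; rewrite in_itv/= => /HK; move=> /le_trans; apply; exact: ltW.
Qed.

Lemma int_head_within a b f : a <= b -> itg a b f ->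
  {within `[a, b], continuous (fun z => \int[mu]_(t in `[a, z]) f t)}.
Proof. exact: parameterized_integral_continuous. Qed.

(** Weak derivatives are merely integrable, so the continuous case is extended by density: both
    sides depend continuously on [r] in the norm of L1, and continuous functions are dense there. *)
Lemma triangle_itg (r s : R -> R) a b : itg a b r -> continuous s -> a <= b ->
  \int[mu]_(z in `[a, b]) (s z * \int[mu]_(t in `[a, z]) r t) =
  \int[mu]_(t in `[a, b]) (r t * \int[mu]_(z in `[t, b]) s z).
Proof.
move=> ri cs ab.
have mab : measurable (`[a, b]%classic : set (measurableTypeR R)) by [].
pose S t := \int[mu]_(z in `[clamp a b t, b]) s z.
have cS : continuous S.
  have := jc_int_tail (fun t _ => s t) _ _ ab (jc1 _ cs).
  by move/jc_slice1 => /(_ 0).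
have SE (f : R -> R) : \int[mu]_(t in `[a, b]) (f t * \int[mu]_(z in `[t, b]) s z) =
    \int[mu]_(t in `[a, b]) (f t * S t).
  by apply: eq_Rintegral => t; rewrite inE/= in_itv/= => tab; rewrite /S clamp_id.
rewrite SE.
have [K K0 HK] := bounded_itg a b s cs.
have [K' K0' HK'] := bounded_itg a b S cS.
set X := LHS; set Y := RHS.
suff H e : 0 < e -> `|X - Y| <= e.
  apply/eqP; rewrite -subr_eq0 -normr_le0; apply/ler_addgt0Pl => e e0.
  by rewrite addr0 H.
move=> e0.
(* [K * (b - a)] and [K'] are the L1 Lipschitz constants of the two sides; the extra 1 makes [C]
   positive, and the total error is at most [(C - 1) * (e / C)]. *)
pose C := K * (b - a) + K' + 1.
have C0 : 0 < C by rewrite /C ltr_wpDl// addr_ge0// mulr_ge0// subr_ge0.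
have mu_fin : (mu `[a, b]%classic < +oo)%E.
  by rewrite lebesgue_measure_itv/=; case: ifP => // _; rewrite ltry.
have [g_ [cg gi gl]] := approximation_continuous_integrable mab mu_fin ri.
have [n Hn] : exists n, \int[mu]_(z in `[a, b]) `|r z - g_ n z| <= e / C.
  have eC : 0 < e / C by rewrite divr_gt0.
  have [_ /cvgrPdist_le/(_ _ eC)[n _ /(_ n (leqnn n))]] := (fine_cvgP _ _).1 gl.
  rewrite sub0r normrN /= => Hn; exists n.
  by apply: le_trans Hn; rewrite /Rintegral ler_norm.
set g := g_ n in Hn.
have gcont : continuous g by exact: cg.
have gI : itg a b g by exact: continuous_itg.
have := triangle_continuous _ _ _ _ gcont cs ab; rewrite SE => T.
have rg : itg a b (fun t => r t - g t) by exact: itgB.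
have rgn : itg a b (fun t => `|r t - g t|) by exact: (integrable_norm rg).
have hi (f : R -> R) : itg a b f -> itg a b (fun z => s z * \int[mu]_(t in `[a, z]) f t).
  move=> fi; apply: within_itg => x.
  apply: (@continuousM R (subspace `[a, b])); last exact: int_head_within.
  exact: (continuous_subspaceT cs).
have X1 : `|X - \int[mu]_(z in `[a, b]) (s z * \int[mu]_(t in `[a, z]) g t)|
    <= K * (e / C) * (b - a).
  rewrite /X -itgB_E; [|exact: hi|exact: hi].
  rewrite -Rint_cst//; apply: norm_itg_le; [|exact: itg_cst|].
    by apply: itgB; exact: hi.
  move=> z /andP[az zb]; rewrite -mulrBr normrM ler_pM//.
    by rewrite HK// az.
  have ri' : itg a z r by exact: itgS ri.
  have gi' : itg a z g by exact: itgS gI.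
  rewrite -itgB_E//.
  apply: (@le_trans _ _ (\int[mu]_(t in `[a, z]) `|r t - g t|)).
    by apply: norm_itg_le; [exact: itgB|exact: itgS rgn|].
  apply: le_trans Hn; rewrite [leRHS](itg_split _ _ z)// lerDl.
  by apply: Rintegral_ge0.
have X2 : `|\int[mu]_(t in `[a, b]) (g t * S t) - Y| <= K' * (e / C).
  rewrite /Y -itgB_E; [|exact: itg_mulc|exact: itg_mulc].
  apply: (@le_trans _ _ (\int[mu]_(t in `[a, b]) (K' * `|r t - g t|))).
    apply: norm_itg_le; [|exact: itgZ|].
      by apply: itgB; exact: itg_mulc.
    move=> t tab; rewrite -mulrBl normrM distrC mulrC ler_wpM2r//.
    exact: HK'.
  by rewrite itgZ_E// ler_wpM2l.
rewrite T in X1.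
have -> : X - Y = (X - \int[mu]_(t in `[a, b]) (g t * S t)) +
   (\int[mu]_(t in `[a, b]) (g t * S t) - Y) by ring.
apply: (le_trans (ler_normD _ _)); apply: (le_trans (lerD X1 X2)).
have -> : K * (e / C) * (b - a) + K' * (e / C) = (C - 1) * (e / C).
  by rewrite /C; ring.
by rewrite mulrA ler_pdivrMr// mulrBl mul1r mulrC gerBl ltW.
Qed.

(** The difference of [f] and [g] has zero primitive, hence vanishes almost everywhere by Lebesgue
    differentiation. The conclusion is phrased as equal pairings because weak derivatives are
    compared only inside inner products. *)
Lemma primitive_unique a b f g : a <= b -> sq_integrable a b f -> sq_integrable a b g ->
  (forall z, a <= z <= b ->
    \int[mu]_(t in `[a, z]) f t = \int[mu]_(t in `[a, z]) g t) ->
  forall r, sq_integrable a b r -> \int[mu]_(t in `[a, b]) (f t * r t) =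
                         \int[mu]_(t in `[a, b]) (g t * r t).
Proof.
move=> ab sf sg fg r sr.
have mab : measurable (`[a, b]%classic : set (measurableTypeR R)) by [].
(* Extension by zero gives a function integrable on the line, to which the differentiation theorem
   applies. *)
pose q := (fun t => f t - g t) \_ `[a, b].
have di : itg a b (fun t => f t - g t) by apply: itgB; exact: sqi_itg.
have qi : mu.-integrable setT (EFin \o q).
  have := (@integrable_mkcond _ _ R mu _ (EFin \o (fun t => f t - g t)) mab).1 di.
  by rewrite /q restrict_EFin.
have qab x : a <= x <= b -> q x = f x - g x.
  by move=> xab; rewrite /q patchE mem_set//= in_itv.
have qi' c y : mu.-integrable [set` Interval (BLeft c) (BRight y)] (EFin \o q).
  exact: integrableS qi.
have v_node : locally_integrable [set: R] q by apply: open_integrable_locally => //; exact: openT.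
have F0 x : \int[mu]_(t in `[a, x]) q t = 0.
  have H y : a <= y <= b -> \int[mu]_(t in `[a, y]) q t = 0.
    move=> /andP[ay yb].
    transitivity (\int[mu]_(t in `[a, y]) (f t - g t)).
      apply: eq_Rintegral => t; rewrite inE/= in_itv/= => /andP[at_ ty].
      by rewrite qab// at_ (le_trans ty).
    rewrite itgB_E; [|exact: itgS (sqi_itg _ _ _ sf)|exact: itgS (sqi_itg _ _ _ sg)].
    by rewrite fg ?subrr// ay.
  have [ax|xa] := leP a x; last first.
    by rewrite set_itv_ge ?Rintegral_set0// bnd_simp -ltNge.
  have [xb|bx] := leP x b; first by rewrite H// ax.
  rewrite (itg_split q a b x ab (ltW bx) (qi' a x)) H ?ab ?lexx// add0r.
  rewrite -Rintegral_itv_obnd_cbnd; last first.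
    exact: integrableS qi.
  transitivity (\int[mu]_(t in [set` Interval (BRight b) (BRight x)]) (0 : R)).
    apply: eq_Rintegral => t; rewrite inE/= in_itv/= => /andP[bt _].
    by rewrite /q patchE memNset//= in_itv/= (leNgt t) bt andbF.
  by rewrite Rintegral_cst// mul0r.
have q0 t : t < a -> q t = 0.
  by move=> ta; rewrite /q patchE memNset//= in_itv/= (leNgt a) ta.
(* Starting the primitive at [a - 1] puts every point of [[a, b]] strictly to the right of the base
   point. *)
have F1 x : \int[mu]_(t in `[a - 1, x]) q t = 0.
  have [ax|xa] := leP a x.
    have a1 : a - 1 <= a by lra.
    rewrite (itg_split q _ _ _ a1 ax (qi' _ x)) F0 addr0.
    rewrite -Rintegral_itv_bndo_bndc; last exact: integrableS qi.
    transitivity (\int[mu]_(t in [set` Interval (BLeft (a - 1)) (BLeft a)]) (0 : R)).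
      by apply: eq_Rintegral => t; rewrite inE/= in_itv/= => /andP[_ /q0].
    by rewrite Rintegral_cst// mul0r.
  transitivity (\int[mu]_(t in `[a - 1, x]) (0 : R)).
    apply: eq_Rintegral => t; rewrite inE/= in_itv/= => /andP[_ tx].
    by apply: q0; exact: le_lt_trans tx xa.
  by rewrite Rintegral_cst// mul0r.
have := FTC1 (qi' (a - 1)) v_node.
have -> : (fun x => \int[mu]_(t in `[a - 1, x]) q t) = cst 0 by apply/funext.
move=> H.
have ae : ae_eq mu (`[a, b]%classic : set (measurableTypeR R)) (fun t => ((f t - g t) * r t)%:E) (cst 0%E).
  move: H; apply: filterS; first exact: (ae_filter_ringOfSetsType mu).
  move=> x Hx; rewrite /= in_itv/= => xab.
  have [ax xb] := andP xab.
  have lt : ((a - 1)%:E < x%:E)%E by rewrite lte_fin; lra.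
  have [_] := Hx lt.
  by rewrite derive1_cst qab// => <-; rewrite mul0r.
apply/eqP; rewrite -subr_eq0 -itgB_E; [|exact: sqi_mul|exact: sqi_mul].
apply/eqP; transitivity (\int[mu]_(t in `[a, b]) ((f t - g t) * r t)).
  by apply: eq_Rintegral => t _; rewrite mulrBl.
rewrite /Rintegral (ae_eq_integral (cst 0%E))//; first by rewrite integral0.
apply/measurable_EFinP; apply: measurable_funM; last by case: sr.
by apply: measurable_funB; [case: sf|case: sg].
Qed.

(** After the exchange of integrals the weight is integrated from [a] up to [t], which gives
    [(expR (l * t) - expR (l * a)) / l]; dropping the negative term leaves the gain [l^-1]. Tails
    towards the upper end and a weight growing with [z] fit together here. *)
Lemma carleman_tail a b (l : R) (r : R -> R) : a <= b -> 0 < l -> continuous r ->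
  (forall t, 0 <= r t) ->
  \int[mu]_(z in `[a, b]) (expR (l * z) * \int[mu]_(t in `[clamp a b z, b]) r t) <=
  l^-1 * \int[mu]_(t in `[a, b]) (expR (l * t) * r t).
Proof.
move=> ab l0 cr r0.
have ce : continuous (fun z => expR (l * z)).
  move=> x; apply: continuous_comp; last exact: continuous_expR.
  by apply: cvgM; [exact: cvg_cst|exact: cvg_id].
have := triangle_continuous _ _ _ _ ce cr ab.
have -> : \int[mu]_(z in `[a, b]) (expR (l * z) * \int[mu]_(t in `[clamp a b z, b]) r t)
 = \int[mu]_(z in `[a, b]) (expR (l * z) * \int[mu]_(t in `[z, b]) r t).
  by apply: eq_Rintegral => z; rewrite inE/= in_itv/= => zab; rewrite clamp_id.
move=> <-; rewrite -itgZ_E; last by apply: continuous_itg; exact: ctM.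
have E z : a <= z <= b -> \int[mu]_(t in `[a, z]) expR (l * t) =
    l^-1 * expR (l * z) - l^-1 * expR (l * a).
  move=> /andP[az zb]; apply: (ftc2T (fun x => l^-1 * expR (l * x))) => //.
  move=> x _; apply: is_derive_eq; rewrite /GRing.scale/=.
  by field; rewrite gt_eqF.
have H z : a <= z <= b -> r z * \int[mu]_(t in `[a, z]) expR (l * t) =
  r z * (l^-1 * expR (l * z) - l^-1 * expR (l * a)) by move=> /E ->.
apply: le_itg.
- apply: (eq_itg (fun z => r z * (l^-1 * expR (l * z) - l^-1 * expR (l * a)))).
    by move=> z; rewrite in_itv/= => /H ->.
  by apply: continuous_itg; apply: ctM => //; apply: ctB; [exact: ctZ|exact: ct_cst].
- by apply: continuous_itg; apply: ctZ; exact: ctM.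
move=> z zab; rewrite H//.
have i0 : 0 < l^-1 by rewrite invr_gt0.
have := expR_gt0 (l * a); have := expR_gt0 (l * z).
have -> : l^-1 * (expR (l * z) * r z) = r z * (l^-1 * expR (l * z)) by ring.
by move=> _ ea; rewrite ler_wpM2l// gerBl mulr_ge0 ?ltW.
Qed.

End SquareIntegrable.

(** * Independence of the basis from the shift *)

Section GramSchmidt.
Context {R : realType}.
Implicit Types (f g : R -> R) (a b : R) (p : {poly R}).
Local Notation mu := (@lebesgue_measure R).

(** Polynomials times the exponential: the span of all [xi a n], whatever [a], and stable under
    differentiation. Gram-Schmidt then becomes a matter of degrees. *)
Definition pexp p : R -> R := fun x => p.[x] * expR x.

Lemma continuous_horner p : continuous (fun x => p.[x]).
Proof.
elim/poly_ind: p => [|p c IH].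
  by under eq_fun do rewrite horner0; exact: ct_cst.
under eq_fun do rewrite hornerMXaddC.
by apply: ctD; [apply: ctM => // x; exact: cvg_id|exact: ct_cst].
Qed.

Lemma continuous_pexp p : continuous (pexp p).
Proof. by apply: ctM; [exact: continuous_horner|exact: continuous_expR]. Qed.

Lemma is_derive_horner p (x : R) : is_derive x 1 (fun x => p.[x]) (p^`()).[x].
Proof.
elim/poly_ind: p => [|p c IH].
  rewrite deriv0 horner0; under eq_fun do rewrite horner0; exact: is_derive_cst.
under eq_fun do rewrite hornerMXaddC.
rewrite derivD derivM derivX derivC addr0 mulr1 hornerD hornerMX.
by apply: is_derive_eq; rewrite /GRing.scale/=; ring.
Qed.

Lemma is_derive_pexp p (x : R) : is_derive x 1 (pexp p) (pexp (p + p^`()) x).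
Proof.
have dp := is_derive_horner p x.
by apply: is_derive_eq; rewrite /pexp hornerD /GRing.scale/=; ring.
Qed.

Lemma dotC f g : dot01 f g = dot01 g f.
Proof. by apply: eq_Rintegral => x _; rewrite mulrC. Qed.

Lemma dotZl k f g : continuous f -> continuous g ->
  dot01 (fun x => k * f x) g = k * dot01 f g.
Proof.
move=> cf cg; rewrite /dot01 -itgZ_E; last by apply: continuous_itg; exact: ctM.
by apply: eq_Rintegral => x _; rewrite mulrA.
Qed.

Lemma dotBl f1 f2 g : continuous f1 -> continuous f2 -> continuous g ->
  dot01 (fun x => f1 x - f2 x) g = dot01 f1 g - dot01 f2 g.
Proof.
move=> c1 c2 cg; rewrite /dot01 -itgB_E; try by apply: continuous_itg; exact: ctM.
by apply: eq_Rintegral => x _; rewrite mulrBl.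
Qed.

Lemma dot_suml (T : Type) (s : seq T) (c : T -> R) (F : T -> R -> R) g :
  (forall i, continuous (F i)) -> continuous g ->
  dot01 (fun x => \sum_(i <- s) c i * F i x) g = \sum_(i <- s) c i * dot01 (F i) g.
Proof.
move=> cF cg; rewrite /dot01.
transitivity (\int[mu]_(x in `[0, 1]) \sum_(i <- s) c i * (F i x * g x)).
  by apply: eq_Rintegral => x _; rewrite mulr_suml; apply: eq_bigr => i _; rewrite mulrA.
rewrite Rint_sum; last by move=> i; apply: continuous_itg; apply: ctZ; exact: ctM.
by apply: eq_bigr => i _; rewrite itgZ_E//; apply: continuous_itg; exact: ctM.
Qed.

(** If [g x > 0], then [g] stays above [g x / 2] on a short interval to the right of [x], which
    makes the integral positive. Looking to the right calls for [x < 1]. *)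
Lemma int01_eq0 g : continuous g -> (forall x, 0 <= g x) ->
  \int[mu]_(x in `[0, 1]) g x = 0 -> forall x, 0 <= x < 1 -> g x = 0.
Proof.
move=> cg g0 I0 x /andP[x0 x1]; apply/eqP; rewrite eq_le g0 andbT leNgt.
apply/negP => gx.
have gx2 : 0 < g x / 2 by rewrite divr_gt0.
have /nbhs_ballP[e /= e0 He] : \forall y \near x, `|g x - g y| <= g x / 2.
  by exact: (@cvgr_dist_le _ _ _ (nbhs x) _ g (g x) (cg x) (g x / 2) gx2).
pose y := Num.min (x + e / 2) 1.
have xy : x < y by rewrite /y lt_min x1 andbT ltrDl divr_gt0.
have y1 : y <= 1 by rewrite /y ge_min lexx orbT.
have ye : y <= x + e / 2 by rewrite /y ge_min lexx.
have : g x / 2 * (y - x) <= \int[mu]_(t in `[x, y]) g t.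
  rewrite -(Rint_cst x y _ (ltW xy)); apply: le_itg; [exact: itg_cst|exact: continuous_itg|].
  move=> t /andP[xt ty]; have : `|g x - g t| <= g x / 2.
    by apply: He; rewrite /ball/= ler0_norm; lra.
  by rewrite ler_norml; lra.
have H2 : 0 < g x / 2 * (y - x) by rewrite mulr_gt0// subr_gt0.
have : \int[mu]_(t in `[x, y]) g t <= 0.
  rewrite -I0 [leRHS](itg_split _ 0 x)//; [|exact: ltW|exact: continuous_itg].
  rewrite [X in _ <= _ + X](itg_split _ x y)//; [|exact: ltW|exact: continuous_itg].
  have p1 : 0 <= \int[mu]_(t in `[0, x]) g t by exact: Rintegral_ge0.
  have p2 : 0 <= \int[mu]_(t in `[y, 1]) g t by exact: Rintegral_ge0.
  by rewrite addrCA lerDl addr_ge0.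
move=> h1 h2; have := lt_le_trans H2 (le_trans h2 h1).
by rewrite ltxx.
Qed.

(** Otherwise [p] would vanish at the [size p] distinct points [i / (size p + 1)], [i < size p],
    more roots than its degree allows. *)
Lemma dot_pexp_gt0 p : p != 0 -> 0 < dot01 (pexp p) (pexp p).
Proof.
move=> p0; have nn x : 0 <= pexp p x * pexp p x by rewrite -expr2 sqr_ge0.
rewrite lt_neqAle Rintegral_ge0// andbT eq_sym; apply/negP => /eqP E.
have H := int01_eq0 (fun x => pexp p x * pexp p x) (ctM _ _ (continuous_pexp p) (continuous_pexp p)) nn E.
pose n := size p; pose rs := [seq i%:R / n.+1%:R | i <- iota 0 n] : seq R.
have n1 : 0 < n.+1%:R :> R by rewrite ltr0n.
have : (size rs < size p)%N.
  apply: max_poly_roots => //.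
    apply/allP => x /mapP[i]; rewrite mem_iota add0n => /= im ->.
    have /H/eqP : 0 <= (i%:R / n.+1%:R : R) < 1.
      by rewrite divr_ge0//= ltr_pdivrMr// mul1r ltr_nat ltnS ltnW.
    by rewrite mulf_eq0 orbb mulf_eq0 (gt_eqF (expR_gt0 _)) orbF.
  rewrite map_inj_uniq ?iota_uniq// => i j /(mulIf _) H'.
  by apply/eqP; rewrite -(eqr_nat R); apply/eqP; apply: H'; rewrite invr_neq0// gt_eqF.
by rewrite size_map size_iota ltnn.
Qed.

Lemma size_gram_schmidt a n : size (gram_schmidt a n) = n.
Proof. by elim: n => //= n IH; rewrite size_rcons IH. Qed.

Lemma gram_schmidtE a n : gram_schmidt a n = [seq Psi a i | i <- iota 0 n].
Proof.
elim: n => // n IH; rewrite -addn1 iotaD map_cat -IH add0n addn1 /= cats1.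
congr rcons; rewrite /Psi /=.
by rewrite nth_rcons size_gram_schmidt ltnn eqxx.
Qed.

Lemma PsiE a n : Psi a n = normalize01 (fun x => xi a n x -
  \sum_(i <- iota 0 n) dot01 (xi a n) (Psi a i) * Psi a i x).
Proof.
rewrite {1}/Psi /= nth_rcons size_gram_schmidt ltnn eqxx gram_schmidtE.
by congr normalize01; apply/funext => x; rewrite big_map.
Qed.

Lemma xiE a n : xi a n = pexp (('X - (- a)%:P) ^+ n).
Proof. by apply/funext => x; rewrite /xi /pexp horner_exp hornerXsubC opprK. Qed.

(** Degrees and orthonormality have to be carried together: the degree shows that the unnormalized
    residual is a nonzero polynomial times the exponential, so that [normalize01] divides by a
    positive number, and orthonormality makes the residual orthogonal to its predecessors. *)
Lemma Psi_pexp_orthonormal a n :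
  exists P : nat -> {poly R},
    (forall i, (i < n)%N -> size (P i) = i.+1 /\ Psi a i = pexp (P i)) /\
    (forall i j, (i < n)%N -> (j < n)%N -> dot01 (Psi a i) (Psi a j) = (i == j)%:R).
Proof.
elim: n => [|n [P [HP HO]]]; first by exists (fun=> 0).
pose c i := dot01 (xi a n) (Psi a i).
pose q := ('X - (- a)%:P) ^+ n - \sum_(i <- iota 0 n) c i *: P i.
have sz : (size (\sum_(i <- iota 0 n) c i *: P i)%R <= n)%N.
  rewrite big_seq; apply: (big_ind (fun p : {poly R} => size p <= n)%N).
  - by rewrite size_poly0.
  - by move=> p1 p2 h1 h2; rewrite (leq_trans (size_polyD _ _))// geq_max h1.
  by move=> i; rewrite mem_iota add0n => /= im; rewrite (leq_trans (size_scale_leq _ _))// (HP i im).1.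
have szq : size q = n.+1.
  by rewrite /q size_polyDl ?size_exp_XsubC// size_polyN.
have q0 : q != 0 by rewrite -size_poly_gt0 szq.
have resE : (fun x => xi a n x - \sum_(i <- iota 0 n) dot01 (xi a n) (Psi a i) * Psi a i x)
   = pexp q.
  apply/funext => x; rewrite xiE /pexp hornerD hornerN mulrDl mulNr; congr (_ - _).
  rewrite horner_sum mulr_suml big_seq [RHS]big_seq; apply: eq_bigr => i.
  rewrite mem_iota add0n => /= im; rewrite hornerZ -mulrA -/(pexp (P i) x) -(HP i im).2.
  by rewrite /c xiE.
pose k := (Num.sqrt (dot01 (pexp q) (pexp q)))^-1.
have dq := dot_pexp_gt0 q q0.
have k0 : k != 0 by rewrite invr_neq0// gt_eqF// sqrtr_gt0.
have PE : Psi a n = pexp (k *: q).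
  by rewrite PsiE resE; apply/funext => x; rewrite /normalize01 /pexp hornerZ mulrC mulrA.
have cPsi i : (i < n)%N -> continuous (Psi a i).
  by move=> /HP[_ ->]; exact: continuous_pexp.
have PEk : Psi a n = (fun x => k * pexp q x).
  by rewrite PE; apply/funext => x; rewrite /pexp hornerZ mulrA.
have On i : (i < n)%N -> dot01 (Psi a n) (Psi a i) = 0.
  move=> im; rewrite PEk dotZl; [|exact: continuous_pexp|exact: cPsi].
  (* [dot_suml] asks for continuity at every index, but only indices below [n] are under control so
     far; [F] is padded with zero. *)
  pose F i := if (i < n)%N then Psi a i else cst 0.
  have cF j : continuous (F j).
    by rewrite /F; case: ifP => [/cPsi//|_]; exact: ct_cst.
  rewrite -resE (_ : (fun x => _) = (fun x => xi a n x - \sum_(i <- iota 0 n) c i * F i x)).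
    rewrite dotBl; first last.
    - exact: cPsi.
    - by apply: ct_sum => j; exact: ctZ.
    - by rewrite xiE; exact: continuous_pexp.
    rewrite dot_suml//; last exact: cPsi.
    rewrite (bigD1_seq i) ?iota_uniq ?mem_iota//= big_seq_cond big1 ?addr0.
      by rewrite /F im HO// eqxx mulr1 subrr mulr0.
    move=> j; rewrite mem_iota /= add0n => /andP[jm ji].
    by rewrite /F jm HO// (negbTE ji) mulr0.
  apply/funext => x; congr (_ - _); rewrite big_seq [RHS]big_seq.
  by apply: eq_bigr => j; rewrite mem_iota add0n /F /c => /= ->.
have Onn : dot01 (Psi a n) (Psi a n) = 1.
  rewrite {1}PEk dotZl; [|exact: continuous_pexp|rewrite PE; exact: continuous_pexp].
  rewrite dotC PEk dotZl; [|exact: continuous_pexp|exact: continuous_pexp].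
  rewrite mulrA -expr2 /k exprVn sqr_sqrtr ?ltW// mulVf// gt_eqF//.
exists (fun i => if i == n then k *: q else P i); split.
  move=> i; rewrite ltnS leq_eqVlt; case: eqP => [->|_] /= im.
    by rewrite size_scale.
  exact: HP.
move=> i j; rewrite !ltnS leq_eqVlt [(j <= n)%N]leq_eqVlt.
case: (eqVneq i n) => [->|ni] /= im; case: (eqVneq j n) => [->|nj] /= jm.
- by rewrite Onn ?eqxx.
- by rewrite On// ?(eq_sym n) ?(negbTE nj).
- by rewrite dotC On// ?(negbTE ni).
exact: HO.
Qed.

Lemma Psi_pexp a n : exists p, Psi a n = pexp p.
Proof.
have [P [HP _]] := Psi_pexp_orthonormal a n.+1.
by exists (P n); case: (HP n (ltnSn n)).
Qed.

Lemma Psi_continuous a n : continuous (Psi a n).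
Proof. by have [p ->] := Psi_pexp a n; exact: continuous_pexp. Qed.

Lemma Psi_derive a n : exists2 f, continuous f &
  forall x : R, is_derive x 1 (Psi a n) (f x).
Proof.
have [p ->] := Psi_pexp a n; exists (pexp (p + p^`())).
  exact: continuous_pexp.
exact: is_derive_pexp.
Qed.

(** Subtracting a multiple of the top polynomial lowers the size, so some expansion exists; pairing
    with each [Psi a i] then identifies the coefficients. *)
Lemma pexp_expand a n p : (size p <= n)%N ->
  forall x, pexp p x = \sum_(i <- iota 0 n) dot01 (pexp p) (Psi a i) * Psi a i x.
Proof.
have [P [HP HO]] := Psi_pexp_orthonormal a n.
have {}HP i : (i < n)%N -> size (P i) = i.+1 /\ Psi a i = pexp (P i) by exact: HP.
suff H m (q : {poly R}) : (m <= n)%N -> (size q <= m)%N -> exists c : nat -> R,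
    pexp q = fun x => \sum_(i <- iota 0 m) c i * Psi a i x.
  move=> pn x; have [c ->] := H n p (leqnn n) pn.
  rewrite big_seq [RHS]big_seq; apply: eq_bigr => i; rewrite mem_iota /= add0n => im.
  congr (_ * _); rewrite dot_suml; [|by move=> ?; exact: Psi_continuous|exact: Psi_continuous].
  rewrite (bigD1_seq i) ?iota_uniq ?mem_iota//= HO// eqxx mulr1 big_seq_cond big1 ?addr0//.
  by move=> j; rewrite mem_iota /= add0n => /andP[jm ji]; rewrite HO// (negbTE ji) mulr0.
elim: m q => [|m IH] q mn.
  rewrite leqn0 size_poly_eq0 => /eqP ->; exists (fun=> 0).
  by apply/funext => x; rewrite /pexp horner0 mul0r big_nil.
move=> qm; have [sP PE] := HP m mn.
have lP : (P m)`_m != 0.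
  by have := lead_coef_eq0 (P m); rewrite lead_coefE sP /= -size_poly_eq0 sP => ->.
pose k := q`_m / (P m)`_m; pose r := q - k *: P m.
have szr : (size r <= m)%N.
  apply/leq_sizeP => j; rewrite leq_eqVlt => /predU1P[<-|mj].
    by rewrite coefB coefZ /k divfK// subrr.
  by rewrite coefB coefZ !nth_default ?mulr0 ?subrr// ?sP// (leq_trans qm).
have [c cE] := IH r (ltnW mn) szr.
exists (fun i => if i == m then k else c i); apply/funext => x.
rewrite -addn1 iotaD add0n big_cat/= big_seq1 eqxx PE.
have -> : \sum_(i <- iota 0 m) (if i == m then k else c i) * Psi a i x = pexp r x.
  rewrite cE big_seq [RHS]big_seq; apply: eq_bigr => i; rewrite mem_iota /= add0n => im.
  by rewrite ltn_eqF.
by rewrite /pexp /r hornerD hornerN hornerZ; ring.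
Qed.

(** The generators of index [n] for [a] and [b] differ by a polynomial of size at most [n] times the
    exponential. By [pexp_expand] this difference equals its own projection on the earlier
    functions, which agree by induction, so the two residuals coincide before normalization. *)
Lemma Psi_indep a b n : Psi a n = Psi b n.
Proof.
have K (u v s t : R) : u - v = s - t -> u - s = v - t by move=> ?; lra.
elim/ltn_ind: n => n IH.
have Es : {in iota 0 n, Psi a =1 Psi b}.
  by move=> i; rewrite mem_iota /= add0n; exact: IH.
apply: etrans (PsiE a n) _; apply: etrans _ (esym (PsiE b n)).
have E (f g : R -> R) : f = g -> normalize01 f = normalize01 g by move=> ->.
apply: E; apply/funext => x.
pose d := ('X - (- a)%:P) ^+ n - ('X - (- b)%:P) ^+ n : {poly R}.
have szd : (size d <= n)%N.
  apply/leq_sizeP => j; rewrite leq_eqVlt => /predU1P[<-|nj]; rewrite coefB.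
    have h c : (('X - c%:P) ^+ n : {poly R})`_n = 1.
      have := monic_exp n (monicXsubC c); rewrite monicE lead_coefE size_exp_XsubC /=.
      by move/eqP.
    by rewrite !h subrr.
  by rewrite !nth_default ?subrr// size_exp_XsubC.
have dE y : pexp d y = xi a n y - xi b n y.
  by rewrite !xiE /pexp /d hornerD hornerN; ring.
have H := pexp_expand b n d szd x.
have cx (c : R) : continuous (xi c n) by have := continuous_pexp (('X - (- c)%:P) ^+ n : {poly R}); rewrite -xiE.
have H1 : \sum_(i <- iota 0 n) dot01 (xi a n) (Psi a i) * Psi a i x =
          \sum_(i <- iota 0 n) dot01 (xi a n) (Psi b i) * Psi b i x.
  by apply: eq_big_seq => i /Es ->.
have H2 : \sum_(i <- iota 0 n) dot01 (pexp d) (Psi b i) * Psi b i x =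
  \sum_(i <- iota 0 n) dot01 (xi a n) (Psi b i) * Psi b i x -
  \sum_(i <- iota 0 n) dot01 (xi b n) (Psi b i) * Psi b i x.
  rewrite -sumrB; apply: eq_bigr => i _.
  have dF : pexp d = (fun y => xi a n y - xi b n y) by apply/funext.
  rewrite -mulrBl dF (dotBl _ _ _ (cx a) (cx b) (Psi_continuous b i)).
  by [].
apply: (etrans (congr1 (fun s => xi a n x - s) H1)); apply: K.
exact: (etrans (esym (dE x)) (etrans H H2)).
Qed.

Lemma MN_indep a b N : MN a N = MN b N.
Proof.
have E : Psi a = Psi b by apply/funext => n; exact: Psi_indep.
by rewrite /MN E.
Qed.

End GramSchmidt.

(** * Estimates for the flux *)

Section Theta.
Context {R : realType}.
Implicit Types (p q v w : R).

(* The integrand of the flux, with [p] a difference quotient of [u] and [q] the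
   value of [u]; [dflux_kernel] is its differential at [(p, q)] applied to [(v, w)]. *)
Definition flux_kernel p q := p / (2 * Num.sqrt q).

Definition dflux_kernel p q v w := v / (2 * Num.sqrt q) - p * w / (4 * Num.sqrt q ^+ 3).

Lemma le_normM (x y X Y : R) : `|x| <= X -> `|y| <= Y -> `|x * y| <= X * Y.
Proof. by move=> ? ?; rewrite normrM ler_pM. Qed.

Lemma le_normD (x y X Y : R) : `|x| <= X -> `|y| <= Y -> `|x + y| <= X + Y.
Proof. by move=> ? ?; rewrite (le_trans (ler_normD _ _))// lerD. Qed.

Lemma le_normX (x X : R) n : `|x| <= X -> `|x ^+ n| <= X ^+ n.
Proof. by move=> h; rewrite normrX lerXn2r// ?nnegrE// (le_trans _ h). Qed.

(** Multiply by the sum of the two square roots, which is at least [2 * m]. *)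
Lemma sqrt_lip (m q1 q2 d : R) : 0 < m -> m ^+ 2 <= q1 -> m ^+ 2 <= q2 ->
  `|q2 - q1| <= d -> `|Num.sqrt q1 - Num.sqrt q2| <= d * m^-1 / 2.
Proof.
move=> m0 h1 h2 hd.
have m20 : 0 <= m ^+ 2 by rewrite sqr_ge0.
have hs q : m ^+ 2 <= q -> m <= Num.sqrt q.
  by move=> h; rewrite -[leLHS](ger0_norm (ltW m0)) -sqrtr_sqr ler_sqrt// (le_trans _ h).
have [s1 s2] := (hs _ h1, hs _ h2).
have e1 : q1 = Num.sqrt q1 ^+ 2 by rewrite sqr_sqrtr// (le_trans m20).
have e2 : q2 = Num.sqrt q2 ^+ 2 by rewrite sqr_sqrtr// (le_trans m20).
move: hd; rewrite e1 e2 !sqrtr_sqr.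
rewrite !(ger0_norm (sqrtr_ge0 _)).
move: (Num.sqrt q1) (Num.sqrt q2) s1 s2 => x y mx my.
have -> : y ^+ 2 - x ^+ 2 = (y - x) * (x + y) by ring.
rewrite normrM (ger0_norm (_ : 0 <= x + y)); last by lra.
rewrite distrC => h; rewrite -mulrA -invfM ler_pdivlMr; last by lra.
apply: le_trans h; apply: ler_wpM2l => //; lra.
Qed.

(** The comparisons of constants in [theta_estimates], where with [i = m^-1] the five numbers are
    [M * i], [i], [M * i ^+ 3], [i ^+ 3] and [M * i ^+ 5]. *)
Lemma theta_consts (K : realFieldType) (p q r s t : K) :
  0 <= p -> 0 <= q -> 0 <= r -> 0 <= s -> 0 <= t ->
  let C := p + (q + r) + (s + t) in
  [/\ p / 2 <= C, q / 2 + r / 4 <= C, s / 4 + t * (3 / 16) <= C & s / 2 + t * (3 / 8) <= C].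
Proof. by move=> p0 q0 r0 s0 t0 C; rewrite /C; split; lra. Qed.

(** In terms of [x = 1 / sqrt q], which is at most [m^-1], the kernel is [p * x / 2] and its
    differential [v * x / 2 - p * w * x ^+ 3 / 4]; all five bounds become estimates of polynomials.
    The increment of [x] is controlled by that of [sqrt q], hence by [sqrt_lip]. *)
Lemma theta_estimates (M m : R) : 0 <= M -> 0 < m -> exists2 C, 0 <= C &
  forall p1 q1 p2 q2, `|p1| <= M -> `|p2| <= M -> m ^+ 2 <= q1 -> m ^+ 2 <= q2 ->
  [/\ `|flux_kernel p1 q1| <= C,
      forall v w n, `|v| <= n -> `|w| <= n -> `|dflux_kernel p1 q1 v w| <= C * n,
      forall d, `|p2 - p1| <= d -> `|q2 - q1| <= d ->
        `|flux_kernel p2 q2 - flux_kernel p1 q1| <= C * d,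
      forall d, `|p2 - p1| <= d -> `|q2 - q1| <= d ->
        `|flux_kernel p2 q2 - flux_kernel p1 q1 - dflux_kernel p1 q1 (p2 - p1) (q2 - q1)| <= C * d ^+ 2 &
      forall d v w n, `|p2 - p1| <= d -> `|q2 - q1| <= d ->
        `|v| <= n -> `|w| <= n ->
        `|dflux_kernel p2 q2 v w - dflux_kernel p1 q1 v w| <= C * (d * n)].
Proof.
move=> M0 m0; pose i := m^-1.
have i0 : 0 <= i by rewrite invr_ge0 ltW.
pose a1 := M * i; pose a2 := i + M * i ^+ 3; pose a3 := i ^+ 3 + M * i ^+ 5.
have a10 : 0 <= a1 by rewrite mulr_ge0.
have a20 : 0 <= a2 by rewrite addr_ge0// mulr_ge0// exprn_ge0.
have a30 : 0 <= a3 by rewrite addr_ge0 ?mulr_ge0 ?exprn_ge0.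
exists (a1 + a2 + a3); first by apply: addr_ge0 => //; exact: addr_ge0.
move=> p1 q1 p2 q2 P1 P2 Q1 Q2.
pose s1 := Num.sqrt q1; pose s2 := Num.sqrt q2.
have m20 : 0 <= m ^+ 2 by rewrite sqr_ge0.
have hs q : m ^+ 2 <= q -> m <= Num.sqrt q.
  by move=> h; rewrite -[leLHS](ger0_norm (ltW m0)) -sqrtr_sqr ler_sqrt// (le_trans _ h).
have s1m : m <= s1 by exact: hs. have s2m : m <= s2 by exact: hs.
have s10 : 0 < s1 by exact: lt_le_trans s1m.
have s20 : 0 < s2 by exact: lt_le_trans s2m.
pose x1 := s1^-1; pose x2 := s2^-1.
have xb s : 0 < s -> m <= s -> `|s^-1| <= i.
  move=> s0 sm; rewrite ger0_norm ?invr_ge0; last exact: ltW.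
  by rewrite lef_pV2.
have X1 : `|x1| <= i by exact: xb. have X2 : `|x2| <= i by exact: xb.
have E1 : s1 * x1 = 1 by rewrite mulfV// gt_eqF.
have E2 : s2 * x2 = 1 by rewrite mulfV// gt_eqF.
have thE1 : flux_kernel p1 q1 = p1 * x1 / 2 by rewrite /flux_kernel invfM -/x1; ring.
have thE2 : flux_kernel p2 q2 = p2 * x2 / 2 by rewrite /flux_kernel invfM -/x2; ring.
have dthE1 v w : dflux_kernel p1 q1 v w = v * x1 / 2 - p1 * w * x1 ^+ 3 / 4.
  by rewrite /dflux_kernel -/s1 /x1; field; rewrite gt_eqF.
have dthE2 v w : dflux_kernel p2 q2 v w = v * x2 / 2 - p2 * w * x2 ^+ 3 / 4.
  by rewrite /dflux_kernel -/s2 /x2; field; rewrite gt_eqF.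
have dx : x2 - x1 = (s1 - s2) * (x1 * x2) by rewrite /x1 /x2; field; rewrite !gt_eqF.
have h2 : `|2^-1 : R| <= 2^-1 by rewrite ger0_norm// invr_ge0.
have h4 : `|4^-1 : R| <= 4^-1 by rewrite ger0_norm// invr_ge0.
have sl d : `|q2 - q1| <= d -> `|s1 - s2| <= d * i / 2 by exact: sqrt_lip.
have dxb d : `|q2 - q1| <= d -> `|x2 - x1| <= d * i / 2 * (i * i).
  by move=> /sl h; rewrite dx; apply: le_normM => //; exact: le_normM.
have i30 : 0 <= M * i ^+ 3 by rewrite mulr_ge0// exprn_ge0.
have i33 : 0 <= i ^+ 3 by rewrite exprn_ge0.
have i50 : 0 <= M * i ^+ 5 by rewrite mulr_ge0// exprn_ge0.
have [c1 c2 c3 c4] := theta_consts _ _ _ _ _ _ a10 i0 i30 i33 i50.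
have d1b v w n : `|v| <= n -> `|w| <= n ->
    `|v * x1 / 2 - p1 * w * x1 ^+ 3 / 4| <= n * i / 2 + M * n * i ^+ 3 / 4.
  move=> hv hw; rewrite -[X in _ + X]mulN1r; apply: le_normD.
    by apply: le_normM => //; exact: le_normM.
  rewrite mulN1r normrN; apply: le_normM => //.
  by apply: le_normM; [exact: le_normM|exact: le_normX].
split.
- rewrite thE1; apply: (@le_trans _ _ (M * i / 2)).
    by apply: le_normM => //; exact: le_normM.
  exact: c1.
- move=> v w n hv hw; rewrite dthE1 (le_trans (d1b _ _ _ hv hw))//.
  have n0 : 0 <= n by rewrite (le_trans _ hv).
  have -> : n * i / 2 + M * n * i ^+ 3 / 4 = (i / 2 + M * i ^+ 3 / 4) * n by ring.
  by apply: ler_wpM2r.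
- move=> d hp hq; rewrite thE1 thE2.
  have -> : p2 * x2 / 2 - p1 * x1 / 2 = (p2 - p1) * x2 / 2 + p1 * (x2 - x1) / 2 by ring.
  have d0 : 0 <= d by rewrite (le_trans _ hp).
  apply: (@le_trans _ _ (d * i / 2 + M * (d * i / 2 * (i * i)) / 2)).
    apply: le_normD; apply: le_normM => //; apply: le_normM => //.
    exact: dxb.
  have -> : d * i / 2 + M * (d * i / 2 * (i * i)) / 2 = (i / 2 + M * i ^+ 3 / 4) * d by field.
  by apply: ler_wpM2r.
- move=> d hp hq; rewrite thE1 thE2 dthE1.
  have d0 : 0 <= d by rewrite (le_trans _ hp).
  (* The first-order part has been removed, so each remaining term carries two small factors:
     [(p2 - p1) * (x2 - x1)] or the square of [s1 - s2]. Writing [q] as [s ^+ 2] makes the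
     cancellation visible. *)
  have -> : p2 * x2 / 2 - p1 * x1 / 2 - ((p2 - p1) * x1 / 2 - p1 * (q2 - q1) * x1 ^+ 3 / 4)
     = (p2 - p1) * (x2 - x1) / 2 +
       p1 * ((s1 - s2) ^+ 2 * (x1 ^+ 3 / 4 + x1 ^+ 2 * x2 / 2)).
    have -> : q1 = s1 ^+ 2 by rewrite sqr_sqrtr// (le_trans m20).
    have -> : q2 = s2 ^+ 2 by rewrite sqr_sqrtr// (le_trans m20).
    by rewrite /x1 /x2; field; rewrite !gt_eqF.
  apply: (@le_trans _ _ (d * (d * i / 2 * (i * i)) / 2 +
     M * ((d * i / 2) ^+ 2 * (i ^+ 3 / 4 + i ^+ 2 * i / 2)))).
    apply: le_normD.
      by apply: le_normM => //; apply: le_normM => //; exact: dxb.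
    apply: le_normM => //; apply: le_normM; first by apply: le_normX; exact: sl.
    apply: le_normD; apply: le_normM => //; first exact: le_normX.
    by apply: le_normM => //; exact: le_normX.
  have dd : 0 <= d ^+ 2 by rewrite sqr_ge0.
  have -> : d * (d * i / 2 * (i * i)) / 2 + M * ((d * i / 2) ^+ 2 * (i ^+ 3 / 4 + i ^+ 2 * i / 2))
    = d ^+ 2 * (i ^+ 3 / 4 + M * i ^+ 5 * (3 / 16)) by field.
  by rewrite mulrC; apply: ler_wpM2r.
move=> d v w n hp hq hv hw; rewrite dthE1 dthE2.
have d0 : 0 <= d by rewrite (le_trans _ hp).
have n0 : 0 <= n by rewrite (le_trans _ hv).
have -> : v * x2 / 2 - p2 * w * x2 ^+ 3 / 4 - (v * x1 / 2 - p1 * w * x1 ^+ 3 / 4)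
  = v * (x2 - x1) / 2 + - 1 * ((p2 - p1) * w * x2 ^+ 3 / 4 +
     p1 * w * ((x2 - x1) * (x1 ^+ 2 + x1 * x2 + x2 ^+ 2)) / 4) by ring.
apply: (@le_trans _ _ (n * (d * i / 2 * (i * i)) / 2 +
   1 * (d * n * i ^+ 3 / 4 + M * n * ((d * i / 2 * (i * i)) * (i ^+ 2 + i * i + i ^+ 2)) / 4))).
  apply: le_normD.
    by apply: le_normM => //; apply: le_normM => //; exact: dxb.
  apply: le_normM; first by rewrite normrN1.
  apply: le_normD; apply: le_normM => //; apply: le_normM.
  - exact: le_normM.
  - exact: le_normX.
  - exact: le_normM.
  apply: le_normM; first exact: dxb.
  by apply: le_normD; [apply: le_normD; [exact: le_normX|exact: le_normM]|exact: le_normX].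
have dn : 0 <= d * n by rewrite mulr_ge0.
have -> : n * (d * i / 2 * (i * i)) / 2 +
   1 * (d * n * i ^+ 3 / 4 + M * n * ((d * i / 2 * (i * i)) * (i ^+ 2 + i * i + i ^+ 2)) / 4)
  = (d * n) * (i ^+ 3 / 2 + M * i ^+ 5 * (3 / 8)) by field.
by rewrite mulrC; apply: ler_wpM2r.
Qed.

End Theta.

(** * Integration by parts against a basis function *)

Section BoundaryFunctional.
Context {R : realType}.
Implicit Types (g k dk : R -> R).
Local Notation mu := (@lebesgue_measure R).

(* The integral of [k * g^`()] over [[0, 1]], integrated by parts so that [g]
   need not be differentiated; [dk] stands for the derivative of [k]. *)
Definition by_parts k dk g : R :=
  k 1 * g 1 - k 0 * g 0 - \int[mu]_(x in `[0, 1]) (dk x * g x).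

Lemma bfunD k dk g1 g2 : continuous dk -> continuous g1 -> continuous g2 ->
  by_parts k dk (fun x => g1 x + g2 x) = by_parts k dk g1 + by_parts k dk g2.
Proof.
move=> cdk c1 c2; rewrite /by_parts.
have -> : \int[mu]_(x in `[0, 1]) (dk x * (g1 x + g2 x)) =
   \int[mu]_(x in `[0, 1]) (dk x * g1 x) + \int[mu]_(x in `[0, 1]) (dk x * g2 x).
  rewrite -itgD_E; try by apply: continuous_itg; exact: ctM.
  by apply: eq_Rintegral => x _; rewrite mulrDr.
ring.
Qed.

Lemma bfunZ k dk c g : continuous dk -> continuous g ->
  by_parts k dk (fun x => c * g x) = c * by_parts k dk g.
Proof.
move=> cdk cg; rewrite /by_parts.
have -> : \int[mu]_(x in `[0, 1]) (dk x * (c * g x)) =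
   c * \int[mu]_(x in `[0, 1]) (dk x * g x).
  rewrite -itgZ_E; last by apply: continuous_itg; exact: ctM.
  by apply: eq_Rintegral => x _; rewrite mulrCA.
ring.
Qed.

Lemma bfunB k dk g1 g2 : continuous dk -> continuous g1 -> continuous g2 ->
  by_parts k dk (fun x => g1 x - g2 x) = by_parts k dk g1 - by_parts k dk g2.
Proof.
move=> cdk c1 c2; rewrite -[in RHS](mulN1r (by_parts k dk g2)) -bfunZ// -bfunD//.
  by congr by_parts; apply/funext => x; rewrite mulN1r.
exact: ctZ.
Qed.

Lemma eq_bfun k dk g1 g2 : {in `[0, 1], g1 =1 g2} -> by_parts k dk g1 = by_parts k dk g2.
Proof.
move=> E; rewrite /by_parts !E ?in_itv/= ?lexx ?ler01//; congr (_ - _).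
by apply: eq_Rintegral => x; rewrite inE => /E ->.
Qed.

(** This is the gain from integrating by parts: the pairing of [k] with the derivative of [g] is
    controlled by the supremum of [g] alone. *)
Lemma bfun_bound k dk : continuous dk -> exists2 K, 0 <= K &
  forall g c, continuous g -> (forall x, 0 <= x <= 1 -> `|g x| <= c) ->
  `|by_parts k dk g| <= K * c.
Proof.
move=> cdk; have [D D0 HD] := bounded_itg 0 1 dk cdk.
exists (`|k 1| + `|k 0| + D); first by rewrite !addr_ge0// addr_ge0.
move=> g c cg Hg; rewrite /by_parts.
have h1 : `|g 1| <= c by apply: Hg; rewrite lexx ler01.
have h0 : `|g 0| <= c by apply: Hg; rewrite lexx ler01.
have hi : `|\int[mu]_(x in `[0, 1]) (dk x * g x)| <= D * c.
  have -> : D * c = D * c * (1 - 0) by ring.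
  rewrite -(Rint_cst 0 1)//; apply: norm_itg_le; [|exact: itg_cst|].
    by apply: continuous_itg; exact: ctM.
  by move=> x x01; apply: le_normM; [exact: HD|exact: Hg].
rewrite mulrDl mulrDl; apply: le_normD; last by rewrite normrN.
by apply: le_normD; rewrite ?normrN; exact: le_normM.
Qed.

Lemma continuous_bfun k dk (g : R -> R -> R) : continuous dk -> joint_cont g ->
  continuous (fun z => by_parts k dk (g z)).
Proof.
move=> cdk cg; apply: ctB.
  by apply: ctB; apply: ctZ; exact: jc_slice1.
apply: (continuous_int (fun x z => dk x * g z x)).
by apply: jcM; [exact: jc1|exact: jc_swap].
Qed.

(** Point evaluations commute with the integral in [z] by linearity, the remaining term by
    Fubini. *)
Lemma bfun_int k dk a b (s : R -> R) (g : R -> R -> R) : a <= b ->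
  continuous dk -> continuous s -> joint_cont g ->
  \int[mu]_(z in `[a, b]) (s z * by_parts k dk (g z)) =
  by_parts k dk (fun x => \int[mu]_(z in `[a, b]) (s z * g z x)).
Proof.
move=> ab cdk cs cg.
have c0 x : continuous (fun z => s z * g z x) by apply: ctM => //; exact: jc_slice1.
have jg : joint_cont (fun z x => dk x * g z x) by apply: jcM => //; exact: jc2.
have ci : continuous (fun z => \int[mu]_(x in `[0, 1]) (dk x * g z x)).
  by apply: (continuous_int (fun x z => dk x * g z x)); exact: jc_swap.
transitivity (\int[mu]_(z in `[a, b]) ((k 1 * (s z * g z 1) - k 0 * (s z * g z 0)) -
   s z * \int[mu]_(x in `[0, 1]) (dk x * g z x))).
  by apply: eq_Rintegral => z _; rewrite /by_parts; ring.
have c1 y x : continuous (fun z => y * (s z * g z x)) by exact: ctZ.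
rewrite itgB_E; try by apply: continuous_itg; do ?[exact: ctB|exact: ctM].
rewrite itgB_E; try exact: continuous_itg.
rewrite !itgZ_E; try exact: continuous_itg.
rewrite /by_parts; congr (_ - _).
transitivity (\int[mu]_(z in `[a, b]) \int[mu]_(x in `[0, 1]) (s z * (dk x * g z x))).
  apply: eq_Rintegral => z _; rewrite itgZ_E//; apply: continuous_itg.
  exact: (jc_slice2 _ z jg).
rewrite (fubini_jc (fun z x => s z * (dk x * g z x)))//; last first.
  by apply: jcM => //; exact: jc1.
apply: eq_Rintegral => x _; rewrite -itgZ_E; last exact: continuous_itg.
by apply: eq_Rintegral => z _; ring.
Qed.

End BoundaryFunctional.

(** * The flux as a function of the difference quotient and the value of [u] *)

Section Flux.
Context {R : realType}.
Variables (a b : R) (ab : a <= b).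
Implicit Types (p q v w : R -> R -> R) (f nu k dk : R -> R) (z x M m : R).
Local Notation mu := (@lebesgue_measure R).
Local Notation cl := (clamp a b).

Definition tail nu z := \int[mu]_(t in `[cl z, b]) nu t.

Lemma continuous_tail nu : continuous nu -> continuous (tail nu).
Proof. by move=> cn; exact: (jc_slice1 _ 0 (jc_int_tail (fun t _ => nu t) _ _ ab (jc1 _ cn))). Qed.

Lemma clb z : cl z <= b. Proof. by have /andP[] := clamp_itv a b z ab. Qed.
Lemma cla z : a <= cl z. Proof. by have /andP[] := clamp_itv a b z ab. Qed.

Lemma tail_ge0 nu z : (forall t, 0 <= nu t) -> 0 <= tail nu z.
Proof. by move=> n0; apply: Rintegral_ge0. Qed.

Lemma tail_sqr nu z : continuous nu ->
  tail nu z ^+ 2 <= (b - a) * tail (fun t => nu t ^+ 2) z.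
Proof.
move=> cn; rewrite (le_trans (int_sqr_le _ _ _ (clb z) (sqi_continuous _ _ _ cn)))//.
rewrite ler_wpM2r ?tail_ge0 ?lerD2l ?lerN2 ?cla//; by move=> t; rewrite sqr_ge0.
Qed.

Lemma tail_le nu (c : R) z : continuous nu -> (forall t, nu t <= c) -> 0 <= c ->
  tail nu z <= (b - a) * c.
Proof.
move=> cn nc c0; apply: (@le_trans _ _ (\int[mu]_(t in `[cl z, b]) c)).
  by apply: le_itg => //; [exact: continuous_itg|exact: itg_cst].
by rewrite Rint_cst ?clb// mulrC ler_wpM2r// lerD2l lerN2 cla.
Qed.

(** The expression squared in [P], with [f] and [p] standing for the difference quotients of the
    data [F] and of [u], and [q] for [u] itself. Keeping them abstract treats both difference
    operators and all nodes at once. *)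
Definition phi f p q z x := f x - \int[mu]_(t in `[cl z, b]) flux_kernel (p t x) (q t x).

Definition dphi p q v w z x :=
  - \int[mu]_(t in `[cl z, b]) dflux_kernel (p t x) (q t x) (v t x) (w t x).

Definition admissible_pair M m p q := [/\ joint_cont p, joint_cont q, (forall t x, `|p t x| <= M) &
  (forall t x, m ^+ 2 <= q t x)].

Lemma jc_th M m p q : 0 < m -> admissible_pair M m p q -> joint_cont (fun t x => flux_kernel (p t x) (q t x)).
Proof.
move=> m0 [cp cq _ Q]; apply: jcM => //; apply: ctV.
  by apply: ctZ; exact: ct_sqrt.
by move=> y; rewrite mulf_neq0// gt_eqF// sqrtr_gt0 (lt_le_trans _ (Q _ _))// exprn_gt0.
Qed.

Lemma jc_dth M m p q v w : 0 < m -> admissible_pair M m p q -> joint_cont v -> joint_cont w ->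
  joint_cont (fun t x => dflux_kernel (p t x) (q t x) (v t x) (w t x)).
Proof.
move=> m0 [cp cq _ Q] cv cw.
have s0 (y : R * R) : Num.sqrt (q y.1 y.2) != 0.
  by rewrite gt_eqF// sqrtr_gt0 (lt_le_trans _ (Q _ _))// exprn_gt0.
apply: jcB; apply: jcM => //.
- apply: ctV; first by apply: ctZ; exact: ct_sqrt.
  by move=> y; rewrite mulf_neq0.
- exact: jcM.
apply: ctV; first by apply: ctZ; apply: ctX; exact: ct_sqrt.
by move=> y; rewrite mulf_neq0// expf_neq0.
Qed.

Lemma jc_phi M m f p q : 0 < m -> admissible_pair M m p q -> continuous f -> joint_cont (phi f p q).
Proof.
move=> m0 A cf; apply: jcB; first exact: jc2.
by apply: jc_int_tail => //; exact: jc_th A.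
Qed.

Lemma jc_dphi M m p q v w : 0 < m -> admissible_pair M m p q -> joint_cont v -> joint_cont w ->
  joint_cont (dphi p q v w).
Proof.
move=> m0 A cv cw; apply: jcN; apply: jc_int_tail => //; exact: jc_dth A _ _.
Qed.

(** One of the two integrals in [P_n], after integration by parts, when [k] is [Psi n] and [dk] its
    derivative. *)
Definition Pi k dk f p q z := by_parts k dk (fun x => phi f p q z x ^+ 2).

Definition DPi k dk f p q v w z :=
  by_parts k dk (fun x => 2 * phi f p q z x * dphi p q v w z x).

(** The bounds of [theta_estimates] hold at each [t] and are integrated from [cl z] to [b]. The
    majorant [nu] depends on [t] only, so the bounds on increments are tail integrals, to which the
    Carleman estimate can be applied. In the last bound the increment enters through a constant [d],
    which leaves a single tail, linear in the direction. *)
Lemma tail_estimates M m : 0 <= M -> 0 < m -> exists2 C, 0 <= C &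
  forall f p1 q1 p2 q2, continuous f -> (forall x, `|f x| <= M) ->
    admissible_pair M m p1 q1 -> admissible_pair M m p2 q2 ->
  [/\ forall z x, `|phi f p1 q1 z x| <= C,
      forall v w nu z x, joint_cont v -> joint_cont w -> continuous nu ->
        (forall t x, `|v t x| <= nu t) -> (forall t x, `|w t x| <= nu t) ->
        `|dphi p1 q1 v w z x| <= C * tail nu z,
      forall nu z x, continuous nu ->
        (forall t x, `|p2 t x - p1 t x| <= nu t) ->
        (forall t x, `|q2 t x - q1 t x| <= nu t) ->
        `|phi f p2 q2 z x - phi f p1 q1 z x| <= C * tail nu z,
      forall nu z x, continuous nu ->
        (forall t x, `|p2 t x - p1 t x| <= nu t) ->
        (forall t x, `|q2 t x - q1 t x| <= nu t) ->
        `|phi f p2 q2 z x - phi f p1 q1 z x -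
          dphi p1 q1 (fun t x => p2 t x - p1 t x) (fun t x => q2 t x - q1 t x) z x|
        <= C * tail (fun t => nu t ^+ 2) z &
      forall v w nu d z x, joint_cont v -> joint_cont w -> continuous nu ->
        (forall t x, `|p2 t x - p1 t x| <= d) ->
        (forall t x, `|q2 t x - q1 t x| <= d) ->
        (forall t x, `|v t x| <= nu t) -> (forall t x, `|w t x| <= nu t) ->
        `|dphi p2 q2 v w z x - dphi p1 q1 v w z x| <= C * (d * tail nu z)].
Proof.
move=> M0 m0; have [C C0 HC] := theta_estimates M m M0 m0.
have bba : 0 <= b - a by rewrite subr_ge0.
have BC : 0 <= (b - a) * C by rewrite mulr_ge0.
have CC : C <= M + (b - a) * C + C by lra.
exists (M + (b - a) * C + C); first by rewrite !addr_ge0// addr_ge0.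
move=> f p1 q1 p2 q2 cf fM A1 A2.
have c1 x : continuous (fun t => flux_kernel (p1 t x) (q1 t x)) by exact: (jc_slice1 _ x (jc_th _ _ _ _ m0 A1)).
have c2 x : continuous (fun t => flux_kernel (p2 t x) (q2 t x)) by exact: (jc_slice1 _ x (jc_th _ _ _ _ m0 A2)).
have d1 v w x : joint_cont v -> joint_cont w -> continuous (fun t => dflux_kernel (p1 t x) (q1 t x) (v t x) (w t x)).
  by move=> cv cw; exact: (jc_slice1 _ x (jc_dth _ _ _ _ _ _ m0 A1 cv cw)).
have d2 v w x : joint_cont v -> joint_cont w -> continuous (fun t => dflux_kernel (p2 t x) (q2 t x) (v t x) (w t x)).
  by move=> cv cw; exact: (jc_slice1 _ x (jc_dth _ _ _ _ _ _ m0 A2 cv cw)).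
have T t x := HC (p1 t x) (q1 t x) (p2 t x) (q2 t x).
have {T} T t x : _ := T t x (let: And4 _ _ h _ := A1 in h t x)
  (let: And4 _ _ h _ := A2 in h t x) (let: And4 _ _ _ h := A1 in h t x)
  (let: And4 _ _ _ h := A2 in h t x).
have tC nu z (K : R) : continuous nu -> K * tail nu z = \int[mu]_(t in `[cl z, b]) (K * nu t).
  by move=> cn; rewrite /tail itgZ_E//; exact: continuous_itg.
have up nu z (X : R) : (forall t, 0 <= nu t) -> X <= C * tail nu z ->
    X <= (M + (b - a) * C + C) * tail nu z.
  by move=> n0 /le_trans; apply; rewrite ler_wpM2r// tail_ge0.
split.
- move=> z x; rewrite /phi -addrA; apply: le_normD => //; rewrite normrN.
  apply: (@le_trans _ _ ((b - a) * C)); last by lra.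
  apply: (@le_trans _ _ (\int[mu]_(t in `[cl z, b]) C)).
    apply: norm_itg_le; [exact: continuous_itg|exact: itg_cst|].
    by move=> t _; case: (T t x).
  by rewrite Rint_cst ?clb// mulrC ler_wpM2r// lerD2l lerN2 cla.
- move=> v w nu z x cv cw cn hv hw; apply: up.
    by move=> t; rewrite (le_trans _ (hv t x)).
  rewrite normrN tC//; apply: norm_itg_le.
  + by apply: continuous_itg; exact: d1.
  + by apply: continuous_itg; exact: ctZ.
  by move=> t _; have [_ h _ _ _] := T t x; exact: h.
- move=> nu z x cn hp hq; apply: up.
    by move=> t; rewrite (le_trans _ (hp t x)).
  have -> : phi f p2 q2 z x - phi f p1 q1 z x =
     - \int[mu]_(t in `[cl z, b]) (flux_kernel (p2 t x) (q2 t x) - flux_kernel (p1 t x) (q1 t x)).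
    by rewrite itgB_E; [rewrite /phi; ring|exact: continuous_itg|exact: continuous_itg].
  rewrite normrN tC//; apply: norm_itg_le.
  + by apply: continuous_itg; exact: ctB.
  + by apply: continuous_itg; exact: ctZ.
  by move=> t _; have [_ _ h _ _] := T t x; exact: h.
- move=> nu z x cn hp hq; apply: up.
    by move=> t; rewrite sqr_ge0.
  have cv : joint_cont (fun t x => p2 t x - p1 t x) by apply: jcB; [case: A2|case: A1].
  have cw : joint_cont (fun t x => q2 t x - q1 t x) by apply: jcB; [case: A2|case: A1].
  have D := d1 _ _ x cv cw.
  have -> : phi f p2 q2 z x - phi f p1 q1 z x -
     dphi p1 q1 (fun t x => p2 t x - p1 t x) (fun t x => q2 t x - q1 t x) z x =
     - \int[mu]_(t in `[cl z, b]) (flux_kernel (p2 t x) (q2 t x) - flux_kernel (p1 t x) (q1 t x) -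
        dflux_kernel (p1 t x) (q1 t x) (p2 t x - p1 t x) (q2 t x - q1 t x)).
    rewrite itgB_E; [|by apply: continuous_itg; exact: ctB|exact: continuous_itg].
    rewrite itgB_E; [|exact: continuous_itg|exact: continuous_itg].
    by rewrite /phi /dphi; ring.
  rewrite normrN tC; last exact: ctX.
  apply: norm_itg_le.
  + by apply: continuous_itg; apply: ctB => //; exact: ctB.
  + by apply: continuous_itg; apply: ctZ; exact: ctX.
  by move=> t _; have [_ _ _ h _] := T t x; exact: h.
move=> v w nu d z x cv cw cn hp hq hv hw.
have d0 : 0 <= d by rewrite (le_trans _ (hp 0 0)).
have -> : d * tail nu z = tail (fun t => d * nu t) z.
  by rewrite /tail itgZ_E//; exact: continuous_itg.
apply: up.
  by move=> t; rewrite mulr_ge0// (le_trans _ (hv t x)).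
have -> : dphi p2 q2 v w z x - dphi p1 q1 v w z x =
   - \int[mu]_(t in `[cl z, b]) (dflux_kernel (p2 t x) (q2 t x) (v t x) (w t x) -
      dflux_kernel (p1 t x) (q1 t x) (v t x) (w t x)).
  rewrite itgB_E; [|by apply: continuous_itg; exact: d2|by apply: continuous_itg; exact: d1].
  by rewrite /dphi; ring.
rewrite normrN tC; last exact: ctZ.
apply: norm_itg_le.
- by apply: continuous_itg; apply: ctB; [exact: d2|exact: d1].
- by apply: continuous_itg; do 2 apply: ctZ.
by move=> t _; have [_ _ _ _ h] := T t x; exact: h.
Qed.

End Flux.

Section FluxSquared.
Context {R : realType}.
Variables (a b : R) (ab : a <= b).
Implicit Types (p q v w : R -> R -> R) (f nu k dk : R -> R) (z x M m : R).
Local Notation tail := (tail a b).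
Local Notation phi := (phi a b).
Local Notation dphi := (dphi a b).
Local Notation Pi := (Pi a b).
Local Notation DPi := (DPi a b).

Lemma sqr_le_norm (x X : R) : `|x| <= X -> x ^+ 2 <= X ^+ 2.
Proof. by move=> h; rewrite -(real_normK (num_real x)) lerXn2r// nnegrE (le_trans _ h). Qed.

Lemma continuous_Pi M m k dk f p q : 0 < m -> continuous dk -> continuous f ->
  admissible_pair M m p q -> continuous (Pi k dk f p q).
Proof.
move=> m0 cdk cf A; apply: (continuous_bfun k dk (fun z x => phi f p q z x ^+ 2)) => //.
by apply: ctX; exact: jc_phi A cf.
Qed.

Lemma jc_2phi_dphi M m f p q v w : 0 < m -> continuous f ->
  admissible_pair M m p q -> joint_cont v -> joint_cont w -> joint_cont (fun z x => 2 * phi f p q z x * dphi p q v w z x).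
Proof.
move=> m0 cf A cv cw; apply: jcM; first by apply: jcZ; exact: jc_phi A cf.
exact: jc_dphi A cv cw.
Qed.

Lemma continuous_DPi M m k dk f p q v w : 0 < m -> continuous dk -> continuous f ->
  admissible_pair M m p q -> joint_cont v -> joint_cont w -> continuous (DPi k dk f p q v w).
Proof.
move=> m0 cdk cf A cv cw; apply: (continuous_bfun k dk _ cdk).
exact: jc_2phi_dphi A cv cw.
Qed.

(** Bounds linear in [nu] are squared on the left: Cauchy-Schwarz turns the square of [tail nu] into
    a tail of [nu ^+ 2], the quantity comparable with the weighted L2 norm. The second-order
    remainder is already quadratic in [nu] and stays unsquared. *)
Lemma Pi_estimates k dk M m : continuous dk -> 0 <= M -> 0 < m -> exists2 C, 0 <= C &
  forall f p1 q1 p2 q2, continuous f -> (forall x, `|f x| <= M) ->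
    admissible_pair M m p1 q1 -> admissible_pair M m p2 q2 ->
  [/\ forall z, `|Pi k dk f p1 q1 z| <= C,
      forall v w nu z, joint_cont v -> joint_cont w -> continuous nu ->
        (forall t x, `|v t x| <= nu t) -> (forall t x, `|w t x| <= nu t) ->
        DPi k dk f p1 q1 v w z ^+ 2 <= C * tail (fun t => nu t ^+ 2) z,
      forall nu z, continuous nu ->
        (forall t x, `|p2 t x - p1 t x| <= nu t) ->
        (forall t x, `|q2 t x - q1 t x| <= nu t) ->
        (Pi k dk f p2 q2 z - Pi k dk f p1 q1 z) ^+ 2 <= C * tail (fun t => nu t ^+ 2) z,
      forall nu z, continuous nu ->
        (forall t x, `|p2 t x - p1 t x| <= nu t) ->
        (forall t x, `|q2 t x - q1 t x| <= nu t) ->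
        `|Pi k dk f p2 q2 z - Pi k dk f p1 q1 z -
          DPi k dk f p1 q1 (fun t x => p2 t x - p1 t x) (fun t x => q2 t x - q1 t x) z|
        <= C * tail (fun t => nu t ^+ 2) z &
      forall v w nu d z, joint_cont v -> joint_cont w -> continuous nu ->
        (forall t x, `|p2 t x - p1 t x| <= d) ->
        (forall t x, `|q2 t x - q1 t x| <= d) ->
        (forall t x, `|v t x| <= nu t) -> (forall t x, `|w t x| <= nu t) ->
        (DPi k dk f p2 q2 v w z - DPi k dk f p1 q1 v w z) ^+ 2
        <= C * (d ^+ 2 * tail (fun t => nu t ^+ 2) z)].
Proof.
move=> cdk M0 m0; have [C C0 HC] := tail_estimates _ _ ab M m M0 m0.
have [K K0 HK] := bfun_bound k dk cdk.
pose L := b - a.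
have L0 : 0 <= L by rewrite subr_ge0.
(* [e1] serves for [Pi] itself, [e2] for its increment and its differential, [e3] for the
   second-order remainder, [e4] for the variation of the differential. [L] comes from
   Cauchy-Schwarz, the factors 2 from differentiating or factoring squares. *)
pose e1 := K * C ^+ 2.
pose e2 := (K * (2 * C * C)) ^+ 2 * L.
pose e3 := K * (2 * C * C + C ^+ 2 * L).
pose e4 := (K * (2 * (C * L) * C + 2 * C * C)) ^+ 2 * L.
have C2 : 0 <= 2 * C by rewrite mulr_ge0.
have e10 : 0 <= e1 by rewrite mulr_ge0// sqr_ge0.
have e20 : 0 <= e2 by rewrite mulr_ge0// sqr_ge0.
have e30 : 0 <= e3.
  by rewrite mulr_ge0// addr_ge0 ?mulr_ge0// exprn_ge0.
have e40 : 0 <= e4 by rewrite mulr_ge0// sqr_ge0.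
exists (e1 + e2 + e3 + e4); first by apply: addr_ge0 => //; apply: addr_ge0 => //; exact: addr_ge0.
move=> f p1 q1 p2 q2 cf fM A1 A2.
have [T1 T2 T3 T4 T5] := HC f p1 q1 p2 q2 cf fM A1 A2.
have [U1 U2 _ _ _] := HC f p2 q2 p1 q1 cf fM A2 A1.
have cp1 z : continuous (phi f p1 q1 z) by exact: (jc_slice2 _ z (jc_phi _ _ ab _ _ _ _ _ m0 A1 cf)).
have cp2 z : continuous (phi f p2 q2 z) by exact: (jc_slice2 _ z (jc_phi _ _ ab _ _ _ _ _ m0 A2 cf)).
have cd1 v w z : joint_cont v -> joint_cont w -> continuous (dphi p1 q1 v w z).
  by move=> cv cw; exact: (jc_slice2 _ z (jc_dphi _ _ ab _ _ _ _ _ _ m0 A1 cv cw)).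
have cd2 v w z : joint_cont v -> joint_cont w -> continuous (dphi p2 q2 v w z).
  by move=> cv cw; exact: (jc_slice2 _ z (jc_dphi _ _ ab _ _ _ _ _ _ m0 A2 cv cw)).
have up X e nu z : 0 <= e -> e <= e1 + e2 + e3 + e4 ->
    X <= e * tail (fun t => nu t ^+ 2) z ->
    X <= (e1 + e2 + e3 + e4) * tail (fun t => nu t ^+ 2) z.
  move=> e0 ee /le_trans; apply; rewrite ler_wpM2r// tail_ge0// => t.
  by rewrite sqr_ge0.
have sq (X c : R) nu z : continuous nu -> `|X| <= c * tail nu z ->
    X ^+ 2 <= c ^+ 2 * L * tail (fun t => nu t ^+ 2) z.
  move=> cn /sqr_le_norm/le_trans; apply.
  by rewrite exprMn -mulrA ler_wpM2l ?sqr_ge0// tail_sqr.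
split.
- move=> z; apply: (@le_trans _ _ e1); last by lra.
  by apply: HK; [exact: ctX|move=> x _; exact: le_normX].
- move=> v w nu z cv cw cn hv hw; apply: (up _ e2) => //; first by lra.
  apply: sq => //; rewrite -(mulrA K); apply: HK.
    by apply: ctM; [exact: ctZ|exact: cd1].
  move=> x _; rewrite -[leRHS]mulrA; apply: le_normM; last exact: T2.
  by apply: le_normM => //; rewrite ger0_norm.
- move=> nu z cn hp hq; apply: (up _ e2) => //; first by lra.
  apply: sq => //; rewrite -(mulrA K) -bfunB//; try exact: ctX.
  apply: HK; first by apply: ctB; exact: ctX.
  move=> x _; rewrite subr_sqr mulrC -[leRHS]mulrA; apply: le_normM; last exact: T3.
  by rewrite (_ : 2 * C = C + C); [exact: le_normD|ring].
- move=> nu z cn hp hq; apply: (up _ e3) => //; first by lra.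
  have cv : joint_cont (fun t x => p2 t x - p1 t x) by apply: jcB; [case: A2|case: A1].
  have cw : joint_cont (fun t x => q2 t x - q1 t x) by apply: jcB; [case: A2|case: A1].
  have cE : continuous (fun x => 2 * phi f p1 q1 z x *
      dphi p1 q1 (fun t x => p2 t x - p1 t x) (fun t x => q2 t x - q1 t x) z x).
    by apply: ctM; [exact: ctZ|exact: cd1].
  rewrite -bfunB//; try exact: ctX.
  rewrite -bfunB//; [|by apply: ctB; exact: ctX].
  rewrite /e3 -(mulrA K); apply: HK.
    by apply: ctB => //; apply: ctB; exact: ctX.
  move=> x _; set D := dphi _ _ _ _ _ _.
  have -> : phi f p2 q2 z x ^+ 2 - phi f p1 q1 z x ^+ 2 - 2 * phi f p1 q1 z x * D =
    2 * phi f p1 q1 z x * (phi f p2 q2 z x - phi f p1 q1 z x - D) +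
    (phi f p2 q2 z x - phi f p1 q1 z x) ^+ 2 by ring.
  rewrite [leRHS]mulrDl; apply: le_normD.
    rewrite -[leRHS]mulrA; apply: le_normM; last exact: T4.
    by apply: le_normM => //; rewrite ger0_norm.
  rewrite ger0_norm ?sqr_ge0//; apply: sq => //; exact: T3.
move=> v w nu d z cv cw cn hp hq hv hw.
have d0 : 0 <= d by rewrite (le_trans _ (hp 0 0)).
have -> : (e1 + e2 + e3 + e4) * (d ^+ 2 * tail (fun t => nu t ^+ 2) z) =
  (e1 + e2 + e3 + e4) * tail (fun t => (d * nu t) ^+ 2) z.
  congr (_ * _); rewrite /tail.
  rewrite -itgZ_E; last by apply: continuous_itg; exact: ctX.
  by apply: eq_Rintegral => t _; rewrite exprMn.
apply: (up _ e4) => //; first by lra.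
apply: sq; first exact: ctZ.
have -> : tail (fun t => d * nu t) z = d * tail nu z.
  by rewrite /tail itgZ_E//; exact: continuous_itg.
have c2E : continuous (fun x => 2 * phi f p2 q2 z x * dphi p2 q2 v w z x).
  by apply: ctM; [exact: ctZ|exact: cd2].
have c1E : continuous (fun x => 2 * phi f p1 q1 z x * dphi p1 q1 v w z x).
  by apply: ctM; [exact: ctZ|exact: cd1].
rewrite /DPi -(bfunB _ _ _ _ cdk c2E c1E).
rewrite -(mulrA K); apply: HK.
  exact: ctB c2E c1E.
move=> x _.
have -> : 2 * phi f p2 q2 z x * dphi p2 q2 v w z x - 2 * phi f p1 q1 z x * dphi p1 q1 v w z x
 = 2 * (phi f p2 q2 z x - phi f p1 q1 z x) * dphi p2 q2 v w z x +
   2 * phi f p1 q1 z x * (dphi p2 q2 v w z x - dphi p1 q1 v w z x) by ring.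
have residual_node : 0 <= tail nu z by rewrite tail_ge0// => t; rewrite (le_trans _ (hv t 0)).
have -> : (2 * (C * L) * C + 2 * C * C) * (d * tail nu z) =
   2 * (C * (L * d)) * (C * tail nu z) + 2 * C * (C * (d * tail nu z)) by ring.
apply: le_normD; last first.
  by apply: le_normM; [apply: le_normM => //; rewrite ger0_norm|exact: T5].
apply: le_normM; last exact: U2.
apply: le_normM; first by rewrite ger0_norm.
(* Only the size of the increment of [phi] matters here, so the constant [d] is taken as the
   majorant; its tail is at most [L * d]. *)
apply: (le_trans (T3 (fun=> d) z x (ct_cst d) hp hq)).
by rewrite ler_wpM2l//; apply: tail_le => //; exact: ct_cst.
Qed.

Lemma dthD (p q v1 v2 w1 w2 : R) : dflux_kernel p q (v1 + v2) (w1 + w2) =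
  dflux_kernel p q v1 w1 + dflux_kernel p q v2 w2.
Proof. by rewrite /dflux_kernel; ring. Qed.

Lemma dthZ (p q c v w : R) : dflux_kernel p q (c * v) (c * w) = c * dflux_kernel p q v w.
Proof. by rewrite /dflux_kernel; ring. Qed.

End FluxSquared.

(** * Representing the differential by a density in [t] *)

Section FluxRepresentation.
Context {R : realType}.
Variables (a b : R) (ab : a <= b).
Implicit Types (p q v w : R -> R -> R) (f nu k dk : R -> R) (z x M m : R).
Local Notation mu := (@lebesgue_measure R).
Local Notation cl := (clamp a b).
Local Notation phi := (phi a b).
Local Notation dphi := (dphi a b).
Local Notation DPi := (DPi a b).

Lemma DPi_sum (T : Type) (s : seq T) M m k dk f p q (v w : T -> R -> R -> R) z :
  0 < m -> continuous dk -> continuous f -> admissible_pair M m p q ->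
  (forall i, joint_cont (v i)) -> (forall i, joint_cont (w i)) ->
  DPi k dk f p q (fun t x => \sum_(i <- s) v i t x) (fun t x => \sum_(i <- s) w i t x) z
  = \sum_(i <- s) DPi k dk f p q (v i) (w i) z.
Proof.
move=> m0 cdk cf A cv cw.
have cp : continuous (phi f p q z) by exact: (jc_slice2 _ z (jc_phi _ _ ab _ _ _ _ _ m0 A cf)).
have cd v' w' : joint_cont v' -> joint_cont w' -> continuous (dphi p q v' w' z).
  by move=> cv' cw'; exact: (jc_slice2 _ z (jc_dphi _ _ ab _ _ _ _ _ _ m0 A cv' cw')).
have id v' w' x : joint_cont v' -> joint_cont w' ->
    continuous (fun t => dflux_kernel (p t x) (q t x) (v' t x) (w' t x)).
  by move=> cv' cw'; exact: (jc_slice1 _ x (jc_dth _ _ _ _ _ _ m0 A cv' cw')).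
elim: s => [|i s IH].
  (* The zero function is written as 0 times a continuous one, so that homogeneity gives the value
     0. *)
  rewrite big_nil /DPi (_ : (fun x => _) = fun x => 0 * (2 * phi f p q z x * 0)).
    by rewrite bfunZ ?mul0r//; apply: ctM; [exact: ctZ|exact: ct_cst].
  apply/funext => x; rewrite mul0r /dphi; apply/eqP; rewrite mulf_eq0 oppr_eq0.
  apply/orP; right; apply/eqP; transitivity (\int[mu]_(t in `[cl z, b]) (0 : R)).
    by apply: eq_Rintegral => t _; rewrite !big_nil /dflux_kernel; ring.
  by rewrite Rint_cst ?mul0r// clb.
rewrite big_cons -IH /DPi -bfunD//.
- congr by_parts; apply/funext => x; rewrite -mulrDr; congr (_ * _).
  rewrite /dphi -opprD -itgD_E; [|exact: (continuous_itg _ _ _ (id _ _ x (cv i) (cw i)))|exact: (continuous_itg _ _ _ (id _ _ x (jc_sum _ s v cv) (jc_sum _ s w cw)))].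
  congr (- _); apply: eq_Rintegral => t _; rewrite !big_cons; exact: dthD.
- by apply: ctM; [exact: ctZ|exact: cd].
- by apply: ctM; [exact: ctZ|exact: (cd _ _ (jc_sum _ s v cv) (jc_sum _ s w cw))].
Qed.

(** For a direction that splits as [c t] times functions of [x], the factor [c] can be isolated: the
    integral in [z] is pulled inside [by_parts], the order of [t] and [z] is exchanged on the
    triangle, and the integral in [t] is pulled out again. What multiplies [c t] is the density. *)
Lemma DPi_rep M m k dk f p q (s al be : R -> R) :
  0 < m -> continuous dk -> continuous f -> admissible_pair M m p q ->
  continuous s -> continuous al -> continuous be ->
  exists2 r : R -> R, continuous r & forall c : R -> R, continuous c ->
    \int[mu]_(z in `[a, b])
      (s z * DPi k dk f p q (fun t x => c t * al x) (fun t x => c t * be x) z) =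
    \int[mu]_(t in `[a, b]) (r t * c t).
Proof.
move=> m0 cdk cf A cs cal cbe.
pose ka t x := dflux_kernel (p t x) (q t x) (al x) (be x).
have cka : joint_cont ka by apply: (jc_dth _ _ _ _ _ _ m0 A); exact: jc2.
have cph := jc_phi _ _ ab _ _ _ _ _ m0 A cf.
pose H z x := s z * (2 * phi f p q z x).
have cH : joint_cont H by apply: jcM; [exact: jc1|exact: jcZ].
(* The integral of [H] over [z] from [a] to [t], written as a total minus a clamped tail so that
   joint continuity comes from [jc_int_tail]. *)
pose G t x := \int[mu]_(z in `[a, b]) H z x - \int[mu]_(z in `[cl t, b]) H z x.
have cG : joint_cont G.
  by apply: jcB; [apply: jc2; exact: continuous_int|exact: jc_int_tail].
have cKG : joint_cont (fun t x => ka t x * G t x) by exact: jcM.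
exists (fun t => - by_parts k dk (fun x => ka t x * G t x)).
  by apply: ctN; exact: continuous_bfun.
move=> c cc.
pose v (t x : R) := c t * al x; pose w (t x : R) := c t * be x.
have cv : joint_cont v by apply: jcM; [exact: jc1|exact: jc2].
have cw : joint_cont w by apply: jcM; [exact: jc1|exact: jc2].
have cd := jc_dphi _ _ ab _ _ _ _ _ _ m0 A cv cw.
rewrite bfun_int//; last by apply: jcM => //; exact: jcZ.
transitivity (by_parts k dk (fun x => \int[mu]_(t in `[a, b]) (- c t * (ka t x * G t x)))).
  apply: eq_bfun => x _.
  have ckx : continuous (fun t => ka t x * c t) by apply: ctM => //; exact: jc_slice1.
  have cHx : continuous (fun z => H z x) by exact: jc_slice1.
  transitivity (- \int[mu]_(z in `[a, b]) (H z x * \int[mu]_(t in `[z, b]) (ka t x * c t))).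
    rewrite -itgN_E; last first.
      apply: (eq_itg (fun z => H z x * tail a b (fun t => ka t x * c t) z)).
        by move=> z; rewrite in_itv/= => zab; rewrite /tail clamp_id.
      by apply: continuous_itg; apply: ctM => //; exact: continuous_tail.
    apply: eq_Rintegral => z; rewrite inE/= in_itv/= => zab.
    rewrite /dphi clamp_id// /H.
    have -> : \int[mu]_(t in `[z, b]) dflux_kernel (p t x) (q t x) (v t x) (w t x) =
       \int[mu]_(t in `[z, b]) (ka t x * c t).
      by apply: eq_Rintegral => t _; rewrite /v /w dthZ mulrC.
    by ring.
  rewrite -triangle_continuous// -itgN_E; last first.
    apply: (eq_itg (fun t => ka t x * c t * G t x)).
      move=> t; rewrite in_itv/= => /andP[at_ tb].
      rewrite /G clamp_id ?at_//; congr (_ * _).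
      by rewrite (itg_split (fun z => H z x) _ _ _ at_ tb) ?addrK//; exact: continuous_itg.
    by apply: continuous_itg; apply: ctM => //; exact: jc_slice1.
  apply: eq_Rintegral => t; rewrite inE/= in_itv/= => /andP[at_ tb].
  rewrite /G clamp_id ?at_// (itg_split (fun z => H z x) _ _ _ at_ tb); last exact: continuous_itg.
  by rewrite addrK; ring.
rewrite -(bfun_int k dk _ _ (fun t => - c t) (fun t x => ka t x * G t x))//; last exact: ctN.
by apply: eq_Rintegral => t _; ring.
Qed.

End FluxRepresentation.

(** * A boundary value problem for the Riesz representer *)

Section Green.
Context {R : realType}.
Variables (A sigma : R) (s0 : 0 < sigma).
Local Notation mu := (@lebesgue_measure R).
Local Notation b := (A + sigma).

Let Ab : A <= b. Proof. by rewrite lerDl ltW. Qed.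

Lemma derive_within (f df : R -> R) :
  (forall x : R, A <= x <= b -> is_derive x 1 f (df x)) -> {within `[A, b], continuous f}.
Proof.
move=> H; apply/subspace_continuousP => x; rewrite /= in_itv/= => /H/is_derive_continuous.
exact: cvg_within_filter.
Qed.

(** This is the equation [f'' = f - m] with [g = f'], factored into the first-order equations
    [y' = y - m] and [f' + f = y], each solved with an integrating factor. *)
Lemma ode_particular (m : R -> R) : continuous m -> exists f g : R -> R,
  [/\ f A = 0, forall x : R, A <= x <= b -> is_derive x 1 f (g x) &
      forall x : R, A <= x <= b -> is_derive x 1 g (f x - m x)].
Proof.
move=> cm.
pose Mi z := \int[mu]_(t in `[A - 1, z]) (expR (- t) * m t).
have ce : continuous (fun t : R => expR (- t)).
  move=> t; apply: continuous_comp; last exact: continuous_expR.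
  by apply: cvgN; exact: cvg_id.
have dMi (z : R) : A <= z <= b -> is_derive z 1 Mi (expR (- z) * m z).
  move=> /andP[Az _]; apply: ftc1; first exact: ctM.
  lra.
pose y z := expR z * - Mi z.
have ee (z : R) : expR z * expR (- z) = 1 by rewrite expRN mulfV// gt_eqF// expR_gt0.
have dy (z : R) : A <= z <= b -> is_derive z 1 y (y z - m z).
  move=> /dMi d; apply: is_derive_eq; rewrite /y /GRing.scale/=.
  by rewrite mulrN mulrA ee; ring.
have cy : continuous (y \o clamp A b).
  by apply: clamp_comp_continuous => //; exact: derive_within dy.
pose Y z := \int[mu]_(t in `[A - 1, z]) (expR t * y (clamp A b t)).
have dY (z : R) : A <= z <= b -> is_derive z 1 Y (expR z * y z).
  move=> zab; have Az : A - 1 < z by move: zab; lra.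
  have cY : continuous (fun t => expR t * y (clamp A b t)).
    by apply: ctM; [exact: continuous_expR|exact: cy].
  by have := ftc1 _ _ _ cY Az; rewrite /= clamp_id.
pose f z := expR (- z) * (Y z - Y A).
have df (z : R) : A <= z <= b -> is_derive z 1 f (y z - f z).
  move=> /dY d; apply: is_derive_eq; rewrite /f /GRing.scale/=.
  have -> : expR (- z) * (expR z * y z - 0) = (expR z * expR (- z)) * y z by ring.
  by rewrite ee; ring.
exists f, (fun z => y z - f z); split => //.
- by rewrite /f subrr mulr0.
by move=> z zab; have [d1 d2] := (dy z zab, df z zab); apply: is_derive_eq; ring.
Qed.

(** Subtract a multiple of the homogeneous solution [2 * sinh (z - A)], which vanishes at [A] and
    whose derivative is positive at [b]. *)
Lemma ode_boundary (m : R -> R) : continuous m -> exists f g : R -> R,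
  [/\ f A = 0, g b = 0, forall x : R, A <= x <= b -> is_derive x 1 f (g x) &
      forall x : R, A <= x <= b -> is_derive x 1 g (f x - m x)].
Proof.
move=> /ode_particular[f [g [f0 df dg]]].
pose w (z : R) := expR (z - A) - expR (A - z).
pose w' (z : R) := expR (z - A) + expR (A - z).
have dw (z : R) : is_derive z 1 w (w' z).
  by apply: is_derive_eq; rewrite /w' /GRing.scale/=; ring.
have dw' (z : R) : is_derive z 1 w' (w z).
  by apply: is_derive_eq; rewrite /w /GRing.scale/=; ring.
have wb : 0 < w' b by rewrite addr_gt0// expR_gt0.
pose c := g b / w' b.
exists (fun z => f z - c * w z), (fun z => g z - c * w' z); split.
- by rewrite f0 /w !subrr mulr0 subrr.
- by rewrite /c divfK ?subrr// gt_eqF.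
- move=> z /df d; have d' := dw z; apply: is_derive_eq; rewrite /GRing.scale/=; ring.
move=> z /dg d; have d' := dw' z; apply: is_derive_eq; rewrite /GRing.scale/=; ring.
Qed.

(** The weak form of [f'' = f - m] with [f A = 0] and [f' b = 0]: since [g t] is the integral of
    [m - f] from [t] to [b], [triangle_itg] carries it from the weak derivative [q] over to [V]. So
    [f] represents the functional [V |-> int m V] in the scalar product of H1. *)
Lemma green (m : R -> R) : continuous m -> exists f g : R -> R,
  [/\ f A = 0, is_weak_deriv A sigma f g &
   forall V q, is_weak_deriv A sigma V q -> V A = 0 ->
     \int[mu]_(z in `[A, b]) (f z * V z) + \int[mu]_(z in `[A, b]) (g z * q z) =
     \int[mu]_(z in `[A, b]) (m z * V z)].
Proof.
move=> cm; have [f [g [f0 gb df dg]]] := ode_boundary m cm.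
have wf := derive_within _ _ df; have wg := derive_within _ _ dg.
have cf : continuous (f \o clamp A b) by exact: clamp_comp_continuous.
have sg := sqi_within _ _ _ wg.
exists f, g; split => //.
  split; [by case: sg|by case: sg|].
  move=> z; rewrite /= in_itv/= => /andP[Az zb].
  have S : `[A, z]%classic `<=` `[A, b]%classic.
    by move=> x /=; rewrite !in_itv/= => /andP[-> xz]; exact: le_trans zb.
  have d (x : R) : A < x < z -> is_derive x 1 f (g x).
    by move=> /andP[Ax xz]; apply: df; rewrite ltW//= (le_trans (ltW xz)).
  by rewrite (ftc2 f g A z Az (continuous_subspaceW S wg) d (continuous_subspaceW S wf)) addrC subrK.
move=> V q [mq q2 VE] VA.
have sq : sq_integrable A b q by split.
have iq := sqi_itg _ _ _ sq.
pose s z := m z - f (clamp A b z).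
have cs : continuous s by exact: ctB.
have gE t : A <= t <= b -> g t = \int[mu]_(z in `[t, b]) s z.
  move=> /andP[At tb].
  have S : `[t, b]%classic `<=` `[A, b]%classic.
    by move=> x /=; rewrite !in_itv/= => /andP[tx ->]; rewrite andbT; exact: le_trans tx.
  have wN : {within `[A, b], continuous (fun z => - g z)}.
    by move=> x; apply: (@continuousN R _ (subspace `[A, b])); exact: wg.
  have d (x : R) : t < x < b -> is_derive x 1 (fun z => - g z) (s x).
    move=> /andP[tx xb]; have xab : A <= x <= b by rewrite (le_trans At (ltW tx)) ltW.
    have d := dg x xab; apply: is_derive_eq.
    by rewrite /s clamp_id// opprB.
  rewrite (ftc2 (fun z => - g z) s t b tb (continuous_subspaceT cs) d (continuous_subspaceW S wN)).
  by rewrite gb oppr0 add0r opprK.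
have VE' z : A <= z <= b -> V z = \int[mu]_(t in `[A, z]) q t.
  by move=> zab; rewrite VE ?VA ?add0r//= in_itv.
have cV : {within `[A, b], continuous V}.
  apply: (subspace_eq_continuous _ (int_head_within A b q Ab iq)).
  by move=> z; rewrite inE/= in_itv/= => zab; by [exact: VE'|exact: (esym (VE' z zab))].
have sV := sqi_within _ _ _ cV.
have -> : \int[mu]_(z in `[A, b]) (g z * q z) = \int[mu]_(z in `[A, b]) (s z * V z).
  transitivity (\int[mu]_(t in `[A, b]) (q t * \int[mu]_(z in `[t, b]) s z)).
    by apply: eq_Rintegral => t; rewrite inE/= in_itv/= => /gE ->; rewrite mulrC.
  rewrite -triangle_itg//; apply: eq_Rintegral => z; rewrite inE/= in_itv/= => /VE' ->.
  by [].
have ss := sqi_continuous A b _ cs.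
have sf := sqi_within _ _ _ wf.
rewrite -itgD_E; [|exact: sqi_mul|exact: sqi_mul].
apply: eq_Rintegral => z; rewrite inE/= in_itv/= => zab.
by rewrite /s clamp_id//; ring.
Qed.

End Green.

Lemma discriminant_le (R : realFieldType) (a b c : R) : 0 <= a ->
  (forall t, 0 <= t ^+ 2 * a + 2 * t * b + c) -> b ^+ 2 <= a * c.
Proof.
rewrite le_eqVlt => /predU1P[<-|a0] H.
  rewrite mul0r; have [->|b0] := eqVneq b 0; first by rewrite expr0n.
  (* With [a = 0] the polynomial takes the value -1 at this point. *)
  have := H (- (c + 1) / (2 * b)).
  have -> : 2 * (- (c + 1) / (2 * b)) * b = - (c + 1) by field.
  by rewrite mulr0; lra.
have := H (- b / a).
have -> : (- b / a) ^+ 2 * a + 2 * (- b / a) * b + c = (a * c - b ^+ 2) / a.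
  by field; rewrite gt_eqF.
by rewrite pmulr_lge0 ?invr_gt0// subr_ge0.
Qed.

Section Nodes.
Variables (N B : nat).

(** Only interior nodes: the norms sum over these, and elements of [H10] vanish at the others. One
    list replaces the triple sums. *)
Definition nodes : seq ('I_N * nat * nat) :=
  [seq (p, j) | p <- [seq (k, i) | k <- index_enum 'I_N, i <- index_iota 1 B],
                j <- index_iota 1 B].

Lemma sum_nodes (V : nmodType) (f : 'I_N -> nat -> nat -> V) :
  \sum_(k < N) \sum_(1 <= i < B) \sum_(1 <= j < B) f k i j =
  \sum_(e <- nodes) f e.1.1 e.1.2 e.2.
Proof. by rewrite /nodes !big_allpairs. Qed.

Lemma mem_nodes e : e \in nodes -> (1 <= e.1.2 < B)%N /\ (1 <= e.2 < B)%N.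
Proof.
move=> /allpairsP[[p j]] /= [/allpairsP[[k i]] /= [_ i1 ->] j1 ->] /=.
by move: i1 j1; rewrite !mem_index_iota.
Qed.

Lemma nodes_mem k i j : (1 <= i < B)%N -> (1 <= j < B)%N -> (k, i, j) \in nodes.
Proof.
move=> iB jB; apply/allpairsP; exists ((k, i), j); rewrite /= mem_index_iota jB.
split=> //; apply/allpairsP; exists (k, i); rewrite /= mem_index_iota iB.
by split=> //; rewrite mem_index_enum.
Qed.

Lemma nodes_leB e : e \in nodes -> (e.1.2 <= B)%N /\ (e.2 <= B)%N.
Proof. by move=> /mem_nodes[/andP[_ /ltnW ->] /andP[_ /ltnW ->]]. Qed.

End Nodes.

(** * The Hilbert space of semidiscrete functions *)

Section HilbertSpace.
Context {R : realType}.
Variables (A sigma h : R) (B N : nat) (s0 : 0 < sigma) (h0 : 0 < h).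
Implicit Types (Q U V W : sdfun R N) (c : R).
Local Notation mu := (@lebesgue_measure R).
Local Notation b := (A + sigma).
Local Notation nodes := (nodes N B).
Local Notation L2_dot := (L2_dot A sigma h B).
Local Notation L2_norm := (L2_norm A sigma h B).
Local Notation H1_dot := (H1_dot A sigma h B).
Local Notation H1_norm := (H1_norm A sigma h B).
Local Notation H10 := (H10 A sigma B).
Local Notation dz := (dz A sigma).

Lemma le_Ab : A <= b. Proof. by rewrite lerDl ltW. Qed.

Definition at_node Q (e : 'I_N * nat * nat) : R -> R := Q e.1.1 e.1.2 e.2.

Definition L2class Q := forall e, e \in nodes -> sq_integrable A b (at_node Q e).

Lemma Rint_sum_in (T : eqType) (s : seq T) (f : T -> R -> R) (x y : R) :
  (forall i, i \in s -> itg x y (f i)) ->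
  itg x y (fun z => \sum_(i <- s) f i z) /\
  \int[mu]_(z in `[x, y]) (\sum_(i <- s) f i z) =
  \sum_(i <- s) \int[mu]_(z in `[x, y]) f i z.
Proof.
move=> fi; pose g i := if i \in s then f i else cst 0.
have gi i : itg x y (g i).
  by rewrite /g; case: ifP => [/fi//|_]; exact: itg_cst.
have E : (fun z => \sum_(i <- s) f i z) = (fun z => \sum_(i <- s) g i z).
  by apply/funext => z; apply: eq_big_seq => i; rewrite /g => ->.
rewrite E; split; first exact: itg_sum.
by rewrite Rint_sum//; apply: eq_big_seq => i; rewrite /g => ->.
Qed.

Lemma L2_dotE Q V : L2class Q -> L2class V ->
  L2_dot Q V = h ^+ 2 * \sum_(e <- nodes) \int[mu]_(z in `[A, b]) (at_node Q e z * at_node V e z).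
Proof.
move=> LQ LV.
have [i1 i2] := Rint_sum_in _ nodes (fun e z => at_node Q e z * at_node V e z) A b
  (fun e he => sqi_mul _ _ _ _ (LQ e he) (LV e he)).
by rewrite -i2 -itgZ_E//; apply: eq_Rintegral => z _; rewrite sum_nodes.
Qed.

Lemma L2_dotC Q V : L2_dot Q V = L2_dot V Q.
Proof.
apply: eq_Rintegral => z _; congr (_ * _).
by apply: eq_bigr => k _; apply: eq_bigr => i _; apply: eq_bigr => j _; rewrite mulrC.
Qed.

Lemma L2_dot_ge0 Q : 0 <= L2_dot Q Q.
Proof.
apply: Rintegral_ge0 => z _; rewrite mulr_ge0 ?sqr_ge0// sum_nodes.
by apply: sumr_ge0 => e _; rewrite -expr2 sqr_ge0.
Qed.

Lemma L2_norm_sqr Q : L2_norm Q ^+ 2 = L2_dot Q Q.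
Proof. by rewrite sqr_sqrtr// L2_dot_ge0. Qed.

Lemma L2class_lin c U V : L2class U -> L2class V -> L2class (c *: U + V).
Proof. by move=> LU LV e he; apply: sqiD; [apply: sqiZ; exact: LU|exact: LV]. Qed.

Lemma L2_dot_linl c U V W : L2class U -> L2class V -> L2class W ->
  L2_dot (c *: U + V) W = c * L2_dot U W + L2_dot V W.
Proof.
move=> LU LV LW; rewrite !L2_dotE//; last exact: L2class_lin.
rewrite [c * _]mulrCA -mulrDr [c * _]mulr_sumr -big_split/=; congr (_ * _).
apply: eq_big_seq => e he.
have [i1 i2] := (sqi_mul _ _ _ _ (LU e he) (LW e he), sqi_mul _ _ _ _ (LV e he) (LW e he)).
rewrite -itgZ_E// -itgD_E//; last exact: itgZ.
by apply: eq_Rintegral => z _; rewrite mulrA -mulrDl.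
Qed.

Lemma dzP W k i j : H10 W -> (i <= B)%N -> (j <= B)%N ->
  is_weak_deriv A sigma (W k i j) (dz W k i j).
Proof. by move=> [H _ _] iB jB; have [q qP] := H k i j iB jB; apply: xgetPex; exists q. Qed.

Lemma weak_deriv_lin c f g p q : is_weak_deriv A sigma f p -> is_weak_deriv A sigma g q ->
  is_weak_deriv A sigma (fun z => c * f z + g z) (fun z => c * p z + q z).
Proof.
move=> [mp p2 pE] [mq q2 qE].
have sp : sq_integrable A b p by []. have sq : sq_integrable A b q by [].
have [m1 m2] := sqiD _ _ _ _ (sqiZ _ _ c _ sp) sq.
split => // z Iz; have := Iz; rewrite /= in_itv/= => /andP[Az zb].
rewrite (pE z Iz) (qE z Iz).
have ip : itg A z p by exact: itgS (sqi_itg _ _ _ sp).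
have iq : itg A z q by exact: itgS (sqi_itg _ _ _ sq).
by rewrite itgD_E ?itgZ_E//; [ring|exact: itgZ].
Qed.

Lemma weak_deriv_within f p : is_weak_deriv A sigma f p -> {within `[A, b], continuous f}.
Proof.
move=> [mp p2 pE]; have sp : sq_integrable A b p by [].
have : {within `[A, b], continuous (fun z => f A + \int[mu]_(t in `[A, z]) p t)}.
  move=> x; apply: (@continuousD R _ (subspace `[A, b])); first exact: cst_continuous.
  exact: (int_head_within A b p le_Ab (sqi_itg _ _ _ sp)).
apply: subspace_eq_continuous => z; rewrite inE => zab.
by [exact: pE|exact: (esym (pE z zab))].
Qed.

Lemma H10_within W k i j : H10 W -> (i <= B)%N -> (j <= B)%N ->
  {within `[A, b], continuous (W k i j)}.
Proof. by move=> HW iB jB; exact: weak_deriv_within (dzP W k i j HW iB jB). Qed.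

Lemma H10_L2class W : H10 W -> L2class W.
Proof.
by move=> HW e /nodes_leB[iB jB]; apply: sqi_within; exact: H10_within.
Qed.

Lemma H10_dz_L2class W : H10 W -> L2class (dz W).
Proof.
by move=> HW e /nodes_leB[iB jB]; have [] := dzP W e.1.1 e.1.2 e.2 HW iB jB.
Qed.

Lemma H10_lin c U V : H10 U -> H10 V -> H10 (c *: U + V).
Proof.
move=> HU HV; split.
- move=> k i j iB jB; exists (fun z => c * dz U k i j z + dz V k i j z).
  by apply: weak_deriv_lin; exact: dzP.
- move=> k i j z iB jB Iz ij; have [_ gU _] := HU; have [_ gV _] := HV.
  by rewrite -[LHS]/(c * U k i j z + V k i j z) gU// gV// mulr0 addr0.
move=> k i j iB jB; have [_ _ gU] := HU; have [_ _ gV] := HV.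
by rewrite -[LHS]/(c * U k i j A + V k i j A) gU// gV// mulr0 addr0.
Qed.

(** [dz] picks a version of the weak derivative separately for each function, so it is linear only
    up to null sets. The primitives of the two candidates agree, and [primitive_unique] transfers
    this to the pairing. *)
Lemma dz_lin_dot c U V W : H10 U -> H10 V -> L2class W ->
  L2_dot (dz (c *: U + V)) W = c * L2_dot (dz U) W + L2_dot (dz V) W.
Proof.
move=> HU HV LW; have HUV := H10_lin c U V HU HV.
have [[LU LV] LUV] := (H10_dz_L2class U HU, H10_dz_L2class V HV, H10_dz_L2class _ HUV).
rewrite -L2_dot_linl// !L2_dotE//; last exact: L2class_lin.
congr (_ * _); apply: eq_big_seq => e he.
have [iB jB] := nodes_leB _ _ _ he.
apply: (primitive_unique A b); [exact: le_Ab|exact: LUV| | |exact: LW].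
  exact: (L2class_lin c _ _ LU LV).
move=> z zab.
have Iz : `[A, b]%classic z by rewrite /= in_itv.
have [_ _ /(_ z Iz) E1] := dzP _ e.1.1 e.1.2 e.2 HUV iB jB.
have [_ _ /(_ z Iz) E2] := weak_deriv_lin c _ _ _ _
  (dzP _ e.1.1 e.1.2 e.2 HU iB jB) (dzP _ e.1.1 e.1.2 e.2 HV iB jB).
have E : (c *: U + V) e.1.1 e.1.2 e.2 z = c * U e.1.1 e.1.2 e.2 z + V e.1.1 e.1.2 e.2 z by [].
have E' : (c *: U + V) e.1.1 e.1.2 e.2 A = c * U e.1.1 e.1.2 e.2 A + V e.1.1 e.1.2 e.2 A by [].
by move: E1; rewrite E E' E2 => /addrI.
Qed.

Lemma H1_dotC U V : H1_dot U V = H1_dot V U.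
Proof. by rewrite /Defs.H1_dot !(L2_dotC _ V) !(L2_dotC _ (dz V)). Qed.

Lemma H1_dot_ge0 V : 0 <= H1_dot V V.
Proof. by rewrite addr_ge0// L2_dot_ge0. Qed.

Lemma H1_norm_sqr V : H1_norm V ^+ 2 = H1_dot V V.
Proof. by rewrite sqr_sqrtr// H1_dot_ge0. Qed.

Lemma H1_norm_ge0 V : 0 <= H1_norm V.
Proof. exact: sqrtr_ge0. Qed.

Lemma H1_dot_linl c U V W : H10 U -> H10 V -> H10 W ->
  H1_dot (c *: U + V) W = c * H1_dot U W + H1_dot V W.
Proof.
move=> HU HV HW; rewrite /Defs.H1_dot L2_dot_linl; try exact: H10_L2class.
rewrite (dz_lin_dot c U V (dz W) HU HV (H10_dz_L2class W HW)) mulrDr.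
by rewrite addrACA.
Qed.

Lemma H1_dot_linr c U V W : H10 U -> H10 V -> H10 W ->
  H1_dot W (c *: U + V) = c * H1_dot W U + H1_dot W V.
Proof. by move=> HU HV HW; rewrite H1_dotC (H1_dot_linl c U V W HU HV HW) !(H1_dotC W). Qed.

Lemma H10_0 : H10 (0 : sdfun R N).
Proof.
split => // k i j _ _; exists (cst 0).
have [m1 m2] := sqi_continuous A b _ (ct_cst (0 : R)).
split => // z; rewrite /= in_itv/= => /andP[Az _].
by rewrite Rint_cst// mul0r addr0.
Qed.

Lemma H10_D U V : H10 U -> H10 V -> H10 (U + V).
Proof. by move=> HU HV; have := H10_lin 1 U V HU HV; rewrite scale1r. Qed.

Lemma H10_Z c U : H10 U -> H10 (c *: U).
Proof. by move=> HU; rewrite -[_ *: _]addr0; exact: H10_lin HU H10_0. Qed.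

Lemma H10_B U V : H10 U -> H10 V -> H10 (U - V).
Proof. by move=> HU HV; have := H10_lin (-1) V U HV HU; rewrite scaleN1r addrC. Qed.

Lemma H1_dotDl U V W : H10 U -> H10 V -> H10 W ->
  H1_dot (U + V) W = H1_dot U W + H1_dot V W.
Proof. by move=> HU HV HW; have := H1_dot_linl 1 U V W HU HV HW; rewrite scale1r mul1r. Qed.

Lemma H1_dotBl U V W : H10 U -> H10 V -> H10 W ->
  H1_dot (U - V) W = H1_dot U W - H1_dot V W.
Proof. by move=> HU HV HW; rewrite addrC -scaleN1r (H1_dot_linl _ V U W HV HU HW) mulN1r addrC. Qed.

Lemma H1_dot0l W : H10 W -> H1_dot 0 W = 0.
Proof. by move=> HW; rewrite -(subrr W) H1_dotBl// subrr. Qed.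

Lemma H1_dotZl c U W : H10 U -> H10 W -> H1_dot (c *: U) W = c * H1_dot U W.
Proof.
move=> HU HW; rewrite -[_ *: _]addr0 (H1_dot_linl c U 0 W HU H10_0 HW).
by rewrite (H1_dot0l W HW) addr0.
Qed.

Lemma H1_CS U V : H10 U -> H10 V -> `|H1_dot U V| <= H1_norm U * H1_norm V.
Proof.
move=> HU HV; rewrite -ler_sqr ?nnegrE ?mulr_ge0 ?sqrtr_ge0//.
rewrite real_normK ?num_real// exprMn !H1_norm_sqr.
apply: discriminant_le; first exact: H1_dot_ge0.
move=> t; have := H1_dot_ge0 (t *: U + V).
have HUV := H10_lin t U V HU HV.
rewrite (H1_dot_linl t U V _ HU HV HUV) (H1_dot_linr t U V U HU HV HU).
rewrite (H1_dot_linr t U V V HU HV HV) (H1_dotC V U).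
by move: (H1_dot U U) (H1_dot U V) (H1_dot V V) => p q s; congr (0 <= _); ring.
Qed.

Lemma H1_normZ c U : H10 U -> H1_norm (c *: U) = `|c| * H1_norm U.
Proof.
move=> HU; rewrite /Defs.H1_norm H1_dotZl//; last exact: H10_Z.
by rewrite H1_dotC H1_dotZl// mulrA -expr2 sqrtrM ?sqr_ge0// sqrtr_sqr.
Qed.

Lemma H1_normD U V : H10 U -> H10 V -> H1_norm (U + V) <= H1_norm U + H1_norm V.
Proof.
move=> HU HV; rewrite -ler_sqr ?nnegrE ?addr_ge0 ?sqrtr_ge0//.
have HUV := H10_D U V HU HV.
rewrite H1_norm_sqr H1_dotDl// (H1_dotC U (U + V)) (H1_dotC V (U + V)) !H1_dotDl//.
have cs := le_trans (ler_norm _) (H1_CS U V HU HV).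
rewrite sqrrD !H1_norm_sqr (H1_dotC V U) mulr2n.
by move: (H1_dot U U) (H1_dot V V) (H1_dot U V) (H1_norm U * H1_norm V) cs => *; lra.
Qed.

Lemma H1_normB_sym U V : H10 U -> H10 V -> H1_norm (U - V) = H1_norm (V - U).
Proof.
move=> HU HV; rewrite -opprB -scaleN1r (H1_normZ _ _ (H10_B V U HV HU)).
by rewrite normrN1 mul1r.
Qed.

(** The Euclidean norm of all interior nodal values at height [z]. It dominates each nodal value,
    and the integral of its square is the squared L2 norm up to [h ^+ 2], which links pointwise
    bounds with norms. *)
Definition nu V (z : R) := Num.sqrt (\sum_(e <- nodes) at_node V e (clamp A b z) ^+ 2).

Lemma nu_sqr V z : nu V z ^+ 2 = \sum_(e <- nodes) at_node V e (clamp A b z) ^+ 2.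
Proof. by rewrite sqr_sqrtr// sumr_ge0// => e _; rewrite sqr_ge0. Qed.

Lemma nu_ge0 V z : 0 <= nu V z. Proof. exact: sqrtr_ge0. Qed.

Lemma nu_continuous V : H10 V -> continuous (nu V).
Proof.
move=> HV; apply: ct_sqrt.
pose g e : R -> R := if e \in nodes then at_node V e \o clamp A b else cst 0.
have -> : (fun z => \sum_(e <- nodes) at_node V e (clamp A b z) ^+ 2) =
   (fun z => \sum_(e <- nodes) g e z ^+ 2).
  by apply/funext => z; apply: eq_big_seq => e; rewrite /g => ->.
apply: ct_sum => e; apply: ctX; rewrite /g; case: ifP => [he|_]; last exact: ct_cst.
have [iB jB] := nodes_leB _ _ _ he.
by apply: clamp_comp_continuous; [exact: le_Ab|exact: H10_within].
Qed.

Lemma node_le_nu V k i j z : H10 V -> (i <= B)%N -> (j <= B)%N ->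
  `|V k i j (clamp A b z)| <= nu V z.
Proof.
move=> HV iB jB.
have [bd|] := boolP [|| i == 0%N, i == B, j == 0%N | j == B].
  have [_ -> //] := HV; first by rewrite normr0 nu_ge0.
  by rewrite /= in_itv/= clamp_itv// le_Ab.
rewrite !negb_or => /and4P[i0 iB' j0 jB'].
have he : (k, i, j) \in nodes.
  by apply: nodes_mem; rewrite lt0n ?i0 ?j0 ltn_neqAle ?iB' ?jB'.
rewrite -ler_sqr ?nnegrE ?nu_ge0// real_normK ?num_real// nu_sqr.
rewrite (big_rem (k, i, j))//= lerDl sumr_ge0// => e _; exact: sqr_ge0.
Qed.

Lemma int_nu V (w : R -> R) : H10 V -> continuous w ->
  \int[mu]_(z in `[A, b]) (w z * nu V z ^+ 2) =
  \sum_(e <- nodes) \int[mu]_(z in `[A, b]) (w z * at_node V e z ^+ 2).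
Proof.
move=> HV cw.
have iw e : e \in nodes -> itg A b (fun z => w z * at_node V e z ^+ 2).
  move=> he; apply: (eq_itg _ _ _ _ _ (itg_mulc _ _ _ _ (H10_L2class V HV e he).2 cw)).
  by move=> z _; rewrite mulrC.
have [_ <-] := Rint_sum_in _ nodes (fun e z => w z * at_node V e z ^+ 2) A b iw.
apply: eq_Rintegral => z; rewrite inE/= in_itv/= => zab.
by rewrite nu_sqr clamp_id// mulr_sumr.
Qed.

Lemma L2_dot_nu V : H10 V -> L2_dot V V = h ^+ 2 * \int[mu]_(z in `[A, b]) (nu V z ^+ 2).
Proof.
move=> HV; have LV := H10_L2class V HV; rewrite L2_dotE//; congr (_ * _).
transitivity (\sum_(e <- nodes) \int[mu]_(z in `[A, b]) (1 * at_node V e z ^+ 2)).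
  by apply: eq_bigr => e _; apply: eq_Rintegral => z _; rewrite mul1r expr2.
rewrite -(int_nu V (fun=> 1))//; last exact: ct_cst.
by apply: eq_Rintegral => z _; rewrite mul1r.
Qed.

Lemma H10_primitive V e z : H10 V -> e \in nodes -> A <= z <= b ->
  at_node V e z = \int[mu]_(t in `[A, z]) at_node (dz V) e t.
Proof.
move=> HV he zab; have [iB jB] := nodes_leB _ _ _ he.
have [_ _ E] := dzP V e.1.1 e.1.2 e.2 HV iB jB.
rewrite /at_node E/= ?in_itv//; have [_ _ ->//] := HV.
by rewrite add0r.
Qed.

(** An element of [H10] starts from 0 at [A], so it is the integral of its weak derivative and
    Cauchy-Schwarz costs a factor [sigma]. Dividing by [h ^+ 2] removes the weight of the grid
    sum. *)
Lemma nu_embedding V z : H10 V -> nu V z ^+ 2 <= sigma / h ^+ 2 * H1_dot V V.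
Proof.
move=> HV; have h2 : 0 < h ^+ 2 by rewrite exprn_gt0.
have LD := H10_dz_L2class V HV.
apply: (@le_trans _ _ (sigma / h ^+ 2 * L2_dot (dz V) (dz V))); last first.
  rewrite ler_wpM2l ?divr_ge0 ?(ltW s0) ?(ltW h2)//.
  by rewrite /Defs.H1_dot lerDr L2_dot_ge0.
rewrite L2_dotE// mulrA divfK ?gt_eqF// nu_sqr mulr_sumr.
rewrite big_seq [leRHS]big_seq; apply: ler_sum => e he.
have /andP[Az zb] := clamp_itv A b z le_Ab.
rewrite (H10_primitive V e (clamp A b z) HV he) ?Az//.
have sq := LD e he.
have sq' := sqiS _ _ _ _ _ (lexx A) zb sq.
apply: (le_trans (int_sqr_le _ _ _ Az sq')).
have H0 x y : 0 <= \int[mu]_(t in `[x, y]) at_node (dz V) e t ^+ 2.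
  by apply: Rintegral_ge0 => t _; rewrite sqr_ge0.
apply: ler_pM => //; [by rewrite subr_ge0|by lra|].
have -> : \int[mu]_(t in `[A, b]) (at_node (dz V) e t * at_node (dz V) e t) =
   \int[mu]_(t in `[A, b]) (at_node (dz V) e t ^+ 2) by [].
by rewrite [leRHS](itg_split _ _ _ _ Az zb) ?lerDl//; case: sq.
Qed.

(* The constant of the embedding of H1 into the continuous functions of [z]. *)
Definition embedding_const := Num.sqrt sigma / h.

Lemma emb_ge0 : 0 <= embedding_const. Proof. by rewrite divr_ge0 ?sqrtr_ge0 ?ltW. Qed.

Lemma nu_le_H1_norm V z : H10 V -> nu V z <= embedding_const * H1_norm V.
Proof.
move=> HV; have e0 : 0 <= embedding_const * H1_norm V by apply: mulr_ge0; [exact: emb_ge0|exact: H1_norm_ge0].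
rewrite -ler_sqr ?nnegrE ?nu_ge0//.
rewrite exprMn H1_norm_sqr /embedding_const expr_div_n (sqr_sqrtr (ltW s0)).
exact: nu_embedding.
Qed.

(** The scalar product decouples over the nodes, so [green] is applied at each interior node with
    density [m e], and the representer is set to 0 elsewhere. *)
Lemma riesz (m : 'I_N * nat * nat -> R -> R) : (forall e, continuous (m e)) ->
  exists2 D, H10 D & forall V, H10 V -> H1_dot D V =
    h ^+ 2 * \sum_(e <- nodes) \int[mu]_(z in `[A, b]) (m e z * at_node V e z).
Proof.
move=> cm.
have G e : exists fg : (R -> R) * (R -> R), [/\ fg.1 A = 0, is_weak_deriv A sigma fg.1 fg.2 &
   forall (v q : R -> R), is_weak_deriv A sigma v q -> v A = 0 ->
     \int[mu]_(z in `[A, b]) (fg.1 z * v z) + \int[mu]_(z in `[A, b]) (fg.2 z * q z) =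
     \int[mu]_(z in `[A, b]) (m e z * v z)].
  by have [f [g H]] := green A sigma s0 (m e) (cm e); exists (f, g).
pose F e := projT1 (cid (G e)).
have FP e := projT2 (cid (G e)).
pose D : sdfun R N := fun k i j z => if (k, i, j) \in nodes then (F (k, i, j)).1 z else 0.
have DE e : e \in nodes -> at_node D e = (F e).1.
  by case: e => [[k i] j] he; apply/funext => z; rewrite /at_node /D he.
have HD : H10 D.
  split.
  - move=> k i j iB jB; case he: ((k, i, j) \in nodes).
      exists (F (k, i, j)).2; have -> : D k i j = (F (k, i, j)).1 by exact: (DE _ he).
      by have [] := FP (k, i, j).
    have -> : D k i j = cst 0 by apply/funext => z; rewrite /D he.
    by have [H _ _] := H10_0; exact: (H k i j iB jB).
  - move=> k i j z iB jB Iz; apply: contraTeq; rewrite /D; case: ifP => [he _|]; last by rewrite eqxx.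
    have [/= /andP[i1 i2] /andP[j1 j2]] := mem_nodes _ _ _ he.
    by rewrite (gtn_eqF i1) (gtn_eqF j1) (ltn_eqF i2) (ltn_eqF j2).
  move=> k i j iB jB; rewrite /D; case: ifP => // he.
  by have [] := FP (k, i, j).
exists D => // V HV.
have [LD LdD] := (H10_L2class D HD, H10_dz_L2class D HD).
have [LV LdV] := (H10_L2class V HV, H10_dz_L2class V HV).
rewrite /Defs.H1_dot !L2_dotE// -mulrDr -big_split/=; congr (_ * _).
apply: eq_big_seq => e he; have [iB jB] := nodes_leB _ _ _ he.
have [F0 Fw FE] := FP e.
have [_ _ VA] := HV.
rewrite -(FE _ _ (dzP V e.1.1 e.1.2 e.2 HV iB jB) (VA _ _ _ iB jB)) (DE _ he); congr (_ + _).
have [mF F2 Fz] := Fw.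
(* [dz D] may be another version of the derivative than the one produced by [green]; they have the
   same primitive. *)
apply: (primitive_unique A b); [exact: le_Ab|exact: LdD| | |exact: LdV].
  by split.
move=> z zab; rewrite -(H10_primitive D e z HD he zab) (DE _ he) Fz/= ?in_itv//.
by rewrite F0 add0r.
Qed.

End HilbertSpace.

(** * From the derivative in [P] to the integrated form *)

Section FluxByParts.
Context {R : realType}.
Variables (a b : R) (ab : a <= b).
Implicit Types (p q v w : R -> R -> R) (f nu k dk : R -> R) (z x M m : R).
Local Notation mu := (@lebesgue_measure R).
Local Notation cl := (clamp a b).

Lemma is_derive_local (f g : R -> R) (c d x l : R) : c < x < d ->
  (forall y, c < y < d -> f y = g y) -> is_derive x 1 f l -> is_derive x 1 g l.
Proof.
move=> cxd fg df.
have N : \forall y \near x, f y = g y.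
  have xI : x \in `]c, d[ by rewrite in_itv.
  have := near_in_itvoo xI; apply: filterS => y; rewrite in_itv/=; exact: fg.
exact: (near_eq_is_derive N df).
Qed.

(** The chain rule makes [dflux_kernel] do double duty: besides the variation in [W] it gives the
    derivative in [alpha]. *)
Lemma is_derive_th (p q : R -> R) (x dp dq : R) : 0 < q x ->
  is_derive x 1 p dp -> is_derive x 1 q dq ->
  is_derive x 1 (fun x => flux_kernel (p x) (q x)) (dflux_kernel (p x) (q x) dp dq).
Proof.
move=> q0 d1 d2; have s0 : 0 < Num.sqrt (q x) by rewrite sqrtr_gt0.
have ds : is_derive x 1 (fun x => Num.sqrt (q x)) ((2 * Num.sqrt (q x))^-1 * dq).
  have dsq := is_derive1_sqrt q0.
  by have := @is_derive1_comp R Num.sqrt q x _ _ dsq d2; rewrite mulrC.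
have s20 : 2 * Num.sqrt (q x) != 0 by rewrite mulf_neq0// gt_eqF.
have d2s : is_derive x 1 (fun x => 2 * Num.sqrt (q x)) ((Num.sqrt (q x))^-1 * dq).
  apply: is_derive_eq; rewrite /GRing.scale/=; field.
  by rewrite gt_eqF.
have di := @is_deriveV R (fun x => 2 * Num.sqrt (q x)) x _ _ s20 d2s.
rewrite /flux_kernel; apply: is_derive_eq.
rewrite /dflux_kernel /GRing.scale/=; field; by rewrite gt_eqF.
Qed.

Lemma is_derive_phi M m f fx p q px qx z (x : R) : 0 < m -> admissible_pair M m p q ->
  joint_cont px -> joint_cont qx -> 0 < x < 1 -> is_derive x 1 f (fx x) ->
  (forall t (y : R), 0 < y < 1 -> is_derive y 1 (p t) (px t y)) ->
  (forall t (y : R), 0 < y < 1 -> is_derive y 1 (q t) (qx t y)) ->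
  is_derive x 1 (phi a b f p q z) (fx x + dphi a b p q px qx z x).
Proof.
move=> m0 A cpx cqx x01 df dp dq.
have [_ _ _ Q] := A.
have Q0 t y : 0 < q t y by rewrite (lt_le_trans _ (Q t y))// exprn_gt0.
pose g (y t : R) := flux_kernel (p t y) (q t y).
pose dg (y t : R) := dflux_kernel (p t y) (q t y) (px t y) (qx t y).
have cdg := jc_dth _ _ _ _ _ _ m0 A cpx cqx.
have dgP t (y : R) : 0 < y < 1 -> is_derive y 1 (g^~ t) (dg y t).
  by move=> y01; have [d1 d2] := (dp t y y01, dq t y y01); exact: is_derive_th.
have [K K0 HK] := jc_bound _ (cl z) b 0 1 cdg.
have mzb : measurable (`[cl z, b]%classic : set (measurableTypeR R)) by [].
have Ix : `]0, 1[%classic x by rewrite /= in_itv.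
have i1 y : `]0, 1[%classic y -> mu.-integrable `[cl z, b] (EFin \o g y).
  by move=> _; apply: continuous_itg; exact: (jc_slice1 _ y (jc_th _ _ _ _ m0 A)).
have i2 y t : `]0, 1[%classic y -> `[cl z, b]%classic t -> derivable (g^~ t) y 1.
  by rewrite /= in_itv/= => y01 _; have [] := dgP t y y01.
have i3 y t : `]0, 1[%classic y -> `[cl z, b]%classic t -> `|partial1of2 g y t| <= K.
  rewrite /= !in_itv/= => y01 tzb; rewrite partial1of2E.
  rewrite (@derive_val _ _ _ _ _ _ _ (dgP t y y01)); apply: HK => //.
  by move/andP: y01 => [? ?]; rewrite !ltW.
have K0' (t : R) : 0 <= cst K t by [].
have iK : mu.-integrable `[cl z, b] (EFin \o cst K) by apply: continuous_itg; exact: ct_cst.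
have D := derivable_under_integral mzb Ix i1 i2 K0' iK i3.
have E := differentiation_under_integral mzb Ix i1 i2 K0' iK i3.
have dI : is_derive x 1 (fun y => \int[mu]_(t in `[cl z, b]) g y t)
    (\int[mu]_(t in `[cl z, b]) dg x t).
  apply: derivable_is_derive; first exact: D.
  rewrite -[LHS]/(derive1 (fun y => \int[mu]_(t in `[cl z, b]) g y t) x) E.
  apply: eq_Rintegral => t _; rewrite partial1of2E.
  by rewrite (@derive_val _ _ _ _ _ _ _ (dgP t x x01)).
exact: (is_deriveB df dI).
Qed.

Lemma itg_measurable_set (D : set R) (f : R -> R) :
  mu.-integrable D (EFin \o f) -> measurable_fun D f.
Proof. by move=> /integrableP[/measurable_EFinP]. Qed.

Lemma within_deriv_local (f df : R -> R) : continuous f ->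
  (forall x : R, 0 < x < 1 -> is_derive x 1 f (df x)) ->
  derivable_oo_LRcontinuous f 0 1 /\ {in `]0, 1[, derive1 f =1 df}.
Proof.
move=> cf H; have [c1 c2 c3] := (continuous_within_itvP _ ltr01).1 (continuous_subspaceT cf).
split; first by split => // x; rewrite in_itv/= => /H[].
by move=> x; rewrite in_itv/= => /H d; rewrite derive1E; exact: derive_val.
Qed.

(** [g0] will be the unclamped flux of the definition, compared with [phi] on the open interval
    only. The two integrands agree there, and the endpoints, where the derivative of [g0 ^+ 2] is
    out of control, form a null set. Integration by parts does the rest. *)
Lemma dot01_derive_flux M m k dk f fx p q px qx z (g0 : R -> R) :
  0 < m -> admissible_pair M m p q -> joint_cont px -> joint_cont qx -> continuous f -> continuous fx ->
  continuous dk -> (forall x : R, is_derive x 1 k (dk x)) ->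
  (forall x : R, 0 < x < 1 -> is_derive x 1 f (fx x)) ->
  (forall t (x : R), 0 < x < 1 -> is_derive x 1 (p t) (px t x)) ->
  (forall t (x : R), 0 < x < 1 -> is_derive x 1 (q t) (qx t x)) ->
  (forall x, 0 < x < 1 -> g0 x = phi a b f p q z x) ->
  dot01 k (derive1 (fun x => g0 x ^+ 2)) = Pi a b k dk f p q z.
Proof.
move=> m0 A cpx cqx cf cfx cdk dk' df dp dq g0E.
have cphi := jc_slice2 _ z (jc_phi _ _ ab _ _ _ _ _ m0 A cf).
have cdphi := jc_slice2 _ z (jc_dphi _ _ ab _ _ _ _ _ _ m0 A cpx cqx).
pose ph := phi a b f p q z.
pose dph x := fx x + dphi a b p q px qx z x.
have dphP (x : R) : 0 < x < 1 -> is_derive x 1 ph (dph x).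
  by move=> x01; apply: (is_derive_phi M m) => //; exact: df.
have ck : continuous k by move=> x; exact: is_derive_continuous (dk' x).
have d2 (x : R) : 0 < x < 1 -> is_derive x 1 (fun x => ph x ^+ 2) (2 * ph x * dph x).
  by move=> /dphP d; apply: is_derive_eq; rewrite /GRing.scale/=; ring.
have cdph : continuous dph by exact: ctD.
have c2 : continuous (fun x => 2 * ph x * dph x) by apply: ctM => //; exact: ctZ.
have [Goo GE] := within_deriv_local _ _ (ctX _ 2 cphi) d2.
have [koo kE] := within_deriv_local _ _ ck (fun x _ => dk' x).
have := Rintegration_by_parts ltr01 (continuous_subspaceT cdk) koo kE
  (continuous_subspaceT c2) Goo GE.
rewrite /Pi /by_parts => <-.
pose r x := k x * (2 * ph x * dph x).
have cr : continuous r by exact: ctM.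
have iS (f1 : R -> R) : continuous f1 ->
   \int[mu]_(x in `[0, 1]) f1 x = \int[mu]_(x in [set` `]0, 1[%R]) f1 x.
  move=> c1; rewrite -Rintegral_itv_obnd_cbnd -?Rintegral_itv_bndo_bndc//.
    by apply: integrableS (continuous_itg f1 0 1 c1) => //; apply: subset_itv_oo_cc.
  by apply: integrableS (continuous_itg f1 0 1 c1) => //; apply: subset_itvr; rewrite bnd_simp.
pose l x := k x * derive1 (fun x => g0 x ^+ 2) x.
have lE x : 0 < x < 1 -> l x = r x.
  move=> x01; rewrite /l /r; congr (_ * _); rewrite derive1E.
  have d : is_derive x 1 (fun x => g0 x ^+ 2) (2 * ph x * dph x).
    by apply: (is_derive_local _ _ 0 1 _ _ x01 _ (d2 x x01)) => y y01; rewrite g0E.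
  exact: derive_val.
rewrite [RHS](iS r cr) /dot01 -/l.
have i01 : mu.-integrable [set` `]0, 1[%R] (EFin \o r).
  by apply: integrableS (continuous_itg r 0 1 cr) => //; apply: subset_itv_oo_cc.
have li : mu.-integrable [set` `]0, 1[%R] (EFin \o l).
  apply: eq_integrable i01 => // x; rewrite inE/= in_itv/= => /lE E.
  by rewrite /= E.
have ml := itg_measurable_set _ _ li.
(* Removing the endpoints one at a time calls for measurability on the half-open interval too. *)
have ml1 : measurable_fun (`]0, 1]%classic : set R) l.
  have lt01 : (BRight (0 : R) <= BLeft (1 : R))%O by rewrite bnd_simp.
  rewrite -(setUitv1 true lt01); apply/measurable_funU => //; split => //.
  exact: measurable_fun_set1.
rewrite /Rintegral -integral_itv_obnd_cbnd -?integral_itv_bndo_bndc; last 2 first.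
- exact/measurable_EFinP.
- exact/measurable_EFinP.
rewrite -/(Rintegral _ _ l).
by apply: eq_Rintegral => x; rewrite inE/= in_itv/=; exact: lE.
Qed.

End FluxByParts.

Section CNorm.
Context {R : realType}.
Variables (A sigma : R) (B N : nat).

(** The supremum is an upper bound once the set is known to be bounded: there are finitely many
    components and nodes, each function is bounded by continuity on a compact interval, and the sum
    of these bounds serves for all. *)
Lemma CN_norm_bound (Q : sdfun R N) k i j z : CN_space A sigma B Q ->
  (i <= B)%N -> (j <= B)%N -> A <= z <= A + sigma ->
  `|Q k i j z| <= CN_norm A sigma B Q.
Proof.
move=> CQ iB jB zI; apply: ub_le_sup; last first.
  by exists k, i, j, z; split => //; rewrite /= in_itv.
have Ab : A <= A + sigma by move/andP: zI => [/le_trans]; apply.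
have bd (p : 'I_N * 'I_B.+1 * 'I_B.+1) : exists K : R, 0 <= K /\
    forall y, A <= y <= A + sigma -> `|Q p.1.1 p.1.2 p.2 y| <= K.
  have cQ : {within `[A, A + sigma], continuous (Q p.1.1 p.1.2 p.2)}.
    by apply: CQ; rewrite -ltnS.
  have [K K0 HK] := bounded_itg A (A + sigma) _ (clamp_comp_continuous _ _ _ Ab cQ).
  exists K; split => // y yI; have := HK y yI.
  by rewrite /= clamp_id.
have [K KP] := choice bd.
exists (\sum_p K p) => y [k' [i' [j' [z' [iB' jB' Iz' ->]]]]].
have i1 : (i' < B.+1)%N by []. have j1 : (j' < B.+1)%N by [].
pose p := (k', Ordinal i1, Ordinal j1).
have := (KP p).2 z'; rewrite /= => H; apply: le_trans (H _) _.
  by move: Iz'; rewrite /= in_itv.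
rewrite (bigD1 p)//= lerDl sumr_ge0// => q _; by case: (KP q).
Qed.

End CNorm.

(** * Clamped values of [u] and their derivatives in [alpha] *)

Section Stencil.
Context {R : realType}.
Variables (A sigma h : R) (B N : nat) (a : R).
Hypotheses (hA : 0 < A) (s0 : 0 < sigma) (h0 : 0 < h) (h1 : h < 1).
Local Notation b := (A + sigma).
Local Notation cl := (clamp A b).
Local Notation c01 := (clamp (0 : R) 1).

Let Ab : A <= b. Proof. by rewrite lerDl ltW. Qed.

Definition dPsi (n : nat) : R -> R := s2val (cid2 (Psi_derive a n)).

Lemma dPsi_continuous n : continuous (dPsi n).
Proof. exact: s2valP (cid2 (Psi_derive a n)). Qed.

Lemma dPsiP n (x : R) : is_derive x 1 (Psi a n) (dPsi n x).
Proof. exact: (s2valP' (cid2 (Psi_derive a n))). Qed.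

Lemma Psi_bound : exists2 c : R, 0 <= c &
  forall (k : 'I_N) x, 0 <= x <= 1 -> `|Psi a k x| <= c.
Proof.
have bd (k : 'I_N) : exists K : R, 0 <= K /\ forall x, 0 <= x <= 1 -> `|Psi a k x| <= K.
  by have [K K0 HK] := bounded_itg 0 1 _ (Psi_continuous a k); exists K.
have [K KP] := choice bd.
exists (\sum_k K k); first by apply: sumr_ge0 => k _; case: (KP k).
move=> k x x01; apply: (le_trans ((KP k).2 x x01)).
by rewrite (bigD1 k)//= lerDl sumr_ge0// => q _; case: (KP q).
Qed.

Lemma c01_itv (x : R) : 0 <= c01 x <= 1. Proof. exact: clamp_itv. Qed.

(** Clamping both arguments gives functions continuous on the plane; on [[A, b]] times [[0, 1]],
    where all integrals are taken, nothing changes. *)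
Definition vc (V : sdfun R N) (i j : nat) (t x : R) :=
  expansion a (fun k => V k i j (cl t)) (c01 x).

Definition uc (G W : sdfun R N) (i j : nat) (t x : R) :=
  u A h a G W (cl t) (c01 x) i j.

Lemma ucE G W i j t x : uc G W i j t x =
  u0 A h i j (c01 x) + (vc W i j t x + vc G i j t x).
Proof. by []. Qed.

Lemma jc_vc (V : sdfun R N) i j : CN_space A sigma B V -> (i <= B)%N -> (j <= B)%N -> joint_cont (vc V i j).
Proof.
move=> CV iB jB; apply: (jc_sum _ _ (fun k t x => V k i j (cl t) * Psi a k (c01 x))) => k.
apply: jcM.
  by apply: (jc1 (V k i j \o cl)); apply: clamp_comp_continuous => //; exact: CV.
apply: (jc2 (fun x => Psi a k (c01 x))).
by apply: ct_comp; [exact: clamp_continuous|exact: Psi_continuous].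
Qed.

Lemma H10_CN (W : sdfun R N) : H10 A sigma B W -> CN_space A sigma B W.
Proof. by move=> HW k i j iB jB; exact: (H10_within A sigma B N s0 W k i j HW iB jB). Qed.

Lemma u0_den (i j : nat) (x : R) :
  A ^+ 2 <= (i%:R * h - x) ^+ 2 + (j%:R * h - 2^-1) ^+ 2 + A ^+ 2.
Proof. by rewrite lerDr addr_ge0 ?sqr_ge0. Qed.

Lemma u0_bound i j (x : R) : `|u0 A h i j x| <= 1.
Proof.
have A2 : 0 < A ^+ 2 by rewrite exprn_gt0.
have d0 := lt_le_trans A2 (u0_den i j x).
rewrite /u0 ger0_norm ?divr_ge0 ?(ltW A2) ?(ltW d0)//.
by rewrite ler_pdivrMr// mul1r u0_den.
Qed.

Lemma is_derive_u0 i j : exists2 f : R -> R, continuous f &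
  forall x : R, is_derive x 1 (u0 A h i j) (f x).
Proof.
have A2 : 0 < A ^+ 2 by rewrite exprn_gt0.
pose q (x : R) := (i%:R * h - x) ^+ 2 + (j%:R * h - 2^-1) ^+ 2 + A ^+ 2.
have q0 (x : R) : q x != 0 by rewrite gt_eqF// (lt_le_trans A2 (u0_den i j x)).
have dq (x : R) : is_derive x 1 q (- (2 * (i%:R * h - x))).
  by apply: is_derive_eq; rewrite /GRing.scale/=; ring.
have cq : continuous q by move=> x; exact: is_derive_continuous (dq x).
exists (fun x => A ^+ 2 * (2 * (i%:R * h - x)) / q x ^+ 2).
  apply: ctM.
    by apply: ctZ; apply: ctZ; apply: ctB; [exact: ct_cst|move=> x; exact: cvg_id].
  by apply: ctV; [exact: ctX|move=> x; rewrite expf_neq0].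
move=> x; have dv := @is_deriveV R q x _ _ (q0 x) (dq x).
have : is_derive x 1 (fun x => A ^+ 2 * (q x)^-1) (A ^+ 2 * (2 * (i%:R * h - x)) / q x ^+ 2).
  by apply: is_derive_eq; rewrite /GRing.scale/=; field; exact: q0.
exact.
Qed.

Lemma jc_uc (G W : sdfun R N) i j : CN_space A sigma B G -> CN_space A sigma B W ->
  (i <= B)%N -> (j <= B)%N -> joint_cont (uc G W i j).
Proof.
move=> CG CW iB jB; apply: jcD; last by apply: jcD; exact: jc_vc.
apply: (jc2 (fun x => u0 A h i j (c01 x))); apply: ct_comp; first exact: clamp_continuous.
have [f _ H] := is_derive_u0 i j => x; exact: is_derive_continuous (H x).
Qed.

Lemma is_derive_expansion (c : 'I_N -> R) (x : R) :
  is_derive x 1 (expansion a c) (\sum_(k < N) c k * dPsi k x).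
Proof.
rewrite /expansion; elim: (index_enum _) => [|k s IH].
  under eq_fun do rewrite big_nil; rewrite big_nil; exact: is_derive_cst.
under eq_fun do rewrite big_cons; rewrite big_cons.
have d := dPsiP k x.
have : is_derive x 1 (fun x => c k * Psi a k x + \sum_(k <- s) c k * Psi a k x)
  (c k * dPsi k x + \sum_(k <- s) c k * dPsi k x).
  by apply: is_derive_eq; rewrite /GRing.scale/=; ring.
exact.
Qed.

(** The clamp is the identity near an interior point, which is why the derivative is claimed for
    [0 < x < 1] only. *)
Lemma uc_derive (G W : sdfun R N) i j : CN_space A sigma B G -> CN_space A sigma B W ->
  (i <= B)%N -> (j <= B)%N -> exists2 ux : R -> R -> R, joint_cont ux &
  forall t (x : R), 0 < x < 1 -> is_derive x 1 (uc G W i j t) (ux t x).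
Proof.
move=> CG CW iB jB; have [f cf Hf] := is_derive_u0 i j.
pose dv (V : sdfun R N) t x := \sum_(k < N) V k i j (cl t) * dPsi k x.
have jdv V : CN_space A sigma B V -> joint_cont (dv V).
  move=> CV; apply: jc_sum => k; apply: jcM; last exact: jc2 (dPsi_continuous k).
  by apply: (jc1 (V k i j \o cl)); apply: clamp_comp_continuous => //; exact: CV.
exists (fun t x => f x + (dv W t x + dv G t x)).
  by apply: jcD; [exact: jc2|apply: jcD; exact: jdv].
move=> t x x01.
apply: (is_derive_local (fun x => u A h a G W (cl t) x i j) _ 0 1 _ _ x01).
  by move=> y /andP[y0 y1]; rewrite /uc (clamp_id 0 1 y)// !ltW.
have [[d1 d2] d3] := (Hf x, is_derive_expansion (fun k => W k i j (cl t)) x,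
  is_derive_expansion (fun k => G k i j (cl t)) x).
exact: (is_deriveD d1 (is_deriveD d2 d3)).
Qed.

End Stencil.

Lemma sum_sqr_le (R : realType) (T : Type) (s : seq T) (c x : T -> R) X :
  0 <= X -> (forall i, x i ^+ 2 <= X) ->
  (\sum_(i <- s) c i * x i) ^+ 2 <= (\sum_(i <- s) `|c i|) ^+ 2 * X.
Proof.
move=> X0 H.
have xs i : `|x i| <= Num.sqrt X by rewrite -sqrtr_sqr ler_sqrt.
rewrite -[X in leRHS]sqr_sqrtr// -exprMn; apply: sqr_le_norm.
rewrite (le_trans (ler_norm_sum _ _ _))// mulr_suml; apply: ler_sum => i _.
by rewrite normrM ler_wpM2l.
Qed.

Lemma sum_abs_le (R : realType) (T : Type) (s : seq T) (c x : T -> R) X :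
  (forall i, `|x i| <= X) -> `|\sum_(i <- s) c i * x i| <= (\sum_(i <- s) `|c i|) * X.
Proof.
move=> H; rewrite (le_trans (ler_norm_sum _ _ _))// mulr_suml; apply: ler_sum => i _.
by rewrite normrM ler_wpM2l.
Qed.

(** * Uniform estimates at one node and its neighbours *)

Section StencilEstimates.
Context {R : realType}.
Variables (A sigma h : R) (B N : nat) (a : R).
Hypotheses (hA : 0 < A) (s0 : 0 < sigma) (h0 : 0 < h) (h1 : h < 1).
Local Notation b := (A + sigma).
Local Notation cl := (clamp A b).
Local Notation c01 := (clamp (0 : R) 1).
Local Notation nodes := (nodes N B).
Local Notation nu := (nu A sigma B N).
Local Notation H10 := (H10 A sigma B).
Local Notation CN_space := (CN_space A sigma B).
Local Notation CN_norm := (CN_norm A sigma B).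
Local Notation vc := (vc A sigma N a).
Local Notation uc := (uc A sigma h N a).
Implicit Types (G W V : sdfun R N) (F : 'I_N -> nat -> nat -> R) (e : 'I_N * nat * nat).

Let Ab : A <= b. Proof. by rewrite lerDl ltW. Qed.

(* [d] selects the difference operator: [diff_x] if true, [diff_y] if false. *)
Definition next_node (d : bool) e : nat * nat := if d then (e.1.2.+1, e.2) else (e.1.2, e.2.+1).
Definition prev_node (d : bool) e : nat * nat := if d then (e.1.2.-1, e.2) else (e.1.2, e.2.-1).

Lemma sh1_le d e : e \in nodes -> ((next_node d e).1 <= B)%N /\ ((next_node d e).2 <= B)%N.
Proof.
move=> /mem_nodes[/andP[_ i2] /andP[_ j2]].
by case: d; rewrite /= ?i2 ?j2 ?(ltnW i2) ?(ltnW j2).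
Qed.

Lemma sh2_le d e : e \in nodes -> ((prev_node d e).1 <= B)%N /\ ((prev_node d e).2 <= B)%N.
Proof.
move=> /mem_nodes[/andP[_ i2] /andP[_ j2]].
by case: d; rewrite /= ?(ltnW i2) ?(ltnW j2) ?(leq_trans (leq_pred _) (ltnW i2))
  ?(leq_trans (leq_pred _) (ltnW j2)).
Qed.

Definition u_node G W e := uc G W e.1.2 e.2.

Definition u_diff G W (d : bool) e (t x : R) :=
  (uc G W (next_node d e).1 (next_node d e).2 t x - uc G W (prev_node d e).1 (prev_node d e).2 t x) / (2 * h).

Definition v_node V e := vc V e.1.2 e.2.

Definition v_diff V (d : bool) e (t x : R) :=
  (vc V (next_node d e).1 (next_node d e).2 t x - vc V (prev_node d e).1 (prev_node d e).2 t x) / (2 * h).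

Definition f_diff F (d : bool) e (x : R) :=
  (fser a F (c01 x) (next_node d e).1 (next_node d e).2 - fser a F (c01 x) (prev_node d e).1 (prev_node d e).2) / (2 * h).

(* The region where all estimates are uniform; it contains a neighbourhood of the
   sets of the theorem. *)
Definition good (w m : R) G W := [/\ H10 W,
  forall k i j t, (i <= B)%N -> (j <= B)%N -> `|W k i j (cl t)| <= w &
  forall i j t x, (i <= B)%N -> (j <= B)%N -> m ^+ 2 <= uc G W i j t x].

Lemma expansion_bound (c : 'I_N -> R) (K w x : R) : (forall k : 'I_N, `|Psi a k x| <= K) ->
  (forall k, `|c k| <= w) -> `|expansion a c x| <= N%:R * (w * K).
Proof.
move=> HK Hw; rewrite (le_trans (ler_norm_sum _ _ _))//.
apply: (@le_trans _ _ (\sum_(k < N) w * K)).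
  by apply: ler_sum => k _; exact: le_normM.
by rewrite sumr_const card_ord mulr_natl.
Qed.

Definition nbound : R := s2val (cid2 (Psi_bound N a)).

Lemma nbound_ge0 : 0 <= nbound.
Proof. exact: s2valP (cid2 (Psi_bound N a)). Qed.

Lemma nboundP (k : 'I_N) x : 0 <= x <= 1 -> `|Psi a k x| <= nbound.
Proof. exact: (s2valP' (cid2 (Psi_bound N a))). Qed.

(** One factor for both uses: a difference quotient of two values, each bounded by
    [N%:R * nbound * nu], costs [2 / (2 * h)], and a single value is covered because [h < 1]. *)
Definition kappa : R := N%:R * nbound / h.

Lemma kappa_ge0 : 0 <= kappa.
Proof. by rewrite /kappa divr_ge0 ?(ltW h0)// mulr_ge0 ?nbound_ge0. Qed.

Lemma vc_bound V i j t x : H10 V -> (i <= B)%N -> (j <= B)%N ->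
  `|vc V i j t x| <= N%:R * nbound * nu V t.
Proof.
move=> HV iB jB; rewrite -mulrA (mulrC nbound); apply: expansion_bound.
  by move=> k; apply: nboundP; exact: c01_itv.
by move=> k; apply: node_le_nu.
Qed.

Lemma lq_bound V e t x : H10 V -> e \in nodes -> `|v_node V e t x| <= kappa * nu V t.
Proof.
move=> HV he; have [iB jB] := nodes_leB _ _ _ he.
apply: (le_trans (vc_bound V _ _ t x HV iB jB)).
rewrite ler_wpM2r ?nu_ge0// /kappa ler_pdivlMr// ler_piMr ?(ltW h1)//.
by rewrite mulr_ge0 ?nbound_ge0.
Qed.

Lemma lp_bound V d e t x : H10 V -> e \in nodes -> `|v_diff V d e t x| <= kappa * nu V t.
Proof.
move=> HV he; have [i1 j1] := sh1_le d e he; have [i2 j2] := sh2_le d e he.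
have v1 := vc_bound V _ _ t x HV i1 j1.
have v2 := vc_bound V _ _ t x HV i2 j2.
rewrite /v_diff normrM (ger0_norm (_ : 0 <= (2 * h)^-1)); last by rewrite invr_ge0 mulr_ge0// ltW.
rewrite ler_pdivrMr ?mulr_gt0//.
have -> : kappa * nu V t * (2 * h) = N%:R * nbound * nu V t + N%:R * nbound * nu V t.
  by rewrite /kappa; field; rewrite gt_eqF.
by apply: le_normD; rewrite ?normrN.
Qed.

Lemma uc_diff G W1 W2 i j t x :
  uc G W2 i j t x - uc G W1 i j t x = vc (W2 - W1) i j t x.
Proof.
rewrite !ucE opprD addrACA subrr add0r opprD addrACA subrr addr0.
rewrite /Submission.vc /expansion -sumrB; apply: eq_bigr => k _.
by rewrite -mulrBl.
Qed.

Lemma qq_diff G W1 W2 e t x : u_node G W2 e t x - u_node G W1 e t x = v_node (W2 - W1) e t x.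
Proof. exact: uc_diff. Qed.

Lemma pp_diff G W1 W2 d e t x : u_diff G W2 d e t x - u_diff G W1 d e t x = v_diff (W2 - W1) d e t x.
Proof. by rewrite /v_diff -!(uc_diff G) /u_diff; ring. Qed.

Lemma jc_lq V e : H10 V -> e \in nodes -> joint_cont (v_node V e).
Proof. by move=> HV he; have [iB jB] := nodes_leB _ _ _ he; exact: (jc_vc A sigma B N a s0 V _ _ (H10_CN A sigma B N s0 V HV) iB jB). Qed.

Lemma jc_lp V d e : H10 V -> e \in nodes -> joint_cont (v_diff V d e).
Proof.
move=> HV he; have [i1 j1] := sh1_le d e he; have [i2 j2] := sh2_le d e he.
have CV := H10_CN _ _ _ _ s0 V HV.
apply: jcM; last exact: jc_cst.
apply: jcB; first exact: (jc_vc A sigma B N a s0 V _ _ CV i1 j1).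
exact: (jc_vc A sigma B N a s0 V _ _ CV i2 j2).
Qed.

Lemma ff_continuous F d e : continuous (f_diff F d e).
Proof.
have cE i j : continuous (fun x => fser a F (c01 x) i j).
  apply: ct_sum => k; apply: ctZ; apply: ct_comp; first exact: clamp_continuous.
  exact: Psi_continuous.
by apply: ctM; [exact: ctB|exact: ct_cst].
Qed.

(** [M] must be fixed before [G], [F] and [W], so among the data it sees only [w] and the two norms.
    In [U], the 1 bounds [u0] and the other terms the series of [W] and of [G]; [Q] does the same
    for [F]. *)
Lemma admissible_bound (w nG nF : R) : 0 <= w -> 0 <= nG -> 0 <= nF ->
  exists2 M : R, 0 <= M & forall m G F W d e, CN_space G -> CN_norm G = nG ->
    CN_norm (const_z F) = nF -> good w m G W -> e \in nodes ->
    admissible_pair M m (u_diff G W d e) (u_node G W e) /\ forall x, `|f_diff F d e x| <= M.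
Proof.
move=> w0 nG0 nF0.
pose U := 1 + (N%:R * (w * nbound) + N%:R * (nG * nbound)).
pose Q := N%:R * (nF * nbound).
have b0 := nbound_ge0.
have U0 : 0 <= U by rewrite /U !addr_ge0// !mulr_ge0.
have Q0 : 0 <= Q by rewrite /Q !mulr_ge0.
have i0 : 0 <= (2 * h)^-1 by rewrite invr_ge0 mulr_ge0// ltW.
exists ((U + U) * (2 * h)^-1 + (Q + Q) * (2 * h)^-1).
  by rewrite addr_ge0// mulr_ge0// addr_ge0.
move=> m G F W d e CG EG EF [HW Hw HQ] he.
have [iB jB] := nodes_leB _ _ _ he.
have [i1 j1] := sh1_le d e he; have [i2 j2] := sh2_le d e he.
have CW := H10_CN _ _ _ _ s0 W HW.
have hi : `|(2 * h)^-1| <= (2 * h)^-1 by rewrite ger0_norm.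
have ub i j t x : (i <= B)%N -> (j <= B)%N -> `|uc G W i j t x| <= U.
  move=> iB' jB'; rewrite ucE; apply: le_normD; first exact: u0_bound.
  apply: le_normD; apply: expansion_bound.
  - by move=> k; apply: nboundP; exact: c01_itv.
  - by move=> k; exact: Hw.
  - by move=> k; apply: nboundP; exact: c01_itv.
  by move=> k; rewrite -EG; apply: CN_norm_bound => //; exact: clamp_itv.
have fb i j x : (i <= B)%N -> (j <= B)%N -> `|fser a F (c01 x) i j| <= Q.
  move=> iB' jB'; apply: expansion_bound.
    by move=> k; apply: nboundP; exact: c01_itv.
  move=> k; rewrite -EF -/(const_z F k i j A); apply: CN_norm_bound => //.
    move=> k' i' j' _ _; apply: continuous_subspaceT; exact: ct_cst.
  by rewrite lexx.
have UU : 0 <= (U + U) * (2 * h)^-1 by rewrite mulr_ge0// addr_ge0.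
have QQ : 0 <= (Q + Q) * (2 * h)^-1 by rewrite mulr_ge0// addr_ge0.
split; first split.
- apply: jcM; last exact: jc_cst.
  apply: jcB; first exact: (jc_uc A sigma h B N a hA s0 G W _ _ CG CW i1 j1).
  exact: (jc_uc A sigma h B N a hA s0 G W _ _ CG CW i2 j2).
- exact: (jc_uc A sigma h B N a hA s0 G W _ _ CG CW iB jB).
- move=> t x; apply: (@le_trans _ _ ((U + U) * (2 * h)^-1)); last by rewrite lerDl.
  by apply: le_normM => //; apply: le_normD; rewrite ?normrN; exact: ub.
- by move=> t x; exact: HQ.
move=> x; apply: (@le_trans _ _ ((Q + Q) * (2 * h)^-1)); last by rewrite lerDr.
by apply: le_normM => //; apply: le_normD; rewrite ?normrN; exact: fb.
Qed.

Definition flux_node F G W (n : 'I_N) (d : bool) e z :=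
  Pi A b (Psi a n) (dPsi a n) (f_diff F d e) (u_diff G W d e) (u_node G W e) z.

Definition dflux_node F G W V (n : 'I_N) (d : bool) e z :=
  DPi A b (Psi a n) (dPsi a n) (f_diff F d e) (u_diff G W d e) (u_node G W e) (v_diff V d e) (v_node V e) z.

(** The abstract flux is matched with the definition of [P]: the clamps disappear for [z] in
    [[A, b]] and [alpha] strictly between 0 and 1, and [dot01_derive_flux] removes the
    derivative. *)
Lemma P_PiN w m F G W n e z : 0 <= w -> 0 < m -> CN_space G -> good w m G W ->
  e \in nodes -> A <= z <= b ->
  P A sigma h a G F W n e.1.2 e.2 z = flux_node F G W n true e z + flux_node F G W n false e z.
Proof.
move=> w0 m0 CG gW he zab.
have [HW Hw HQ] := gW.
have CF : CN_space (const_z F).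
  by move=> k' i' j' _ _; apply: continuous_subspaceT; exact: ct_cst.
have nn (Q : sdfun R N) : CN_space Q -> 0 <= CN_norm Q.
  move=> CQ; apply: le_trans (normr_ge0 (Q n 0%N 0%N A)) _.
  by apply: CN_norm_bound => //; rewrite lexx Ab.
have [M M0 HM] := admissible_bound _ _ _ w0 (nn _ CG) (nn _ CF).
have [iB jB] := nodes_leB _ _ _ he.
have CW := H10_CN _ _ _ _ s0 W HW.
(* [D] is either difference operator; only its values at the node [e] are used, so one argument
   covers both directions. *)
suff H d D : (forall v, D v e.1.2 e.2 = (v (next_node d e).1 (next_node d e).2 - v (prev_node d e).1 (prev_node d e).2) / (2 * h)) ->
    dot01 (Psi a n) (derive1 (fun x => flux A sigma h a G F D W e.1.2 e.2 z x ^+ 2)) =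
    flux_node F G W n d e z.
  by rewrite /P (H true)// (H false).
move=> DE.
have [Ad _] := HM m G F W d e CG erefl erefl gW he.
have [i1 j1] := sh1_le d e he; have [i2 j2] := sh2_le d e he.
have [qx cqx dqx] := uc_derive A sigma h B N a hA s0 G W _ _ CG CW iB jB.
have [x1 cx1 dx1] := uc_derive A sigma h B N a hA s0 G W _ _ CG CW i1 j1.
have [x2 cx2 dx2] := uc_derive A sigma h B N a hA s0 G W _ _ CG CW i2 j2.
pose px t x := (x1 t x - x2 t x) / (2 * h).
have cpx : joint_cont px by apply: jcM; [exact: jcB|exact: jc_cst].
have dpx t (x : R) : 0 < x < 1 -> is_derive x 1 (u_diff G W d e t) (px t x).
  move=> x01; have [d1 d2] := (dx1 t x x01, dx2 t x x01).
  by apply: is_derive_eq; rewrite /px /GRing.scale/=; ring.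
pose fs (c : nat * nat) (x : R) := \sum_(k < N) F k c.1 c.2 * dPsi a k x.
have cfs c : continuous (fs c).
  by apply: ct_sum => k; apply: ctZ; exact: dPsi_continuous.
pose fx x := (fs (next_node d e) x - fs (prev_node d e) x) / (2 * h).
have dfs c (x : R) : 0 < x < 1 -> is_derive x 1 (fun x => fser a F (c01 x) c.1 c.2) (fs c x).
  move=> x01; apply: (is_derive_local (fun x => fser a F x c.1 c.2) _ 0 1 _ _ x01).
    by move=> y /andP[y0 y1]; rewrite (clamp_id 0 1 y)// !ltW.
  exact: is_derive_expansion.
apply: (dot01_derive_flux A b Ab M m _ _ _ fx _ _ px qx) => //.
- exact: ff_continuous.
- by apply: ctM; [exact: ctB|exact: ct_cst].
- exact: dPsi_continuous.
- exact: dPsiP.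
- move=> x x01; have [d1 d2] := (dfs (next_node d e) x x01, dfs (prev_node d e) x x01).
  by apply: is_derive_eq; rewrite /fx /GRing.scale/=; ring.
move=> x /andP[x0 x1']; have xc : c01 x = x by rewrite clamp_id// !ltW.
rewrite /flux /phi DE addrC /f_diff xc clamp_id//; congr (_ - _).
apply: eq_Rintegral => t; rewrite inE/= in_itv/= => /andP[zt tb].
have tc : cl t = t by rewrite clamp_id// tb andbT (le_trans _ zt)//; case/andP: zab.
by rewrite DE /flux_kernel /u_diff /u_node /Submission.uc tc xc.
Qed.

(** [Pi_estimates] with majorant [kappa * nu V]. Quadratic quantities acquire [kappa ^+ 2], the
    variation of the differential [kappa ^+ 4]; summing the constants over [n] gives one that serves
    all components. *)
Lemma DPiN_estimates (w m nG nF : R) : 0 <= w -> 0 < m -> 0 <= nG -> 0 <= nF ->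
  exists2 C : R, 0 <= C & forall G F W1 W2 n d e z, CN_space G -> CN_norm G = nG ->
    CN_norm (const_z F) = nF -> good w m G W1 -> good w m G W2 -> e \in nodes ->
    let r V := tail A b (fun t => nu V t ^+ 2) z in
  [/\ `|flux_node F G W1 n d e z| <= C,
      forall V, H10 V -> dflux_node F G W1 V n d e z ^+ 2 <= C * r V,
      (flux_node F G W2 n d e z - flux_node F G W1 n d e z) ^+ 2 <= C * r (W2 - W1),
      `|flux_node F G W2 n d e z - flux_node F G W1 n d e z - dflux_node F G W1 (W2 - W1) n d e z|
        <= C * r (W2 - W1) &
      forall V D, H10 V -> (forall t, nu (W2 - W1) t <= D) ->
        (dflux_node F G W2 V n d e z - dflux_node F G W1 V n d e z) ^+ 2 <= C * (D ^+ 2 * r V)].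
Proof.
move=> w0 m0 nG0 nF0; have [M M0 HM] := admissible_bound _ _ _ w0 nG0 nF0.
have est (n : 'I_N) := Pi_estimates A b Ab (Psi a n) (dPsi a n) M m (dPsi_continuous a n) M0 m0.
pose C n := s2val (cid2 (est n)).
have C0 n : 0 <= C n by exact: (s2valP (cid2 (est n))).
have HC n := s2valP' (cid2 (est n)).
pose CT := \sum_n C n.
have CT0 : 0 <= CT by rewrite sumr_ge0.
have CC n : C n <= CT by rewrite /CT (bigD1 n)//= lerDl sumr_ge0.
have k0 := kappa_ge0.
have k20 : 0 <= kappa ^+ 2 by rewrite sqr_ge0.
pose K := CT * (1 + kappa ^+ 2 + kappa ^+ 4).
have k40 : 0 <= kappa ^+ 4 by rewrite exprn_ge0.
have S1 : 1 <= 1 + kappa ^+ 2 + kappa ^+ 4 by rewrite -addrA lerDl addr_ge0.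
have S2 : kappa ^+ 2 <= 1 + kappa ^+ 2 + kappa ^+ 4.
  by rewrite (addrC 1) -addrA lerDl addr_ge0.
have S4 : kappa ^+ 4 <= 1 + kappa ^+ 2 + kappa ^+ 4 by rewrite lerDr addr_ge0.
have S0 : 0 <= 1 + kappa ^+ 2 + kappa ^+ 4 by exact: le_trans S1.
exists K; first by rewrite mulr_ge0.
move=> G F W1 W2 n d e z CG EG EF g1 g2 he r.
have [A1 fM] := HM m G F W1 d e CG EG EF g1 he.
have [A2 _] := HM m G F W2 d e CG EG EF g2 he.
have [E1 E2 E3 E4 E5] := HC n _ _ _ _ _ (ff_continuous F d e) fM A1 A2.
have H12 : H10 (W2 - W1) by apply: H10_B => //; [case: g2|case: g1].
have r0 V : 0 <= r V by apply: tail_ge0 => // t; rewrite sqr_ge0.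
have cnu V : H10 V -> continuous (fun t => kappa * nu V t).
  by move=> HV; apply: ctZ; exact: nu_continuous.
have tk V : H10 V -> tail A b (fun t => (kappa * nu V t) ^+ 2) z = kappa ^+ 2 * r V.
  move=> HV; rewrite /r /tail -itgZ_E; last first.
    by apply: continuous_itg; apply: ctX; exact: nu_continuous.
  by apply: eq_Rintegral => t _; rewrite exprMn.
have up X V : X <= C n * (kappa ^+ 2 * r V) -> X <= K * r V.
  move=> /le_trans; apply; rewrite mulrA ler_wpM2r//.
  by apply: ler_pM.
have dp t x : `|u_diff G W2 d e t x - u_diff G W1 d e t x| <= kappa * nu (W2 - W1) t.
  by rewrite pp_diff; exact: lp_bound.
have dq t x : `|u_node G W2 e t x - u_node G W1 e t x| <= kappa * nu (W2 - W1) t.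
  by rewrite qq_diff; exact: lq_bound.
split.
- apply: (le_trans (E1 z)); apply: (le_trans (CC n)).
  by rewrite ler_peMr.
- move=> V HV; apply: up; rewrite -tk//; apply: E2.
  + exact: jc_lp.
  + exact: jc_lq.
  + exact: cnu.
  + by move=> t x; exact: lp_bound.
  by move=> t x; exact: lq_bound.
- by apply: up; rewrite -tk//; apply: E3 => //; exact: cnu.
- apply: up; rewrite -tk//.
  have Ep : (fun t x => u_diff G W2 d e t x - u_diff G W1 d e t x) = v_diff (W2 - W1) d e.
    by apply/funext => t; apply/funext => x; exact: pp_diff.
  have Eq : (fun t x => u_node G W2 e t x - u_node G W1 e t x) = v_node (W2 - W1) e.
    by apply/funext => t; apply/funext => x; exact: qq_diff.
  have := E4 (fun t => kappa * nu (W2 - W1) t) z (cnu _ H12) dp dq.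
  by rewrite Ep Eq.
move=> V D HV HD.
have D0 : 0 <= D by exact: le_trans (nu_ge0 _ _ _ _ _ 0) (HD 0).
have := E5 (v_diff V d e) (v_node V e) (fun t => kappa * nu V t) (kappa * D) z
  (jc_lp V d e HV he) (jc_lq V e HV he) (cnu V HV).
rewrite tk// => E6; apply: (le_trans (E6 _ _ _ _)).
- by move=> t x; apply: (le_trans (dp t x)); rewrite ler_wpM2l.
- by move=> t x; apply: (le_trans (dq t x)); rewrite ler_wpM2l.
- by move=> t x; exact: lp_bound.
- by move=> t x; exact: lq_bound.
have -> : (kappa * D) ^+ 2 * (kappa ^+ 2 * r V) = kappa ^+ 4 * (D ^+ 2 * r V) by ring.
rewrite mulrA ler_wpM2r ?mulr_ge0 ?sqr_ge0//.
exact: (ler_pM (C0 n) k40 (CC n) S4).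
Qed.

End StencilEstimates.

Lemma nodes_uniq N B : uniq (nodes N B).
Proof.
apply: allpairs_uniq; [|exact: iota_uniq|by move=> [? ?] [? ?]].
by apply: allpairs_uniq; [exact: index_enum_uniq|exact: iota_uniq|move=> [? ?] [? ?]].
Qed.

(** * The operator [M_N^{-1} P] and the densities of its differential *)

Section Operator.
Context {R : realType}.
Variables (A sigma h : R) (B N : nat) (a : R).
Hypotheses (hA : 0 < A) (s0 : 0 < sigma) (h0 : 0 < h) (h1 : h < 1).
Local Notation mu := (@lebesgue_measure R).
Local Notation b := (A + sigma).
Local Notation cl := (clamp A b).
Local Notation c01 := (clamp (0 : R) 1).
Local Notation nodes := (nodes N B).
Local Notation nu := (nu A sigma B N).
Local Notation H10 := (H10 A sigma B).
Local Notation CN_space := (CN_space A sigma B).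
Local Notation CN_norm := (CN_norm A sigma B).
Local Notation good := (good A sigma h B N a).
Local Notation flux_node := (flux_node A sigma h N a).
Local Notation dflux_node := (dflux_node A sigma h N a).
Implicit Types (G W V : sdfun R N) (F : 'I_N -> nat -> nat -> R) (e : 'I_N * nat * nat).

Let Ab : A <= b. Proof. by rewrite lerDl ltW. Qed.

Definition Minv (k n : 'I_N) : R := invmx (MN a N) k n.

(* Node by node, [QN] is [M_N^{-1} P] and [DQN] its differential. *)
Definition QN F G W e z :=
  \sum_(nd : 'I_N * bool) Minv e.1.1 nd.1 * flux_node F G W nd.1 nd.2 e z.

Definition DQN F G W V e z :=
  \sum_(nd : 'I_N * bool) Minv e.1.1 nd.1 * dflux_node F G W V nd.1 nd.2 e z.

Lemma residualE w m F G W e z : 0 <= w -> 0 < m -> CN_space G -> good w m G W ->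
  e \in nodes -> A <= z <= b ->
  residual A sigma h a G F W e.1.1 e.1.2 e.2 z = at_node N W e z - QN F G W e z.
Proof.
move=> w0 m0 CG gW he zab; rewrite /residual mxE; congr (_ - _).
rewrite /QN -(pair_bigA _ (fun n d => Minv e.1.1 n * flux_node F G W n d e z)).
apply: eq_bigr => n _; rewrite mxE.
rewrite (P_PiN A sigma h B N a hA s0 h0 w m F G W n e z w0 m0 CG gW he zab).
by rewrite big_bool mulrDr.
Qed.

Lemma continuous_PiN w m F G W n d e : 0 <= w -> 0 < m -> CN_space G ->
  good w m G W -> e \in nodes -> continuous (flux_node F G W n d e).
Proof.
move=> w0 m0 CG gW he.
have CF : CN_space (const_z F).
  by move=> k' i' j' _ _; apply: continuous_subspaceT; exact: ct_cst.
have nn (Q : sdfun R N) : CN_space Q -> 0 <= CN_norm Q.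
  move=> CQ; apply: le_trans (normr_ge0 (Q n 0%N 0%N A)) _.
  by apply: CN_norm_bound => //; rewrite lexx Ab.
have [M M0 HM] := admissible_bound A sigma h B N a hA s0 h0 _ _ _ w0 (nn _ CG) (nn _ CF).
have [Ad _] := HM m G F W d e CG erefl erefl gW he.
apply: (continuous_Pi A b Ab M m) => //; first exact: dPsi_continuous.
exact: ff_continuous.
Qed.

Lemma continuous_QN w m F G W e : 0 <= w -> 0 < m -> CN_space G ->
  good w m G W -> e \in nodes -> continuous (QN F G W e).
Proof.
move=> w0 m0 CG gW he; apply: ct_sum => nd; apply: ctZ.
exact: (continuous_PiN w m).
Qed.

Lemma continuous_DPiN w m F G W V n d e : 0 <= w -> 0 < m -> CN_space G ->
  good w m G W -> H10 V -> e \in nodes -> continuous (dflux_node F G W V n d e).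
Proof.
move=> w0 m0 CG gW HV he.
have CF : CN_space (const_z F).
  by move=> k' i' j' _ _; apply: continuous_subspaceT; exact: ct_cst.
have nn (Q : sdfun R N) : CN_space Q -> 0 <= CN_norm Q.
  move=> CQ; apply: le_trans (normr_ge0 (Q n 0%N 0%N A)) _.
  by apply: CN_norm_bound => //; rewrite lexx Ab.
have [M M0 HM] := admissible_bound A sigma h B N a hA s0 h0 _ _ _ w0 (nn _ CG) (nn _ CF).
have [Ad _] := HM m G F W d e CG erefl erefl gW he.
apply: (continuous_DPi A b Ab M m) => //; first exact: dPsi_continuous.
- exact: ff_continuous.
- exact: (jc_lp A sigma h B).
exact: (jc_lq A sigma B).
Qed.

Lemma continuous_DQN w m F G W V e : 0 <= w -> 0 < m -> CN_space G ->
  good w m G W -> H10 V -> e \in nodes -> continuous (DQN F G W V e).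
Proof.
move=> w0 m0 CG gW HV he; apply: ct_sum => nd; apply: ctZ.
exact: (continuous_DPiN w m).
Qed.

(** Finite linear combinations with entries of the inverse matrix: absolute values cost [cM],
    squares [cM ^+ 2]. *)
Lemma QN_estimates (w m nG nF : R) : 0 <= w -> 0 < m -> 0 <= nG -> 0 <= nF ->
  exists2 C : R, 0 <= C & forall G F W1 W2 e z, CN_space G -> CN_norm G = nG ->
    CN_norm (const_z F) = nF -> good w m G W1 -> good w m G W2 -> e \in nodes ->
    let r V := tail A b (fun t => nu V t ^+ 2) z in
  [/\ `|QN F G W1 e z| <= C,
      forall V, H10 V -> DQN F G W1 V e z ^+ 2 <= C * r V,
      (QN F G W2 e z - QN F G W1 e z) ^+ 2 <= C * r (W2 - W1),
      `|QN F G W2 e z - QN F G W1 e z - DQN F G W1 (W2 - W1) e z|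
        <= C * r (W2 - W1) &
      forall V D, H10 V -> (forall t, nu (W2 - W1) t <= D) ->
        (DQN F G W2 V e z - DQN F G W1 V e z) ^+ 2 <= C * (D ^+ 2 * r V)].
Proof.
move=> w0 m0 nG0 nF0.
have [C C0 HC] := DPiN_estimates A sigma h B N a hA s0 h0 h1 w m nG nF w0 m0 nG0 nF0.
pose cM := \sum_k \sum_(nd : 'I_N * bool) `|Minv k nd.1|.
have row0 k : 0 <= \sum_(nd : 'I_N * bool) `|Minv k nd.1| by rewrite sumr_ge0.
have row k : \sum_(nd : 'I_N * bool) `|Minv k nd.1| <= cM.
  by rewrite /cM (bigD1 k)//= lerDl sumr_ge0.
have cM0 : 0 <= cM by rewrite sumr_ge0.
have row2 k : (\sum_(nd : 'I_N * bool) `|Minv k nd.1|) ^+ 2 <= cM ^+ 2.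
  by rewrite lerXn2r// nnegrE.
pose K := cM * C + cM ^+ 2 * C.
have c1 : 0 <= cM * C by rewrite mulr_ge0.
have c2 : 0 <= cM ^+ 2 * C by rewrite mulr_ge0 ?sqr_ge0.
have K1 : cM * C <= K by rewrite lerDl.
have K2 : cM ^+ 2 * C <= K by rewrite lerDr.
exists K; first by rewrite addr_ge0.
move=> G F W1 W2 e z CG EG EF g1 g2 he r.
have r0 V : 0 <= r V by apply: tail_ge0 => // t; rewrite sqr_ge0.
have H n d := HC G F W1 W2 n d e z CG EG EF g1 g2 he.
have sB (f g : 'I_N * bool -> R) : \sum_nd Minv e.1.1 nd.1 * f nd - \sum_nd Minv e.1.1 nd.1 * g nd
   = \sum_(nd : 'I_N * bool) Minv e.1.1 nd.1 * (f nd - g nd).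
  by rewrite -sumrB; apply: eq_bigr => nd _; rewrite mulrBr.
have abs1 (f : 'I_N * bool -> R) X : 0 <= X -> (forall nd, `|f nd| <= C * X) ->
    `|\sum_(nd : 'I_N * bool) Minv e.1.1 nd.1 * f nd| <= K * X.
  move=> X0 Hf; apply: (le_trans (sum_abs_le _ _ _ _ _ _ Hf)).
  rewrite mulrA ler_wpM2r//; apply: le_trans K1; by rewrite ler_wpM2r.
have sq1 (f : 'I_N * bool -> R) X : 0 <= X -> (forall nd, f nd ^+ 2 <= C * X) ->
    (\sum_(nd : 'I_N * bool) Minv e.1.1 nd.1 * f nd) ^+ 2 <= K * X.
  move=> X0 Hf; apply: (le_trans (sum_sqr_le _ _ _ _ _ _ _ Hf)); first by rewrite mulr_ge0.
  rewrite mulrA ler_wpM2r//; apply: le_trans K2; by rewrite ler_wpM2r.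
split.
- rewrite -[K]mulr1; apply: abs1 => // nd; rewrite mulr1.
  by case: (H nd.1 nd.2).
- move=> V HV; apply: sq1 => // nd.
  by have [_ h2 _ _ _] := H nd.1 nd.2; exact: h2.
- by rewrite sB; apply: sq1 => // nd; case: (H nd.1 nd.2).
- by rewrite /QN /DQN !sB; apply: abs1 => // nd; case: (H nd.1 nd.2).
move=> V D HV HD; rewrite sB; apply: sq1 => [|nd].
  by rewrite mulr_ge0 ?sqr_ge0.
by have [_ _ _ _ h5] := H nd.1 nd.2; exact: h5.
Qed.

(** The functionals to which [riesz] applies. Stability under sums and multiples reduces the
    gradient to elementary functionals. *)
Definition representable (L : sdfun R N -> R) := exists2 r : 'I_N * nat * nat -> R -> R,
  forall e, continuous (r e) & forall V, H10 V ->
    L V = \sum_(e <- nodes) \int[mu]_(z in `[A, b]) (r e z * at_node N V e z).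

Lemma representable_eq L L' : (forall V, H10 V -> L V = L' V) ->
  representable L -> representable L'.
Proof. by move=> E [r cr H]; exists r => // V HV; rewrite -E// H. Qed.

Lemma itg_node e V (r : R -> R) : H10 V -> e \in nodes -> continuous r ->
  itg A b (fun z => r z * at_node N V e z).
Proof.
move=> HV he cr; apply: sqi_mul; first exact: sqi_continuous.
exact: (H10_L2class A sigma B N s0 V HV).
Qed.

Lemma representable0 : representable (fun=> 0).
Proof.
exists (fun _ _ => 0) => [e|V HV]; first exact: ct_cst.
rewrite big1// => e _; transitivity (\int[mu]_(z in `[A, b]) (0 : R)).
  by apply: eq_Rintegral => z _; rewrite mul0r.
by rewrite Rint_cst// mul0r.
Qed.

Lemma representableD L L' : representable L -> representable L' ->
  representable (fun V => L V + L' V).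
Proof.
move=> [r cr H] [r' cr' H']; exists (fun e z => r e z + r' e z) => [e|V HV].
  exact: ctD.
rewrite H// H'// -big_split/=; apply: eq_big_seq => e he.
rewrite -itgD_E; [|exact: itg_node|exact: itg_node].
by apply: eq_Rintegral => z _; rewrite mulrDl.
Qed.

Lemma representableZ c L : representable L -> representable (fun V => c * L V).
Proof.
move=> [r cr H]; exists (fun e z => c * r e z) => [e|V HV]; first exact: ctZ.
rewrite H// mulr_sumr; apply: eq_big_seq => e he.
rewrite -itgZ_E; last exact: itg_node.
by apply: eq_Rintegral => z _; rewrite mulrA.
Qed.

Lemma representable_sum (T : eqType) (s : seq T) (L : T -> sdfun R N -> R) :
  (forall i, i \in s -> representable (L i)) ->
  representable (fun V => \sum_(i <- s) L i V).
Proof.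
elim: s => [|i s IH] H.
  by apply: representable_eq representable0 => V _; rewrite big_nil.
have H1 := H i (mem_head i s).
have H2 : representable (fun V => \sum_(i <- s) L i V).
  by apply: IH => j js; apply: H; rewrite in_cons js orbT.
by apply: representable_eq (representableD _ _ H1 H2) => V _; rewrite big_cons.
Qed.

(** A stencil may reach the lateral boundary, where elements of [H10] vanish and the functional is
    0; at an interior node the density sits at that node alone. *)
Lemma representable_node (r : R -> R) k i j : continuous r -> (i <= B)%N -> (j <= B)%N ->
  representable (fun V => \int[mu]_(z in `[A, b]) (r z * V k i j (cl z))).
Proof.
move=> cr iB jB.
have clE V : \int[mu]_(z in `[A, b]) (r z * V k i j (cl z)) =
    \int[mu]_(z in `[A, b]) (r z * V k i j z).
  by apply: eq_Rintegral => z; rewrite inE/= in_itv/= => zab; rewrite clamp_id.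
have zi : \int[mu]_(z in `[A, b]) (0 : R) = 0 by rewrite Rint_cst// mul0r.
have [he|he] := boolP ((k, i, j) \in nodes); last first.
  apply: representable_eq representable0 => V HV.
  rewrite clE -[LHS]zi; apply: eq_Rintegral => z; rewrite inE/= in_itv/= => zab.
  have [_ -> //] := HV; rewrite ?mulr0// ?in_itv//.
  apply: contraNT he; rewrite !negb_or => /and4P[i0 iB' j0 jB'].
  by apply: nodes_mem; rewrite lt0n ?i0 ?j0 ltn_neqAle ?iB' ?jB'.
exists (fun e z => if e == (k, i, j) then r z else 0) => [e|V HV].
  by case: eqP => _; [exact: cr|exact: ct_cst].
rewrite clE (bigD1_seq _ he (nodes_uniq N B))/= eqxx big1 ?addr0// => e /negbTE ->.
by rewrite -[RHS]zi; apply: eq_Rintegral => z _; rewrite mul0r.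
Qed.

(** A direction enters through three stencil nodes and [N] components, that is, as a finite sum of
    terms [c t * al x] and [c t * be x]. [DPi_sum] splits the differential accordingly and [DPi_rep]
    gives a density for each term. *)
Lemma representable_DPiN w m F G W n d e (s : R -> R) : 0 <= w -> 0 < m -> CN_space G ->
  good w m G W -> e \in nodes -> continuous s ->
  representable (fun V => \int[mu]_(z in `[A, b]) (s z * dflux_node F G W V n d e z)).
Proof.
move=> w0 m0 CG gW he cs.
have CF : CN_space (const_z F).
  by move=> k' i' j' _ _; apply: continuous_subspaceT; exact: ct_cst.
have nn (Q : sdfun R N) : CN_space Q -> 0 <= CN_norm Q.
  move=> CQ; apply: le_trans (normr_ge0 (Q n 0%N 0%N A)) _.
  by apply: CN_norm_bound => //; rewrite lexx Ab.
have [M M0 HM] := admissible_bound A sigma h B N a hA s0 h0 _ _ _ w0 (nn _ CG) (nn _ CF).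
have [Ad _] := HM m G F W d e CG erefl erefl gW he.
have [iB jB] := nodes_leB _ _ _ he.
have [i1 j1] := sh1_le B N d e he; have [i2 j2] := sh2_le B N d e he.
(* the three nodes of the stencil with their coefficients in [v_diff] and [v_node] *)
pose st : seq (nat * nat * (R * R)) :=
  [:: (next_node N d e, ((2 * h)^-1, 0)); (prev_node N d e, (- (2 * h)^-1, 0)); ((e.1.2, e.2), (0, 1))].
have stB y : y \in st -> (y.1.1 <= B)%N /\ (y.1.2 <= B)%N.
  by rewrite !inE => /or3P[] /eqP ->.
pose S := [seq (k, y) | k <- index_enum 'I_N, y <- st].
have SB ky : ky \in S -> (ky.2.1.1 <= B)%N /\ (ky.2.1.2 <= B)%N.
  by move=> /allpairsP[[k y]] /= [_ /stB ? ->].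
(* Set to 0 off [S], so that [c V ky] is continuous for every index, as the sum lemmas require. *)
pose c (V : sdfun R N) (ky : 'I_N * (nat * nat * (R * R))) (t : R) :=
  if ky \in S then V ky.1 ky.2.1.1 ky.2.1.2 (cl t) else 0.
pose al (ky : 'I_N * (nat * nat * (R * R))) (x : R) := ky.2.2.1 * Psi a ky.1 (c01 x).
pose be (ky : 'I_N * (nat * nat * (R * R))) (x : R) := ky.2.2.2 * Psi a ky.1 (c01 x).
have cal ky : continuous (al ky).
  by apply: ctZ; apply: ct_comp; [exact: clamp_continuous|exact: Psi_continuous].
have cbe ky : continuous (be ky).
  by apply: ctZ; apply: ct_comp; [exact: clamp_continuous|exact: Psi_continuous].
have cc V ky : H10 V -> continuous (c V ky).
  move=> HV; have [kyS|kyS] := boolP (ky \in S); last first.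
    by rewrite /c (negbTE kyS); exact: ct_cst.
  have [i' j'] := SB ky kyS; rewrite /c kyS.
  apply: (clamp_comp_continuous A b (V ky.1 ky.2.1.1 ky.2.1.2)) => //.
  exact: (H10_within A sigma B N s0 V _ _ _ HV).
(* [g] will be [fst] or [snd], which select the coefficients of [v_diff] or [v_node]. *)
have sumS V (g : R * R -> R) t x : \sum_(ky <- S) c V ky t * (g ky.2.2 * Psi a ky.1 (c01 x)) =
    \sum_(k < N) (V k (next_node N d e).1 (next_node N d e).2 (cl t) * (g ((2 * h)^-1, 0)) +
      (V k (prev_node N d e).1 (prev_node N d e).2 (cl t) * (g (- (2 * h)^-1, 0)) +
       V k e.1.2 e.2 (cl t) * g (0, 1))) * Psi a k (c01 x).
  transitivity (\sum_(ky <- S) V ky.1 ky.2.1.1 ky.2.1.2 (cl t) * (g ky.2.2 * Psi a ky.1 (c01 x))).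
    by apply: eq_big_seq => ky; rewrite /c => ->.
  rewrite /S big_allpairs; apply: eq_bigr => k _.
  by rewrite !big_cons big_nil/=; ring.
have lpE V : v_diff A sigma h N a V d e = fun t x => \sum_(ky <- S) c V ky t * al ky x.
  apply/funext => t; apply/funext => x; rewrite (sumS V fst t x) /v_diff /vc /expansion -sumrB mulr_suml.
  by apply: eq_bigr => k _ /=; ring.
have lqE V : v_node A sigma N a V e = fun t x => \sum_(ky <- S) c V ky t * be ky x.
  apply/funext => t; apply/funext => x; rewrite (sumS V snd t x) /v_node /vc /expansion.
  by apply: eq_bigr => k _ /=; ring.
have rep ky := DPi_rep A b Ab M m (Psi a n) (dPsi a n) (f_diff h N a F d e)
  (u_diff A sigma h N a G W d e) (u_node A sigma h N a G W e) s (al ky) (be ky) m0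
  (dPsi_continuous a n) (ff_continuous h N a F d e) Ad cs (cal ky) (cbe ky).
pose L ky V := \int[mu]_(z in `[A, b]) (s z * DPi A b (Psi a n) (dPsi a n) (f_diff h N a F d e)
  (u_diff A sigma h N a G W d e) (u_node A sigma h N a G W e)
  (fun t x => c V ky t * al ky x) (fun t x => c V ky t * be ky x) z).
have RL ky : ky \in S -> representable (L ky).
  move=> kyS; have [r cr Hr] := rep ky; have [i' j'] := SB ky kyS.
  apply: representable_eq (representable_node r ky.1 _ _ cr i' j') => V HV.
  rewrite /L Hr; last exact: cc.
  by apply: eq_Rintegral => z _; rewrite /c kyS.
apply: representable_eq (representable_sum _ _ _ RL) => V HV.
have jl ky : joint_cont (fun t x => c V ky t * al ky x).
  by apply: jcM; [apply: jc1; exact: cc|exact: jc2].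
have jb ky : joint_cont (fun t x => c V ky t * be ky x).
  by apply: jcM; [apply: jc1; exact: cc|exact: jc2].
rewrite /L -Rint_sum; last first.
  move=> ky; apply: continuous_itg; apply: ctM => //.
  apply: (continuous_DPi A b Ab M m) => //; first exact: dPsi_continuous.
  exact: ff_continuous.
apply: eq_Rintegral => z _; rewrite /Submission.dflux_node lpE lqE -mulr_sumr; congr (_ * _).
rewrite (DPi_sum A b Ab _ S M m)//; first exact: dPsi_continuous.
exact: ff_continuous.
Qed.

Lemma representable_DQN w m F G W (s : 'I_N * nat * nat -> R -> R) :
  0 <= w -> 0 < m -> CN_space G -> good w m G W -> (forall e, e \in nodes -> continuous (s e)) ->
  representable (fun V => \sum_(e <- nodes) \int[mu]_(z in `[A, b]) (s e z * DQN F G W V e z)).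
Proof.
move=> w0 m0 CG gW cs; apply: representable_sum => e he.
apply: representable_eq (representable_sum _ (index_enum ('I_N * bool)%type)
  (fun nd V => Minv e.1.1 nd.1 * \int[mu]_(z in `[A, b]) (s e z * dflux_node F G W V nd.1 nd.2 e z)) _).
  move=> V HV.
  have ci nd : continuous (fun z => s e z * dflux_node F G W V nd.1 nd.2 e z).
    by apply: ctM; [exact: cs|exact: (continuous_DPiN w m)].
  transitivity (\sum_(nd : 'I_N * bool) \int[mu]_(z in `[A, b])
     (Minv e.1.1 nd.1 * (s e z * dflux_node F G W V nd.1 nd.2 e z))).
    by apply: eq_bigr => nd _; rewrite itgZ_E//; exact: continuous_itg.
  rewrite -Rint_sum; last by move=> nd; apply: continuous_itg; exact: ctZ.
  by apply: eq_Rintegral => z _; rewrite /DQN mulr_sumr; apply: eq_bigr => nd _; rewrite mulrCA.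
move=> nd _; apply: representableZ; apply: (representable_DPiN w m) => //; exact: cs.
Qed.

End Operator.

Lemma J_expand_ring (R : realType) (x y z u v t q g : R) :
  q * x + g * u - (q * y + g * v) - (q * (2 * z) + 2 * g * t) =
  q * (x - y - 2 * z) + g * (u - v - 2 * t).
Proof. ring. Qed.

(** * The functional and its gradient *)

Section Functional.
Context {R : realType}.
Variables (A sigma h : R) (B N : nat) (a : R).
Hypotheses (hA : 0 < A) (s0 : 0 < sigma) (h0 : 0 < h) (h1 : h < 1).
Local Notation mu := (@lebesgue_measure R).
Local Notation b := (A + sigma).
Local Notation cl := (clamp A b).
Local Notation nodes := (nodes N B).
Local Notation nu := (nu A sigma B N).
Local Notation H10 := (H10 A sigma B).
Local Notation H1_dot := (H1_dot A sigma h B).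
Local Notation H1_norm := (H1_norm A sigma h B).
Local Notation CN_space := (CN_space A sigma B).
Local Notation good := (good A sigma h B N a).
Local Notation QN := (QN A sigma h N a).
Local Notation DQN := (DQN A sigma h N a).
Local Notation J := (J A sigma h B a).
Implicit Types (G W V : sdfun R N) (F : 'I_N -> nat -> nat -> R) (e : 'I_N * nat * nat).
Implicit Types (X Y : 'I_N * nat * nat -> R -> R) (l g : R).

Let Ab : A <= b. Proof. by rewrite lerDl ltW. Qed.

(** The square of the weight [expR (l * z)] that multiplies the residual in [J]. *)
Definition wexp l (z : R) := expR (2 * l * z).

Lemma wexp_continuous l : continuous (wexp l).
Proof.
move=> x; apply: continuous_comp; last exact: continuous_expR.
by apply: cvgM; [exact: cvg_cst|exact: cvg_id].
Qed.

Lemma wexp_ge0 l z : 0 <= wexp l z. Proof. exact: expR_ge0. Qed.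

Definition wsum l X := h ^+ 2 * \sum_(e <- nodes) \int[mu]_(z in `[A, b]) (wexp l z * X e z).

Definition nodal_cont X := forall e, e \in nodes -> continuous (X e).

Lemma wsum_itg l X e : nodal_cont X -> e \in nodes -> itg A b (fun z => wexp l z * X e z).
Proof.
by move=> cX he; apply: continuous_itg; apply: ctM; [exact: wexp_continuous|exact: cX].
Qed.

Lemma h2_ge0 : 0 <= h ^+ 2. Proof. exact: sqr_ge0. Qed.

Lemma wsumD l X Y : nodal_cont X -> nodal_cont Y ->
  wsum l (fun e z => X e z + Y e z) = wsum l X + wsum l Y.
Proof.
move=> cX cY; rewrite /wsum -mulrDr -big_split/=; congr (_ * _).
apply: eq_big_seq => e he; rewrite -itgD_E; [|exact: wsum_itg|exact: wsum_itg].
by apply: eq_Rintegral => z _; rewrite mulrDr.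
Qed.

Lemma wsumZ l c X : nodal_cont X -> wsum l (fun e z => c * X e z) = c * wsum l X.
Proof.
move=> cX; rewrite /wsum mulrCA; congr (_ * _); rewrite mulr_sumr.
apply: eq_big_seq => e he; rewrite -itgZ_E; last exact: wsum_itg.
by apply: eq_Rintegral => z _; rewrite mulrCA.
Qed.

Lemma wsum_le l X Y : nodal_cont X -> nodal_cont Y ->
  (forall e z, e \in nodes -> A <= z <= b -> X e z <= Y e z) -> wsum l X <= wsum l Y.
Proof.
move=> cX cY XY; rewrite /wsum ler_wpM2l ?h2_ge0//.
rewrite big_seq [leRHS]big_seq; apply: ler_sum => e he.
apply: le_itg; [exact: wsum_itg|exact: wsum_itg|].
by move=> z zab; rewrite ler_wpM2l ?wexp_ge0// XY.
Qed.

Lemma eq_wsum l X Y : (forall e z, e \in nodes -> A <= z <= b -> X e z = Y e z) ->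
  wsum l X = wsum l Y.
Proof.
move=> XY; congr (_ * _); apply: eq_big_seq => e he; apply: eq_Rintegral => z.
by rewrite inE/= in_itv/= => zab; rewrite XY.
Qed.

Definition wmass l := wsum l (fun _ _ => 1).

Lemma ncont_cst c : nodal_cont (fun _ _ => c).
Proof. by move=> e _; exact: ct_cst. Qed.

Lemma wmass_ge0 l : 0 <= wmass l.
Proof.
rewrite mulr_ge0 ?h2_ge0// sumr_ge0// => e _; apply: Rintegral_ge0 => z _.
by rewrite mulr1 wexp_ge0.
Qed.

Lemma wsum_bound l X c : nodal_cont X ->
  (forall e z, e \in nodes -> A <= z <= b -> `|X e z| <= c) -> `|wsum l X| <= c * wmass l.
Proof.
move=> cX H; rewrite ler_norml -mulNr -!wsumZ; try exact: ncont_cst.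
apply/andP; split; apply: wsum_le => //; try by apply: ncont_cst.
- by move=> e z he zab; rewrite mulr1; move: (H e z he zab); rewrite ler_norml => /andP[].
by move=> e z he zab; rewrite mulr1; move: (H e z he zab); rewrite ler_norml => /andP[].
Qed.

Definition clamped_node V e z := at_node N V e (cl z).

Lemma ncont_vn V : H10 V -> nodal_cont (clamped_node V).
Proof.
move=> HV e he; have [iB jB] := nodes_leB _ _ _ he.
apply: (clamp_comp_continuous A b (at_node N V e)) => //.
exact: (H10_within A sigma B N s0 V).
Qed.

Lemma vn_le_nu V e z : H10 V -> e \in nodes -> `|clamped_node V e z| <= nu V z.
Proof.
by move=> HV he; have [iB jB] := nodes_leB _ _ _ he; exact: node_le_nu.
Qed.

Definition residual_node F G W e z := clamped_node W e z - QN F G W e z.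

(** The differential of [J] at [W] in the direction [V], as the chain rule predicts it. This formula
    can be estimated, whereas [frechet] is an element chosen by [xget]; [frechet_DJ] identifies the
    two. *)
Definition DJ F G l g W V :=
  expR (- (2 * l * A)) * (2 * wsum l (fun e z => residual_node F G W e z * (clamped_node V e z - DQN F G W V e z)))
  + 2 * g * H1_dot W V.

Definition tail2 V z := tail A b (fun t => nu V t ^+ 2) z.

Lemma tail2_ge0 V z : 0 <= tail2 V z.
Proof. by apply: tail_ge0 => // t; rewrite sqr_ge0. Qed.

Lemma tail2_continuous V : H10 V -> continuous (tail2 V).
Proof. by move=> HV; apply: continuous_tail => //; apply: ctX; exact: nu_continuous. Qed.

Lemma nodal_le V z : H10 V -> nu V z <= embedding_const sigma h * H1_norm V.
Proof. by move=> HV; exact: nu_le_H1_norm. Qed.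

Lemma tail2_le V z : H10 V -> tail2 V z <= sigma * (embedding_const sigma h * H1_norm V) ^+ 2.
Proof.
move=> HV; have E : b - A = sigma by ring.
have cn : continuous (fun t => nu V t ^+ 2) by apply: ctX; exact: nu_continuous.
have le t : nu V t ^+ 2 <= (embedding_const sigma h * H1_norm V) ^+ 2.
  have n0 := nu_ge0 A sigma B N V t; have n1 := nodal_le V t HV.
  exact: (ler_pM n0 n0 n1 n1).
have := tail_le A b Ab (fun t => nu V t ^+ 2) _ z cn le (sqr_ge0 _).
by rewrite E.
Qed.

Section FixedData.
Variables (w m : R) (w0 : 0 <= w) (m0 : 0 < m) (G : sdfun R N) (F : 'I_N -> nat -> nat -> R).
Hypothesis CG : CN_space G.

Lemma ncont_QN W : good w m G W -> nodal_cont (QN F G W).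
Proof. by move=> gW e he; exact: (continuous_QN A sigma h B N a hA s0 h0 w m). Qed.

Lemma ncont_DQN W V : good w m G W -> H10 V -> nodal_cont (DQN F G W V).
Proof. by move=> gW HV e he; exact: (continuous_DQN A sigma h B N a hA s0 h0 w m). Qed.

Lemma ncont_tn W : good w m G W -> nodal_cont (residual_node F G W).
Proof.
move=> gW e he; apply: ctB; last exact: (ncont_QN W gW e he).
by apply: ncont_vn => //; case: gW.
Qed.

Lemma J_good l g W : good w m G W ->
  J G F l g W = expR (- (2 * l * A)) * wsum l (fun e z => residual_node F G W e z ^+ 2) + g * H1_dot W W.
Proof.
move=> gW; rewrite /Defs.J L2_norm_sqr H1_norm_sqr; congr (_ * _ + _).
have ct : nodal_cont (fun e z => residual_node F G W e z ^+ 2).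
  by move=> e he; apply: ctX; exact: (ncont_tn W gW e he).
have [i1 i2] := Rint_sum_in _ nodes (fun e z => wexp l z * residual_node F G W e z ^+ 2) A b
  (fun e he => wsum_itg l _ e ct he).
rewrite /wsum -i2 -itgZ_E//; apply: eq_Rintegral => z; rewrite inE/= in_itv/= => zab.
congr (_ * _); rewrite sum_nodes; apply: eq_big_seq => e he.
rewrite (residualE A sigma h B N a hA s0 h0 w m F G W e z w0 m0 CG gW he zab).
rewrite /residual_node /clamped_node clamp_id//.
have -> : wexp l z = expR (l * z) * expR (l * z) by rewrite -expRD /wexp; congr expR; ring.
by ring.
Qed.

Lemma vnB U V e z : clamped_node (U - V) e z = clamped_node U e z - clamped_node V e z.
Proof. by []. Qed.

(* What [residual_node F G W2 ^+ 2] adds to its first-order expansion at [W1]. *)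
Definition taylor_rem W1 W2 e z :=
  (clamped_node (W2 - W1) e z - (QN F G W2 e z - QN F G W1 e z)) ^+ 2 -
  2 * residual_node F G W1 e z * (QN F G W2 e z - QN F G W1 e z - DQN F G W1 (W2 - W1) e z).

Lemma ncont_rem W1 W2 : good w m G W1 -> good w m G W2 -> nodal_cont (taylor_rem W1 W2).
Proof.
move=> g1 g2 e he; have H12 : H10 (W2 - W1) by apply: H10_B => //; [case: g2|case: g1].
have c1 := ncont_QN W1 g1 e he; have c2 := ncont_QN W2 g2 e he.
have k1 := ctX _ 2 (ctB _ _ (ncont_vn _ H12 e he) (ctB _ _ c2 c1)).
have k2 := ctM _ _ (ctZ 2 _ (ncont_tn W1 g1 e he))
  (ctB _ _ (ctB _ _ c2 c1) (ncont_DQN W1 _ g1 H12 e he)).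
exact: (ctB _ _ k1 k2).
Qed.

(** An identity, not an estimate: the residual is expanded exactly, and the quadratic regularization
    contributes its full second-order term, the origin of the coefficient [gamma] in the convexity
    bound. Bounding [taylor_rem] in absolute value gives differentiability, bounding it from below
    gives convexity. *)
Lemma J_expand l g W1 W2 : good w m G W1 -> good w m G W2 ->
  J G F l g W2 - J G F l g W1 - DJ F G l g W1 (W2 - W1) =
  expR (- (2 * l * A)) * wsum l (taylor_rem W1 W2) + g * H1_dot (W2 - W1) (W2 - W1).
Proof.
move=> g1 g2; rewrite !J_good// /DJ.
have [HW1 HW2] : H10 W1 /\ H10 W2 by split; [case: g1|case: g2].
have H12 := H10_B A sigma B N W2 W1 HW2 HW1.
have ct W : good w m G W -> nodal_cont (fun e z => residual_node F G W e z ^+ 2).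
  by move=> gW e he; apply: ctX; exact: (ncont_tn W gW e he).
have cd : nodal_cont (fun e z => residual_node F G W1 e z * (clamped_node (W2 - W1) e z - DQN F G W1 (W2 - W1) e z)).
  move=> e he; apply: ctM; first exact: (ncont_tn W1 g1 e he).
  by apply: ctB; [exact: (ncont_vn _ H12 e he)|exact: (ncont_DQN W1 _ g1 H12 e he)].
have E : wsum l (taylor_rem W1 W2) = wsum l (fun e z => residual_node F G W2 e z ^+ 2) -
    wsum l (fun e z => residual_node F G W1 e z ^+ 2) -
    2 * wsum l (fun e z => residual_node F G W1 e z * (clamped_node (W2 - W1) e z - DQN F G W1 (W2 - W1) e z)).
  rewrite -(mulN1r (wsum l (fun e z => residual_node F G W1 e z ^+ 2))) -mulNr -!wsumZ//; try exact: ct.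
  have cN : nodal_cont (fun e z => -1 * residual_node F G W1 e z ^+ 2).
    by move=> e he; apply: ctZ; exact: (ct W1 g1 e he).
  have cM : nodal_cont (fun e z => - (2) * (residual_node F G W1 e z * (clamped_node (W2 - W1) e z - DQN F G W1 (W2 - W1) e z))).
    by move=> e he; apply: ctZ; exact: (cd e he).
  rewrite -wsumD//; last exact: ct.
  rewrite -wsumD//; last first.
    by move=> e he; apply: ctD; [exact: (ct W2 g2 e he)|exact: (cN e he)].
  apply: eq_wsum => e z he zab; rewrite /taylor_rem /residual_node (vnB W2 W1).
  move: (clamped_node W1 e z) (clamped_node W2 e z) (QN F G W1 e z) (QN F G W2 e z) (DQN F G W1 (W2 - W1) e z).
  by clear => x1 x2 q1 q2 d; ring.
have EH : H1_dot (W2 - W1) (W2 - W1) = H1_dot W2 W2 - H1_dot W1 W1 - 2 * H1_dot W1 (W2 - W1).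
  rewrite H1_dotBl//.
  rewrite (H1_dotC _ _ _ _ _ W2 (W2 - W1)) (H1_dotC _ _ _ _ _ W1 (W2 - W1)) !H1_dotBl//.
  rewrite (H1_dotC _ _ _ _ _ W2 W1).
  by move: (H1_dot W1 W1) (H1_dot W1 W2) (H1_dot W2 W2); clear => x y z; ring.
by rewrite E EH; exact: J_expand_ring.
Qed.

(** The part of [DJ] containing [V] itself already has a density; for the part with [DQN] it comes
    from [representable_DQN], and the regularization is represented by a multiple of [W]. *)
Lemma DJ_riesz l g W : good w m G W ->
  exists2 D, H10 D & forall V, H10 V -> H1_dot D V = DJ F G l g W V.
Proof.
move=> gW; have HW : H10 W by case: gW.
have cs1 : nodal_cont (fun e z => wexp l z * residual_node F G W e z).
  by move=> e he; apply: ctM; [exact: wexp_continuous|exact: (ncont_tn W gW e he)].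
have [r cr Hr] := representable_DQN A sigma h B N a hA s0 h0 w m F G W
  (fun e z => - (wexp l z * residual_node F G W e z)) w0 m0 CG gW
  (fun e he => ctN _ (cs1 e he)).
(* [riesz] asks for a continuous density at every index, while continuity of the residual is known
   at interior nodes only. *)
pose r1 e z := if e \in nodes then wexp l z * residual_node F G W e z else 0.
have cr1 e : continuous (r1 e).
  have [he|/negbTE he] := boolP (e \in nodes).
    have -> : r1 e = (fun z => wexp l z * residual_node F G W e z) by apply/funext => z; rewrite /r1 he.
    exact: (cs1 e he).
  have -> : r1 e = (fun=> 0) by apply/funext => z; rewrite /r1 he.
  exact: ct_cst.
pose K := expR (- (2 * l * A)) * 2.
have [D HD DE] := riesz A sigma h B N s0 (fun e z => K * (r1 e z + r e z))
  (fun e => ctZ _ _ (ctD _ _ (cr1 e) (cr e))).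
exists ((2 * g) *: W + D); first exact: H10_lin.
move=> V HV; rewrite H1_dot_linl// addrC; congr (_ + _).
rewrite DE//.
transitivity (K * wsum l (fun e z => residual_node F G W e z * (clamped_node V e z - DQN F G W V e z))); last first.
  by rewrite /K mulrA.
rewrite /wsum [RHS]mulrCA; congr (_ * _).
have iN (q : R -> R) e : continuous q -> e \in nodes -> itg A b (fun z => q z * at_node N V e z).
  by move=> cq he; exact: (itg_node A sigma B N s0 e V q HV he cq).
have cX : nodal_cont (fun e z => residual_node F G W e z * clamped_node V e z).
  by move=> e he; apply: ctM; [exact: (ncont_tn W gW e he)|exact: (ncont_vn V HV e he)].
have cY : nodal_cont (fun e z => - (residual_node F G W e z * DQN F G W V e z)).
  move=> e he; apply: ctN; apply: ctM; first exact: (ncont_tn W gW e he).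
  exact: (ncont_DQN W V gW HV e he).
transitivity (K * (\sum_(e <- nodes) \int[mu]_(z in `[A, b]) (r1 e z * at_node N V e z) +
  \sum_(e <- nodes) \int[mu]_(z in `[A, b]) (r e z * at_node N V e z))).
  rewrite -big_split/= mulr_sumr; apply: eq_big_seq => e he.
  rewrite -itgD_E; [|exact: iN|exact: iN].
  rewrite -itgZ_E; last by apply: itgD; exact: iN.
  by apply: eq_Rintegral => z _; ring.
congr (_ * _); rewrite -Hr// -big_split/=; apply: eq_big_seq => e he.
have -> : \int[mu]_(z in `[A, b]) (r1 e z * at_node N V e z) =
   \int[mu]_(z in `[A, b]) (wexp l z * (residual_node F G W e z * clamped_node V e z)).
  apply: eq_Rintegral => z; rewrite inE/= in_itv/= => zab.
  by rewrite /r1 he /clamped_node clamp_id// mulrA.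
have -> : \int[mu]_(z in `[A, b]) (- (wexp l z * residual_node F G W e z) * DQN F G W V e z) =
   \int[mu]_(z in `[A, b]) (wexp l z * - (residual_node F G W e z * DQN F G W V e z)).
  by apply: eq_Rintegral => z _; ring.
rewrite -itgD_E; [|exact: (wsum_itg l _ e cX he)|exact: (wsum_itg l _ e cY he)].
by apply: eq_Rintegral => z _; ring.
Qed.

End FixedData.

End Functional.

Lemma abs_le_sqrt (R : realType) (x c y : R) : 0 <= c -> 0 <= y ->
  x ^+ 2 <= c * y ^+ 2 -> `|x| <= Num.sqrt c * y.
Proof.
move=> c0 y0 H; have s0 : 0 <= Num.sqrt c * y by rewrite mulr_ge0 ?sqrtr_ge0.
rewrite -ler_sqr ?nnegrE// real_normK ?num_real// exprMn sqr_sqrtr//.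
Qed.

(** Young's inequality in the form [(v - q) ^+ 2 >= v ^+ 2 / 2 - q ^+ 2], which is
    [(v - 2 * q) ^+ 2 >= 0]; the cross term is bounded by the product of the two majorants. *)
Lemma remainder_ge (R : realFieldType) (v q t s C T r : R) : q ^+ 2 <= C * r ->
  `|t| <= T -> `|s| <= C * r -> 0 <= T ->
  v ^+ 2 / 2 - (C + 2 * T * C) * r <= (v - q) ^+ 2 - 2 * t * s.
Proof.
move=> hq ht hs T0.
have : `|t * s| <= T * (C * r) by rewrite normrM ler_pM.
rewrite ler_norml => /andP[_ ts].
have : 0 <= (v - 2 * q) ^+ 2 by rewrite sqr_ge0.
nra.
Qed.

(** The first square is at most 1 and the second at most 1/4, a grid coordinate being within 1/2 of
    the midpoint; this is the 5/4 in [u0min]. *)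
Lemma grid_arith (R : realFieldType) (p q x c : R) : 0 <= p <= 1 -> 0 <= q <= 1 ->
  0 <= x <= 1 -> (p - x) ^+ 2 + (q - 2^-1) ^+ 2 + c <= c + 5 / 4.
Proof.
move=> /andP[p0 p1] /andP[q0 q1] /andP[x0 x1].
have : (p - x) ^+ 2 <= 1 by nra.
have : (q - 2^-1) ^+ 2 <= 1 / 4 by nra.
lra.
Qed.

Lemma le_sum5 (R : realFieldType) (x1 x2 x3 x4 x5 : R) :
  0 <= x1 -> 0 <= x2 -> 0 <= x3 -> 0 <= x4 -> 0 <= x5 ->
  let s := x1 + x2 + x3 + x4 + x5 in
  0 <= s /\ [/\ x1 <= s, x2 <= s, x3 <= s, x4 <= s & x5 <= s].
Proof. by move=> h1 h2 h3 h4 h5 s; rewrite /s; split; [|split]; lra. Qed.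

(** * Differentiability and uniqueness of the derivative *)

Section FrechetDerivative.
Context {R : realType}.
Variables (A sigma h : R) (B N : nat) (s0 : 0 < sigma).
Local Notation H10 := (H10 A sigma B).
Local Notation H1_dot := (H1_dot A sigma h B).
Local Notation H1_norm := (H1_norm A sigma h B).
Implicit Types (W V D : sdfun R N) (J : sdfun R N -> R).

Lemma is_frechet_quadratic J W D (K rho : R) : 0 < rho -> 0 <= K -> H10 D ->
  (forall V, H10 V -> H1_norm V < rho ->
    `|J (W + V) - J W - H1_dot D V| <= K * H1_norm V ^+ 2) ->
  is_frechet A sigma h B J W D.
Proof.
move=> r0 K0 HD H; split=> // e e0; have K1 : 0 < K + 1 by rewrite ltr_wpDl.
exists (Num.min rho (e / (K + 1))); first by rewrite lt_min r0 divr_gt0.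
move=> V HV; rewrite lt_min => /andP[Vr Ve]; apply: (le_trans (H V HV Vr)).
have n0 := H1_norm_ge0 A sigma h B N V.
rewrite expr2 mulrA ler_wpM2r//.
have : H1_norm V * (K + 1) <= e by rewrite -ler_pdivlMr// ltW.
by move: (H1_norm V) n0 => n n0; nra.
Qed.

(** Test with [t *: V] for small [t]: the two linear functionals differ by an arbitrarily small
    multiple of [t], hence agree. Equality holds as functionals, since values off the grid or
    outside [[A, A + sigma]] are arbitrary. *)
Lemma is_frechet_unique J W D1 D2 V : is_frechet A sigma h B J W D1 ->
  is_frechet A sigma h B J W D2 -> H10 V -> H1_dot D1 V = H1_dot D2 V.
Proof.
move=> [HD1 H1] [HD2 H2] HV.
have n0 := H1_norm_ge0 A sigma h B N V.
suff S e : 0 < e -> `|H1_dot D1 V - H1_dot D2 V| <= e.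
  apply/eqP; rewrite -subr_eq0 -normr_le0; apply/ler_addgt0Pl => e e0.
  by rewrite addr0 S.
move=> e0; set n := H1_norm V in n0.
have n1 : 0 < n + 1 by rewrite ltr_wpDl.
(* The 2 accounts for the two remainders, [n + 1] for a possibly zero norm. *)
pose e' := e / (2 * (n + 1)).
have e'0 : 0 < e' by rewrite divr_gt0// mulr_gt0.
have [d1 d10 K1] := H1 e' e'0; have [d2 d20 K2] := H2 e' e'0.
pose d := Num.min d1 d2.
have d0 : 0 < d by rewrite lt_min d10.
pose t := d / 2 / (n + 1).
have t0 : 0 < t by rewrite !divr_gt0.
have HtV : H10 (t *: V) by exact: H10_Z.
have ntV : H1_norm (t *: V) = t * n by rewrite H1_normZ// ger0_norm// ltW.
have residual_node : t * n < d.
  have : t * n <= t * (n + 1) by rewrite ler_pM2l// lerDl.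
  move=> /le_lt_trans; apply; rewrite /t divfK ?gt_eqF//.
  by rewrite ltr_pdivrMr// ltr_pMr// ltr1n.
have [td1 td2] : t * n < d1 /\ t * n < d2 by move: residual_node; rewrite lt_min => /andP[].
have L1 := K1 _ HtV; have L2 := K2 _ HtV.
rewrite ntV in L1 L2; have {}L1 := L1 td1; have {}L2 := L2 td2.
have E D : H10 D -> H1_dot D (t *: V) = t * H1_dot D V.
  by move=> HD; rewrite (H1_dotC A sigma h B N D) (H1_dotZl A sigma h B N s0 t V D HV HD) (H1_dotC A sigma h B N V).
rewrite (E _ HD1) in L1; rewrite (E _ HD2) in L2.
set j := J (W + t *: V) - J W in L1 L2.
have : `|t * (H1_dot D1 V - H1_dot D2 V)| <= 2 * (e' * (t * n)).
  have -> : t * (H1_dot D1 V - H1_dot D2 V) = (j - t * H1_dot D2 V) - (j - t * H1_dot D1 V) by ring.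
  by rewrite mulrDl mul1r; apply: le_normD; rewrite ?normrN.
rewrite normrM (ger0_norm (ltW t0)).
have -> : 2 * (e' * (t * n)) = t * (2 * e' * n) by ring.
rewrite ler_pM2l// => /le_trans; apply.
have -> : 2 * e' * n = e * n / (n + 1) by rewrite /e'; field; rewrite gt_eqF.
by rewrite ler_pdivrMr// ler_pM2l// lerDl.
Qed.

End FrechetDerivative.

(** * Estimates in the norm of H1 *)

Section NormEstimates.
Context {R : realType}.
Variables (A sigma h : R) (B N : nat) (a : R).
Hypotheses (hA : 0 < A) (s0 : 0 < sigma) (h0 : 0 < h) (h1 : h < 1).
Local Notation nodes := (nodes N B).
Local Notation nu := (nu A sigma B N).
Local Notation H10 := (H10 A sigma B).
Local Notation H1_norm := (H1_norm A sigma h B).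
Local Notation CN_space := (CN_space A sigma B).
Local Notation CN_norm := (CN_norm A sigma B).
Local Notation good := (good A sigma h B N a).
Local Notation DQN := (DQN A sigma h N a).
Local Notation residual_node := (residual_node A sigma h N a).
Local Notation clamped_node := (clamped_node A sigma N).
Local Notation taylor_rem := (taylor_rem A sigma h N a).
Local Notation tail2 := (tail2 A sigma B N).
Implicit Types (G W V : sdfun R N) (F : 'I_N -> nat -> nat -> R) (e : 'I_N * nat * nat).

(** The embedding converts tails into H1 norms, which suffices for differentiability and the
    Lipschitz bound. The final inequality keeps [tail2], since convexity needs the gain from the
    Carleman weight. *)
Lemma norm_estimates (w m nG nF : R) : 0 <= w -> 0 < m -> 0 <= nG -> 0 <= nF ->
  exists2 C : R, 0 <= C & forall G F W1 W2 e z, CN_space G -> CN_norm G = nG ->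
    CN_norm (const_z F) = nF -> good w m G W1 -> good w m G W2 -> e \in nodes ->
  [/\ `|residual_node F G W1 e z| <= C,
      `|residual_node F G W2 e z - residual_node F G W1 e z| <= C * H1_norm (W2 - W1),
      (forall V, H10 V -> `|clamped_node V e z - DQN F G W1 V e z| <= C * H1_norm V),
      (forall V, H10 V -> `|DQN F G W2 V e z - DQN F G W1 V e z| <=
        C * (H1_norm (W2 - W1) * H1_norm V)) &
      (`|taylor_rem G F W1 W2 e z| <= C * H1_norm (W2 - W1) ^+ 2 /\
      clamped_node (W2 - W1) e z ^+ 2 / 2 - C * tail2 (W2 - W1) z <= taylor_rem G F W1 W2 e z)].
Proof.
move=> w0 m0 nG0 nF0.
have [C C0 HC] := QN_estimates A sigma h B N a hA s0 h0 h1 w m nG nF w0 m0 nG0 nF0.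
pose ep := embedding_const sigma h.
have ep0 : 0 <= ep by exact: emb_ge0.
pose T := w + C.
have T0 : 0 <= T by rewrite addr_ge0.
pose k := Num.sqrt (C * sigma) * ep.
have Cs : 0 <= C * sigma by rewrite mulr_ge0// ltW.
have k0 : 0 <= k by rewrite mulr_ge0 ?sqrtr_ge0.
(* [T] bounds the residual, [c1] its increment and differential, [c2] the variation of [DQN], [c3]
   the remainder, and [c4] is the coefficient of the tail in [remainder_ge]. *)
pose c1 := ep + k; pose c2 := k * ep; pose c3 := c1 ^+ 2 + 2 * T * (C * sigma * ep ^+ 2).
pose c4 := C + 2 * T * C.
have c10 : 0 <= c1 by rewrite addr_ge0.
have c20 : 0 <= c2 by rewrite mulr_ge0.
have TT0 : 0 <= 2 * T by rewrite mulr_ge0.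
have c30 : 0 <= c3 by rewrite addr_ge0 ?sqr_ge0// mulr_ge0// mulr_ge0// sqr_ge0.
have c40 : 0 <= c4 by rewrite addr_ge0// mulr_ge0.
have [K0 [KT Kc1 Kc2 Kc3 Kc4]] := le_sum5 _ _ _ _ _ _ T0 c10 c20 c30 c40.
move: (T + c1 + c2 + c3 + c4) K0 KT Kc1 Kc2 Kc3 Kc4 => K K0 KT Kc1 Kc2 Kc3 Kc4.
exists K => // G F W1 W2 e z CG EG EF g1 g2 he.
have [Q1 Q2 Q3 Q4 Q5] := HC G F W1 W2 e z CG EG EF g1 g2 he.
have H12 : H10 (W2 - W1) by apply: H10_B; [case: g2|case: g1].
have n0 V := H1_norm_ge0 A sigma h B N V.
have vb V : H10 V -> `|clamped_node V e z| <= ep * H1_norm V.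
  by move=> HV; apply: le_trans (vn_le_nu A sigma B N s0 V e z HV he) _; exact: nodal_le.
have tb V : H10 V -> C * tail2 V z <= C * sigma * ep ^+ 2 * H1_norm V ^+ 2.
  move=> HV; rewrite -2!mulrA ler_wpM2l// -exprMn; exact: tail2_le.
have root x V : H10 V -> x ^+ 2 <= C * tail2 V z -> `|x| <= k * H1_norm V.
  move=> HV Hx; rewrite /k -mulrA.
  apply: (abs_le_sqrt _ _ _ _ Cs (mulr_ge0 ep0 (n0 V))).
  by rewrite exprMn mulrA; exact: (le_trans Hx (tb V HV)).
have t1 : `|residual_node F G W1 e z| <= T.
  apply: le_normD; last by rewrite normrN.
  by have [_ Hw _] := g1; have [iB jB] := nodes_leB _ _ _ he; exact: Hw.
have dq := root _ _ H12 Q3.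
have vq : `|clamped_node (W2 - W1) e z - (QN A sigma h N a F G W2 e z - QN A sigma h N a F G W1 e z)|
    <= c1 * H1_norm (W2 - W1).
  by rewrite /c1 mulrDl; apply: le_normD; [exact: vb|rewrite normrN].
split.
- exact: le_trans t1 KT.
- have -> : residual_node F G W2 e z - residual_node F G W1 e z = clamped_node (W2 - W1) e z -
     (QN A sigma h N a F G W2 e z - QN A sigma h N a F G W1 e z).
    rewrite /Submission.residual_node (vnB A sigma N W2 W1).
    by move: (clamped_node W1 e z) (clamped_node W2 e z) (QN _ _ _ _ _ _ _ W2 _ _) (QN _ _ _ _ _ _ _ W1 _ _);
      clear => ? ? ? ?; ring.
  by apply: le_trans vq _; rewrite ler_wpM2r.
- move=> V HV; have dv := root _ _ HV (Q2 V HV).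
  apply: (@le_trans _ _ (c1 * H1_norm V)); last by rewrite ler_wpM2r.
  by rewrite /c1 mulrDl; apply: le_normD; [exact: vb|rewrite normrN].
- move=> V HV.
  have Hn t : nu (W2 - W1) t <= ep * H1_norm (W2 - W1) by exact: nodal_le.
  have := Q5 V _ HV Hn => Q6.
  apply: (@le_trans _ _ (c2 * (H1_norm (W2 - W1) * H1_norm V))).
    have -> : c2 * (H1_norm (W2 - W1) * H1_norm V) =
      Num.sqrt (C * sigma) * (ep * H1_norm (W2 - W1) * (ep * H1_norm V)).
      by rewrite /c2 /k; move: (H1_norm V) (H1_norm (W2 - W1)) (Num.sqrt _); clear => ? ? ?; ring.
    have p0 : 0 <= ep * H1_norm (W2 - W1) * (ep * H1_norm V).
      exact: (mulr_ge0 (mulr_ge0 ep0 (n0 _)) (mulr_ge0 ep0 (n0 _))).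
    apply: (abs_le_sqrt _ _ _ _ Cs p0); apply: (le_trans Q6).
    rewrite (mulrCA C).
    have -> : C * sigma * (ep * H1_norm (W2 - W1) * (ep * H1_norm V)) ^+ 2 =
       (ep * H1_norm (W2 - W1)) ^+ 2 * (C * sigma * ep ^+ 2 * H1_norm V ^+ 2).
      by move: (H1_norm V) (H1_norm (W2 - W1)); clear => ? ?; ring.
    exact: (ler_wpM2l (sqr_ge0 _) (tb V HV)).
  exact: (ler_wpM2r (mulr_ge0 (n0 _) (n0 _)) Kc2).
split.
  apply: (@le_trans _ _ (c3 * H1_norm (W2 - W1) ^+ 2)); last by rewrite ler_wpM2r// sqr_ge0.
  rewrite /c3 mulrDl -exprMn; apply: le_normD; first exact: le_normX.
  rewrite normrN -[leRHS]mulrA; apply: le_normM.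
    by apply: le_normM => //; rewrite ger0_norm.
  exact: le_trans Q4 (tb _ H12).
apply: (@le_trans _ _ (clamped_node (W2 - W1) e z ^+ 2 / 2 - c4 * tail2 (W2 - W1) z)).
  by rewrite lerD2l lerN2 ler_wpM2r// tail2_ge0.
exact: remainder_ge Q3 t1 Q4 T0.
Qed.

End NormEstimates.

Lemma half_below (R : realFieldType) (m p q : R) : m <= p -> - (m / 2) <= q - p -> m / 2 <= q.
Proof. by move=> ? ?; lra. Qed.

(** * Neighbourhoods on which [u] stays bounded below *)

Section Admissible.
Context {R : realType}.
Variables (A sigma h : R) (B N : nat) (a : R).
Hypotheses (hA : 0 < A) (s0 : 0 < sigma) (h0 : 0 < h) (hB : h^-1 = B%:R).
Local Notation b := (A + sigma).
Local Notation c01 := (clamp (0 : R) 1).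
Local Notation H10 := (H10 A sigma B).
Local Notation H1_norm := (H1_norm A sigma h B).
Local Notation good := (good A sigma h B N a).
Implicit Types (G W V : sdfun R N).

Definition u0min : R := A ^+ 2 / (A ^+ 2 + 5 / 4).

Lemma u0min_gt0 : 0 < u0min.
Proof. by rewrite divr_gt0 ?addr_gt0 ?exprn_gt0. Qed.

Lemma grid_itv (i : nat) : (i <= B)%N -> 0 <= i%:R * h <= 1.
Proof.
move=> iB; rewrite mulr_ge0 ?(ltW h0)//=.
apply: (@le_trans _ _ (B%:R * h)); first by rewrite ler_pM2r// ler_nat.
by rewrite -hB mulVf// gt_eqF.
Qed.

Lemma u0_ge (i j : nat) (x : R) : (i <= B)%N -> (j <= B)%N -> 0 <= x <= 1 -> u0min <= u0 A h i j x.
Proof.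
move=> /grid_itv ih /grid_itv jh x01; rewrite /u0min /u0.
have A2 : 0 < A ^+ 2 by rewrite exprn_gt0.
rewrite ler_pM2l// lef_pV2 ?posrE; first exact: grid_arith.
- by rewrite addr_gt0.
exact: lt_le_trans A2 (u0_den A h i j x).
Qed.

(* Contains both [K (2 r)] and the closure of [K r] when [rho] is [2 r]. *)
Definition nonneg_ball (rho : R) G W := [/\ H10 W, H1_norm W <= rho &
  forall i j z x, (i <= B)%N -> (j <= B)%N ->
    A <= z <= b -> 0 <= x <= 1 -> 0 <= wg a G W z x i j].

(** The first bound keeps nodal values within 1 of those of [W], the second keeps [u] within
    [u0min / 2] of its value; the added 1 keeps the denominators positive. *)
Definition radius : R := Num.min (embedding_const sigma h + 1)^-1
  (u0min / 2 / (N%:R * nbound N a * embedding_const sigma h + 1)).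

Lemma radius_gt0 : 0 < radius.
Proof.
have e0 : 0 <= embedding_const sigma h by exact: emb_ge0.
have p1 : 0 < embedding_const sigma h + 1 by rewrite ltr_wpDl.
have p2 : 0 < N%:R * nbound N a * embedding_const sigma h + 1.
  by apply: ltr_wpDl => //; exact: (mulr_ge0 (mulr_ge0 (ler0n _ _) (nbound_ge0 N a)) e0).
have p3 : 0 < u0min / 2 by apply: divr_gt0 => //; exact: u0min_gt0.
by rewrite lt_min invr_gt0 p1 (divr_gt0 p3 p2).
Qed.

(** Near [W] the sum [w + g] may turn negative, so positivity has to be kept for [u] itself: it
    starts above [u0min] and loses at most half of it. This makes the functional differentiable at
    every point of the ball, including points of the closure. *)
Lemma good_ball (rho : R) G W V : nonneg_ball rho G W -> H10 V -> H1_norm V <= radius ->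
  good (embedding_const sigma h * rho + 1) (Num.sqrt (u0min / 2)) G (W + V).
Proof.
move=> [HW nW pW] HV nV.
have e0 : 0 <= embedding_const sigma h by exact: emb_ge0.
have u2 : 0 <= u0min / 2 by rewrite divr_ge0// ltW// u0min_gt0.
have V0 := H1_norm_ge0 A sigma h B N V.
move: nV; rewrite le_min => /andP[nV1 nV2].
have Ab : A <= b by rewrite lerDl ltW.
split.
- exact: H10_D.
- move=> k i j t iB jB; apply: le_normD.
    apply: le_trans (node_le_nu A sigma B N s0 W k i j t HW iB jB) _.
    apply: le_trans (nu_le_H1_norm A sigma h B N s0 h0 W t HW) _.
    by rewrite ler_wpM2l.
  apply: le_trans (node_le_nu A sigma B N s0 V k i j t HV iB jB) _.
  apply: le_trans (nu_le_H1_norm A sigma h B N s0 h0 V t HV) _.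
  have e1 : 0 < embedding_const sigma h + 1 by rewrite ltr_wpDl.
  apply: (@le_trans _ _ (embedding_const sigma h * (embedding_const sigma h + 1)^-1)); first by rewrite ler_wpM2l.
  by rewrite ler_pdivrMr// mul1r lerDl.
move=> i j t x iB jB; rewrite sqr_sqrtr//.
have D := uc_diff A sigma h N a G W (W + V) i j t x.
have WV : W + V - W = V by rewrite addrC addKr.
rewrite WV in D.
have vb := vc_bound A sigma B N a s0 V i j t x HV iB jB.
have nb0 := nbound_ge0 N a.
have vb2 : `|vc A sigma N a V i j t x| <= u0min / 2.
  apply: (le_trans vb); apply: (@le_trans _ _ (N%:R * nbound N a * (embedding_const sigma h * H1_norm V))).
    by rewrite ler_wpM2l ?mulr_ge0//; exact: nu_le_H1_norm.
  have k0 : 0 <= N%:R * nbound N a * embedding_const sigma h by do 2 apply: mulr_ge0 => //.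
  rewrite mulrA; apply: (le_trans (ler_wpM2l k0 nV2)).
  have k1 : 0 < N%:R * nbound N a * embedding_const sigma h + 1 by rewrite ltr_wpDl.
  by rewrite mulrA ler_pdivrMr// mulrC ler_wpM2l// lerDl.
have c01P := c01_itv x.
have ucW : u0min <= uc A sigma h N a G W i j t x.
  apply: (le_trans (u0_ge i j (c01 x) iB jB c01P)).
  by rewrite /uc /u lerDl; apply: pW => //; exact: clamp_itv.
move: vb2; rewrite -D ler_norml => /andP[lo _].
exact: half_below ucW lo.
Qed.

Lemma good_self (rho : R) G W : nonneg_ball rho G W ->
  good (embedding_const sigma h * rho + 1) (Num.sqrt (u0min / 2)) G W.
Proof.
move=> HW; rewrite -[W]addr0; apply: good_ball => //; first exact: H10_0.
by rewrite -(scale0r 0) H1_normZ ?normr0 ?mul0r ?(ltW radius_gt0)//; exact: H10_0.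
Qed.

End Admissible.

Lemma carleman_const (R : realFieldType) (C n l : R) : 0 < l -> 2 * C * n <= l ->
  C * (n / (2 * l)) <= 4^-1.
Proof. by move=> l0 H; rewrite mulrA ler_pdivrMr ?mulr_gt0//; lra. Qed.

Lemma half_quarter (R : realFieldType) (x y : R) : y <= 4^-1 * x -> 4^-1 * x <= 2^-1 * x - y.
Proof. lra. Qed.

Lemma product_lipschitz (R : realFieldType) (C t1 t2 v d1 d2 p q : R) : 0 <= C ->
  `|t1| <= C -> `|t2 - t1| <= C * p -> `|v - d2| <= C * q -> `|d2 - d1| <= C * (p * q) ->
  `|t2 * (v - d2) + -1 * (t1 * (v - d1))| <= 2 * C ^+ 2 * (p * q).
Proof.
move=> C0 H1 H2 H3 H4.
have -> : t2 * (v - d2) + -1 * (t1 * (v - d1)) = (t2 - t1) * (v - d2) + - t1 * (d2 - d1) by ring.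
have -> : 2 * C ^+ 2 * (p * q) = C * p * (C * q) + C * (C * (p * q)) by ring.
by apply: (le_trans (ler_normD _ _)); apply: lerD; rewrite normrM ler_pM// normrN.
Qed.

Lemma gradient_diff (R : comPzRingType) (E S1 S2 g d1 d2 : R) :
  E * (2 * S2) + 2 * g * d2 - (E * (2 * S1) + 2 * g * d1) = E * (2 * (S2 - S1)) + 2 * g * (d2 - d1).
Proof. ring. Qed.

Lemma gradient_arith (R : realFieldType) (E S g d T M p : R) : 0 <= E -> 0 < g < 1 -> 0 <= p ->
  `|S| <= T * p * M -> `|d| <= p ->
  E * (2 * S) + 2 * g * d <= (E * (2 * (T * M)) + 2) * p.
Proof.
move=> E0 /andP[g0 g1] p0 HS Hd.
have -> : (E * (2 * (T * M)) + 2) * p = E * (2 * (T * p * M)) + 2 * p by ring.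
apply: lerD.
  by rewrite ler_wpM2l// ler_wpM2l//; exact: le_trans (ler_norm _) HS.
rewrite -mulrA ler_wpM2l//; apply: (@le_trans _ _ (g * p)); last by rewrite ler_piMl// ltW.
by rewrite ler_pM2l//; exact: le_trans (ler_norm _) Hd.
Qed.

(** * Lipschitz continuity of the gradient and the Carleman convexity bound *)

Section Convexity.
Context {R : realType}.
Variables (A sigma h : R) (B N : nat) (a : R).
Hypotheses (hA : 0 < A) (s0 : 0 < sigma) (h0 : 0 < h) (h1 : h < 1) (hB : h^-1 = B%:R).
Local Notation mu := (@lebesgue_measure R).
Local Notation b := (A + sigma).
Local Notation nodes := (nodes N B).
Local Notation nu := (nu A sigma B N).
Local Notation H10 := (H10 A sigma B).
Local Notation H1_dot := (H1_dot A sigma h B).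
Local Notation H1_norm := (H1_norm A sigma h B).
Local Notation L2_dot := (L2_dot A sigma h B).
Local Notation L2_norm := (L2_norm A sigma h B).
Local Notation CN_space := (CN_space A sigma B).
Local Notation CN_norm := (CN_norm A sigma B).
Local Notation good := (good A sigma h B N a).
Local Notation DQN := (DQN A sigma h N a).
Local Notation residual_node := (residual_node A sigma h N a).
Local Notation clamped_node := (clamped_node A sigma N).
Local Notation taylor_rem := (taylor_rem A sigma h N a).
Local Notation tail2 := (tail2 A sigma B N).
Local Notation wsum := (wsum A sigma h B N).
Local Notation wmass := (wmass A sigma h B N).
Local Notation nonneg_ball := (nonneg_ball A sigma h B N a).
Local Notation J := (J A sigma h B a).
Local Notation DJ := (DJ A sigma h B N a).
Local Notation frechet := (frechet A sigma h B).
Local Notation is_frechet := (is_frechet A sigma h B).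
Implicit Types (G W V : sdfun R N) (F : 'I_N -> nat -> nat -> R) (e : 'I_N * nat * nat).

Let Ab : A <= b. Proof. by rewrite lerDl ltW. Qed.

Lemma CN_norm_ge0 (k : 'I_N) (Q : sdfun R N) : CN_space Q -> 0 <= CN_norm Q.
Proof.
move=> CQ; apply: le_trans (normr_ge0 (Q k 0%N 0%N A)) _.
by apply: CN_norm_bound => //; rewrite lexx Ab.
Qed.

Lemma CN_const_z F : CN_space (const_z F).
Proof. by move=> k i j _ _; apply: continuous_subspaceT; exact: ct_cst. Qed.

Definition data (nG nF : R) G F :=
  [/\ CN_space G, CN_norm G = nG & CN_norm (const_z F) = nF].

Lemma uniform_estimates (rho nG nF : R) : 0 <= rho -> exists2 C : R, 0 <= C &
  forall G F W1 W2 e z, data nG nF G F ->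
    good (embedding_const sigma h * rho + 1) (Num.sqrt (u0min A / 2)) G W1 ->
    good (embedding_const sigma h * rho + 1) (Num.sqrt (u0min A / 2)) G W2 -> e \in nodes ->
  [/\ `|residual_node F G W1 e z| <= C,
      `|residual_node F G W2 e z - residual_node F G W1 e z| <= C * H1_norm (W2 - W1),
      (forall V, H10 V -> `|clamped_node V e z - DQN F G W1 V e z| <= C * H1_norm V),
      (forall V, H10 V -> `|DQN F G W2 V e z - DQN F G W1 V e z| <=
        C * (H1_norm (W2 - W1) * H1_norm V)) &
      (`|taylor_rem G F W1 W2 e z| <= C * H1_norm (W2 - W1) ^+ 2 /\
      clamped_node (W2 - W1) e z ^+ 2 / 2 - C * tail2 (W2 - W1) z <= taylor_rem G F W1 W2 e z)].
Proof.
move=> r0.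
have w0 : 0 <= embedding_const sigma h * rho + 1 by rewrite addr_ge0// mulr_ge0// emb_ge0.
have m0 : 0 < Num.sqrt (u0min A / 2).
  by rewrite sqrtr_gt0; apply: divr_gt0 => //; exact: u0min_gt0.
(* The norms are arbitrary reals here; for a negative one no data exist, and the node [e] supplies a
   component index to show it. *)
have [nG0|nG0] := leP 0 nG; last first.
  exists 0 => // G F W1 W2 e z [CG EG _].
  by have := CN_norm_ge0 e.1.1 G CG; rewrite EG leNgt nG0.
have [nF0|nF0] := leP 0 nF; last first.
  exists 0 => // G F W1 W2 e z [_ _ EF].
  by have := CN_norm_ge0 e.1.1 _ (CN_const_z F); rewrite EF leNgt nF0.
have [C C0 HC] := norm_estimates A sigma h B N a hA s0 h0 h1 _ _ nG nF w0 m0 nG0 nF0.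
by exists C => // G F W1 W2 e z [CG EG EF] g1 g2 he; exact: HC.
Qed.

Lemma addBK (W V : sdfun R N) : W + V - W = V.
Proof. by rewrite addrC addKr. Qed.

(** The expansion leaves a remainder bounded by [K * H1_norm V ^+ 2] for [V] within [radius], so the
    representer of [DJ] is a derivative; [frechet] then is one too, and uniqueness transfers the
    formula. *)
Lemma frechet_DJ (rho nG nF l g : R) G F W : 0 <= rho -> data nG nF G F ->
  nonneg_ball rho G W ->
  is_frechet (J G F l g) W (frechet (J G F l g) W) /\
  forall V, H10 V -> H1_dot (frechet (J G F l g) W) V = DJ F G l g W V.
Proof.
move=> r0 D HW.
have [C C0 HC] := uniform_estimates rho nG nF r0.
have gW := good_self A sigma h B N a hA s0 h0 hB rho G W HW.
have CG : CN_space G by case: D.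
have w0 : 0 <= embedding_const sigma h * rho + 1 by rewrite addr_ge0// mulr_ge0// emb_ge0.
have m0 : 0 < Num.sqrt (u0min A / 2).
  by rewrite sqrtr_gt0; apply: divr_gt0 => //; exact: u0min_gt0.
have [D0 HD0 D0E] := DJ_riesz A sigma h B N a hA s0 h0 _ _ w0 m0 G F CG l g W gW.
pose K := expR (- (2 * l * A)) * (C * wmass l) + `|g|.
have eK : 0 <= expR (- (2 * l * A)) * (C * wmass l).
  by apply: mulr_ge0; [exact: expR_ge0|apply: mulr_ge0 => //; exact: wmass_ge0].
have K0 : 0 <= K by apply: addr_ge0.
have FD0 : is_frechet (J G F l g) W D0.
  have rg := radius_gt0 A sigma h N a hA h0.
  apply: (is_frechet_quadratic A sigma h B N (J G F l g) W D0 K _ rg K0 HD0).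
  move=> V HV nV.
  have gWV := good_ball A sigma h B N a hA s0 h0 hB rho G W V HW HV (ltW nV).
  have E := J_expand A sigma h B N a hA s0 h0 _ _ w0 m0 G F CG l g _ _ gW gWV.
  rewrite addBK in E; rewrite (D0E V HV) E -H1_norm_sqr.
  have cR := ncont_rem A sigma h B N a hA s0 h0 _ _ w0 m0 G F CG _ _ gW gWV.
  have bR : `|wsum l (taylor_rem G F W (W + V))| <= C * H1_norm V ^+ 2 * wmass l.
    apply: wsum_bound => // e z he _.
    by have [_ _ _ _ []] := HC G F W (W + V) e z D gW gWV he; rewrite addBK.
  have -> : K * H1_norm V ^+ 2 =
     expR (- (2 * l * A)) * (C * H1_norm V ^+ 2 * wmass l) + `|g| * H1_norm V ^+ 2.
    by rewrite /K; ring.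
  apply: le_normD; apply: le_normM => //; rewrite ger0_norm ?expR_ge0 ?sqr_ge0//.
have FF : is_frechet (J G F l g) W (frechet (J G F l g) W).
  by apply: (xgetPex (0 : sdfun R N)); exists D0.
split; [exact: FF|move=> V HV; rewrite -(D0E V HV)].
exact: (is_frechet_unique A sigma h B N s0 _ _ _ _ V FF FD0 HV).
Qed.

(** Pairing the difference [V] of the two gradients with itself gives [H1_norm V ^+ 2], and through
    [DJ] this is at most [K * (H1_norm (W2 - W1) * H1_norm V)]; then divide by the norm of [V]. *)
Lemma lipschitz_derivative (rho nG nF l : R) : 0 <= rho -> exists2 C : R, 0 < C &
  forall G F g W1 W2, data nG nF G F -> 0 < g < 1 ->
    nonneg_ball rho G W1 -> nonneg_ball rho G W2 ->
    H1_norm (frechet (J G F l g) W2 - frechet (J G F l g) W1) <= C * H1_norm (W2 - W1).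
Proof.
move=> r0; have [C C0 HC] := uniform_estimates rho nG nF r0.
(* The summand 2 comes from the regularization, whose gradient is [2 * g] times the identity with
   [g < 1]. *)
pose K := expR (- (2 * l * A)) * (2 * (2 * C ^+ 2 * wmass l)) + 2.
have eK : 0 <= expR (- (2 * l * A)) * (2 * (2 * C ^+ 2 * wmass l)).
  apply: mulr_ge0; first exact: expR_ge0.
  apply: mulr_ge0 => //; apply: mulr_ge0; last exact: wmass_ge0.
  by apply: mulr_ge0 => //; exact: sqr_ge0.
exists K; first by rewrite ltr_wpDl.
move=> G F g W1 W2 D /andP[g0 g1'] N1 N2.
have gW1 := good_self A sigma h B N a hA s0 h0 hB rho G W1 N1.
have gW2 := good_self A sigma h B N a hA s0 h0 hB rho G W2 N2.
have [[HF1 _] E1] := frechet_DJ rho nG nF l g G F W1 r0 D N1.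
have [[HF2 _] E2] := frechet_DJ rho nG nF l g G F W2 r0 D N2.
have CG : CN_space G by case: D.
have w0 : 0 <= embedding_const sigma h * rho + 1 by rewrite addr_ge0// mulr_ge0// emb_ge0.
have m0 : 0 < Num.sqrt (u0min A / 2).
  by rewrite sqrtr_gt0; apply: divr_gt0 => //; exact: u0min_gt0.
have HW1 : H10 W1 by case: N1. have HW2 : H10 W2 by case: N2.
have H12 := H10_B A sigma B N W2 W1 HW2 HW1.
set V := frechet (J G F l g) W2 - frechet (J G F l g) W1.
have HV : H10 V by exact: H10_B.
have n0 U := H1_norm_ge0 A sigma h B N U.
have cX W : good (embedding_const sigma h * rho + 1) (Num.sqrt (u0min A / 2)) G W ->
    nodal_cont B N (fun e z => residual_node F G W e z * (clamped_node V e z - DQN F G W V e z)).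
  move=> gW e he; have c1 := ncont_tn A sigma h B N a hA s0 h0 _ _ w0 m0 G F CG W gW e he.
  have c2 := ncont_vn A sigma B N s0 V HV e he.
  have c3 := ncont_DQN A sigma h B N a hA s0 h0 _ _ w0 m0 G F CG W V gW HV e he.
  exact: (ctM _ _ c1 (ctB _ _ c2 c3)).
have bnd : `|wsum l (fun e z => residual_node F G W2 e z * (clamped_node V e z - DQN F G W2 V e z)) -
    wsum l (fun e z => residual_node F G W1 e z * (clamped_node V e z - DQN F G W1 V e z))| <=
    2 * C ^+ 2 * (H1_norm (W2 - W1) * H1_norm V) * wmass l.
  rewrite -(mulN1r (wsum l (fun e z => residual_node F G W1 e z * _))) -wsumZ; last exact: cX.
  have cN : nodal_cont B N (fun e z => -1 * (residual_node F G W1 e z * (clamped_node V e z - DQN F G W1 V e z))).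
    by move=> e he; apply: ctZ; exact: (cX W1 gW1 e he).
  rewrite -wsumD//; last exact: cX.
  apply: wsum_bound.
    by move=> e he; exact: (ctD _ _ (cX W2 gW2 e he) (cN e he)).
  move=> e z he _.
  have [t1 t21 _ d21 _] := HC G F W1 W2 e z D gW1 gW2 he.
  have [_ _ v2 _ _] := HC G F W2 W1 e z D gW2 gW1 he.
  exact: (product_lipschitz _ C (residual_node F G W1 e z) _ _ _ _ _ _ C0 t1 t21 (v2 V HV) (d21 V HV)).
have key : H1_norm V ^+ 2 <= K * (H1_norm (W2 - W1) * H1_norm V).
  rewrite H1_norm_sqr.
  have -> : H1_dot V V = DJ F G l g W2 V - DJ F G l g W1 V.
    by rewrite -(E2 V HV) -(E1 V HV); exact: (H1_dotBl A sigma h B N s0 _ _ V HF2 HF1 HV).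
  rewrite /Submission.DJ gradient_diff -(H1_dotBl A sigma h B N s0 W2 W1 V HW2 HW1 HV).
  have g01 : 0 < g < 1 by apply/andP.
  exact: (gradient_arith _ _ _ _ _ _ _ _ (expR_ge0 _) g01 (mulr_ge0 (n0 _) (n0 _)) bnd
    (H1_CS A sigma h B N s0 _ _ H12 HV)).
have [V0|V0] := eqVneq (H1_norm V) 0.
  rewrite V0; apply: mulr_ge0; last exact: n0.
  by rewrite ltW// ltr_wpDl.
have Vp : 0 < H1_norm V by rewrite lt_neqAle eq_sym V0 n0.
by move: key; rewrite expr2 mulrA ler_pM2r.
Qed.

Lemma wsum_vn_sqr l V : H10 V ->
  wsum l (fun e z => clamped_node V e z ^+ 2) = h ^+ 2 * \int[mu]_(z in `[A, b]) (wexp l z * nu V z ^+ 2).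
Proof.
move=> HV; rewrite int_nu//; last exact: wexp_continuous.
congr (_ * _); apply: eq_bigr => e _; apply: eq_Rintegral => z.
by rewrite inE/= in_itv/= => zab; rewrite /Submission.clamped_node clamp_id.
Qed.

(** [tail2] is the same at all nodes, hence the factor [size nodes]; the rest is [carleman_tail]
    with exponent [2 * l]. *)
Lemma wsum_tail2 l V : 0 < l -> H10 V ->
  wsum l (fun e z => tail2 V z) <= (size nodes)%:R / (2 * l) * wsum l (fun e z => clamped_node V e z ^+ 2).
Proof.
move=> l0 HV; rewrite wsum_vn_sqr// /Submission.wsum big_const_seq count_predT iter_addr_0.
rewrite [leRHS]mulrCA; apply: (ler_wpM2l (sqr_ge0 h)).
rewrite -[leLHS]mulr_natl -[leRHS]mulrA; apply: ler_wpM2l; first exact: ler0n.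
have l2 : 0 < 2 * l by rewrite mulr_gt0.
have cn : continuous (fun t => nu V t ^+ 2) by apply: ctX; exact: nu_continuous.
exact: (carleman_tail A b (2 * l) _ Ab l2 cn (fun t => sqr_ge0 (nu V t))).
Qed.

(** The normalization [expR (- (2 * l * A))] makes the weight at least 1 on [[A, b]], as
    [z >= A]. *)
Lemma L2_le_wsum l V : 0 < l -> H10 V ->
  L2_dot V V <= expR (- (2 * l * A)) * wsum l (fun e z => clamped_node V e z ^+ 2).
Proof.
move=> l0 HV; rewrite wsum_vn_sqr// (L2_dot_nu A sigma h B N s0 V HV) mulrCA.
rewrite ler_wpM2l ?sqr_ge0//.
have cn : continuous (fun z => nu V z ^+ 2) by apply: ctX; exact: nu_continuous.
have cw : continuous (fun z => wexp l z * nu V z ^+ 2) by apply: ctM => //; exact: wexp_continuous.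
rewrite -itgZ_E; last exact: continuous_itg.
apply: le_itg; [exact: continuous_itg|by apply: continuous_itg; exact: ctZ|].
move=> z /andP[Az _]; rewrite mulrA ler_peMl ?sqr_ge0// /wexp -expRD.
rewrite -expR0 ler_expR addrC subr_ge0 ler_pM2l// mulr_gt0//.
Qed.

(** The remainder is at least half of the weighted square of [W2 - W1] minus a tail term. For [l]
    large the Carleman estimate bounds the latter by a quarter of the same square, and the remaining
    quarter dominates [8^-1] of the squared L2 norm. *)
Lemma convexity_bound (rho nG nF : R) : 0 <= rho -> exists2 l0 : R, 1 < l0 &
  forall G F l g W1 W2, data nG nF G F -> l0 <= l -> nonneg_ball rho G W1 ->
    nonneg_ball rho G W2 ->
    8^-1 * L2_norm (W2 - W1) ^+ 2 + g * H1_norm (W2 - W1) ^+ 2 <=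
    J G F l g W2 - J G F l g W1 - H1_dot (frechet (J G F l g) W1) (W2 - W1).
Proof.
move=> r0; have [C C0 HC] := uniform_estimates rho nG nF r0.
pose n : R := (size nodes)%:R.
have n0 : 0 <= n by rewrite ler0n.
have Cn0 : 0 <= 2 * C * n by rewrite mulr_ge0// mulr_ge0.
(* [2 * C * n] makes [C * (n / (2 * l))] at most 1/4; the summand 2 ensures that the threshold
   exceeds 1. *)
exists (2 * C * n + 2); first by rewrite ltr_wpDl// ltr1n.
move=> G F l g W1 W2 D ll N1 N2.
have l0 : 0 < l by apply: lt_le_trans ll; rewrite ltr_wpDl.
have lC : 2 * C * n <= l by apply: le_trans ll; rewrite lerDl.
have gW1 := good_self A sigma h B N a hA s0 h0 hB rho G W1 N1.
have gW2 := good_self A sigma h B N a hA s0 h0 hB rho G W2 N2.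
have [_ E1] := frechet_DJ rho nG nF l g G F W1 r0 D N1.
have CG : CN_space G by case: D.
have w0 : 0 <= embedding_const sigma h * rho + 1 by rewrite addr_ge0// mulr_ge0// emb_ge0.
have m0 : 0 < Num.sqrt (u0min A / 2).
  by rewrite sqrtr_gt0; apply: divr_gt0 => //; exact: u0min_gt0.
have HW1 : H10 W1 by case: N1. have HW2 : H10 W2 by case: N2.
have H12 := H10_B A sigma B N W2 W1 HW2 HW1.
rewrite (E1 _ H12) (J_expand A sigma h B N a hA s0 h0 _ _ w0 m0 G F CG l g _ _ gW1 gW2).
rewrite L2_norm_sqr H1_norm_sqr lerD2r.
have cR := ncont_rem A sigma h B N a hA s0 h0 _ _ w0 m0 G F CG _ _ gW1 gW2.
have cv : nodal_cont B N (fun e z => clamped_node (W2 - W1) e z ^+ 2).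
  by move=> e he; apply: ctX; exact: (ncont_vn A sigma B N s0 _ H12 e he).
have ct : nodal_cont B N (fun e z => tail2 (W2 - W1) z).
  by move=> e he; exact: tail2_continuous.
have cZ c (X : 'I_N * nat * nat -> R -> R) : nodal_cont B N X -> nodal_cont B N (fun e z => c * X e z).
  by move=> cX e he; apply: ctZ; exact: (cX e he).
have low : 2^-1 * wsum l (fun e z => clamped_node (W2 - W1) e z ^+ 2) - C * wsum l (fun e z => tail2 (W2 - W1) z)
    <= wsum l (taylor_rem G F W1 W2).
  rewrite -mulNr -!wsumZ// -wsumD; [|exact: cZ|exact: cZ].
  apply: wsum_le => //.
    by move=> e he; exact: (ctD _ _ (cZ _ _ cv e he) (cZ _ _ ct e he)).
  move=> e z he _; have [_ _ _ _ [_ H]] := HC G F W1 W2 e z D gW1 gW2 he.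
  by rewrite mulrC mulNr.
have tl := wsum_tail2 l _ l0 H12.
have lw := L2_le_wsum l _ l0 H12.
set S := wsum l (fun e z => clamped_node (W2 - W1) e z ^+ 2) in low tl lw *.
have S0 : 0 <= S.
  by rewrite /S wsum_vn_sqr// mulr_ge0 ?sqr_ge0// Rintegral_ge0// => z _;
    rewrite mulr_ge0 ?sqr_ge0 ?wexp_ge0.
have L0 := L2_dot_ge0 A sigma h B N (W2 - W1).
have low2 : 4^-1 * S <= wsum l (taylor_rem G F W1 W2).
  apply: le_trans low.
  have : C * wsum l (fun e z => tail2 (W2 - W1) z) <= 4^-1 * S.
    apply: (le_trans (ler_wpM2l C0 tl)); rewrite -/n mulrA ler_wpM2r//.
    exact: carleman_const.
  exact: half_quarter.
apply: (@le_trans _ _ (expR (- (2 * l * A)) * (4^-1 * S))); last first.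
  by rewrite ler_wpM2l ?expR_ge0.
rewrite mulrCA; apply: (@le_trans _ _ (4^-1 * L2_dot (W2 - W1) (W2 - W1))).
  by rewrite ler_wpM2r// lef_pV2 ?posrE// ler_nat.
by rewrite ler_wpM2l// invr_ge0.
Qed.

End Convexity.

(** The first-order inequalities at the convex combination, towards its two ends, are weighted by
    [t] and [1 - t]: the linear terms cancel and [g * (t * (1 - t)) * n ^+ 2] remains as strict
    gain. *)
Lemma strict_convexity_arith (R : realFieldType) (jv jw jz t d g n lv lw : R) : 0 < t < 1 ->
  0 < g -> 0 < n -> 0 <= lv -> 0 <= lw ->
  lv + g * ((1 - t) * n) ^+ 2 <= jv - jz - (1 - t) * d ->
  lw + g * (t * n) ^+ 2 <= jw - jz - (- t) * d ->
  jz < t * jv + (1 - t) * jw.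
Proof.
move=> /andP[t0 t1] g0 n0 lv0 lw0 Hv Hw.
have t1' : 0 < 1 - t by rewrite subr_gt0.
have Hv' : t * (g * ((1 - t) * n) ^+ 2) <= t * (jv - jz - (1 - t) * d).
  by rewrite ler_pM2l//; apply: le_trans Hv; rewrite lerDr.
have Hw' : (1 - t) * (g * (t * n) ^+ 2) <= (1 - t) * (jw - jz - (- t) * d).
  by rewrite ler_pM2l//; apply: le_trans Hw; rewrite lerDr.
have p : 0 < g * (t * (1 - t)) * n ^+ 2 by rewrite !mulr_gt0// exprn_gt0.
rewrite -subr_gt0; apply: (lt_le_trans p).
have -> : g * (t * (1 - t)) * n ^+ 2 =
  t * (g * ((1 - t) * n) ^+ 2) + (1 - t) * (g * (t * n) ^+ 2) by ring.
have -> : t * jv + (1 - t) * jw - jz =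
  t * (jv - jz - (1 - t) * d) + (1 - t) * (jw - jz - (- t) * d) by ring.
exact: lerD.
Qed.

Lemma convex_diff (R : pzRingType) (U : lmodType R) (t : R) (v w : U) :
  v - (t *: v + (1 - t) *: w) = (1 - t) *: (v - w) /\
  w - (t *: v + (1 - t) *: w) = (- t) *: (v - w).
Proof.
split; first by rewrite opprD addrA -[X in X - _ - _]scale1r -scalerBl -scalerBr.
rewrite scalerBl scale1r scaleNr scalerBr [RHS]opprB opprD opprB addrCA addrC.
by rewrite [w + _]addrC subrK.
Qed.

Lemma convex_diff2 (R : pzRingType) (U : lmodType R) (s t : R) (v v' w w' : U) :
  s *: v' + t *: w' - (s *: v + t *: w) = s *: (v' - v) + t *: (w' - w).
Proof. by rewrite !scalerBr opprD addrACA. Qed.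

Lemma convex_lt (R : realFieldType) (t p q c : R) : 0 < t < 1 -> p < c -> q < c ->
  t * p + (1 - t) * q < c.
Proof. by move=> /andP[t0 t1] pc qc; nra. Qed.

(** * Convexity on the closure *)

Section AdmissibleSets.
Context {R : realType}.
Variables (A sigma h : R) (B N : nat) (a : R).
Hypotheses (hA : 0 < A) (s0 : 0 < sigma) (h0 : 0 < h) (h1 : h < 1) (hB : h^-1 = B%:R).
Local Notation b := (A + sigma).
Local Notation H10 := (H10 A sigma B).
Local Notation H1_dot := (H1_dot A sigma h B).
Local Notation H1_norm := (H1_norm A sigma h B).
Local Notation nonneg_ball := (nonneg_ball A sigma h B N a).
Local Notation K := (K A sigma h B a).
Local Notation Kbar := (Kbar A sigma h B a).
Local Notation J := (J A sigma h B a).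
Local Notation frechet := (frechet A sigma h B).
Implicit Types (G W V : sdfun R N) (F : 'I_N -> nat -> nat -> R).

Lemma K_nonneg_ball r G W : K G r W -> nonneg_ball r G W.
Proof.
move=> [HW nW pW]; split=> // [|i j z x iB jB zI xI]; first exact: ltW.
by apply/ltW/pW => //; rewrite in_itv.
Qed.

Lemma wg_lin t G V W z x i j : wg a G (t *: V + (1 - t) *: W) z x i j =
  t * wg a G V z x i j + (1 - t) * wg a G W z x i j.
Proof.
have -> : t * wg a G V z x i j + (1 - t) * wg a G W z x i j =
  t * expansion a (fun k => V k i j z) x + (1 - t) * expansion a (fun k => W k i j z) x +
  expansion a (fun k => G k i j z) x by rewrite /wg; ring.
rewrite /wg; congr (_ + _); rewrite /expansion !mulr_sumr -big_split/=.
by apply: eq_bigr => k _; rewrite !mulrA -mulrDl.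
Qed.

Lemma wg_diff G V W z x i j : A <= z <= b -> 0 <= x <= 1 ->
  wg a G V z x i j - wg a G W z x i j = vc A sigma N a (V - W) i j z x.
Proof.
move=> zI xI; rewrite /wg /vc !clamp_id// opprD addrACA subrr addr0 /expansion -sumrB.
by apply: eq_bigr => k _; rewrite -mulrBl.
Qed.

(** Approximating with error [r] puts the norm below [2 * r]. By the embedding, convergence in H1 is
    uniform in the nodes, [z] and [alpha], so strict positivity passes to the limit as
    nonnegativity. *)
Lemma Kbar_nonneg_ball r G W : 0 < r -> Kbar G r W -> nonneg_ball (2 * r) G W.
Proof.
move=> r0 [HW cW]; split=> //.
  have [V [[_ nV _] HV dV]] := cW r r0.
  have -> : W = V + (W - V) by rewrite addrC subrK.
  apply: (le_trans (H1_normD A sigma h B N s0 _ _ HV (H10_B A sigma B N _ _ HW HV))).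
  rewrite (H1_normB_sym A sigma h B N s0 _ _ HW HV) mulr_natl mulr2n.
  exact: (lerD (ltW nV) (ltW dV)).
move=> i j z x iB jB zI xI.
have k0 : 0 <= N%:R * nbound N a * embedding_const sigma h.
  by apply: mulr_ge0; [apply: mulr_ge0 => //; exact: nbound_ge0|exact: emb_ge0].
have k1 : 0 < N%:R * nbound N a * embedding_const sigma h + 1 by rewrite ltr_wpDl.
apply/ler_addgt0Pl => e e0.
have [V [[_ _ pV] HV dV]] := cW (e / (N%:R * nbound N a * embedding_const sigma h + 1)) (divr_gt0 e0 k1).
have HVW := H10_B A sigma B N _ _ HV HW.
have pw : 0 < wg a G V z x i j by apply: pV => //; rewrite in_itv.
have := wg_diff G V W z x i j zI xI.
have := vc_bound A sigma B N a s0 (V - W) i j z x HVW iB jB.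
have nb : N%:R * nbound N a * Submission.nu A sigma B N (V - W) z <= e.
  have k2 : 0 <= N%:R * nbound N a by apply: mulr_ge0 => //; exact: nbound_ge0.
  apply: (le_trans (ler_wpM2l k2 (nu_le_H1_norm A sigma h B N s0 h0 _ z HVW))).
  rewrite mulrA; apply: (le_trans (ler_wpM2l k0 (ltW dV))).
  by rewrite mulrA ler_pdivrMr// mulrC ler_wpM2l ?(ltW e0)// lerDl.
move=> /le_trans /(_ nb) vb dE; move: vb; rewrite -dE ler_norml => /andP[_ ub].
by move: ub pw; move: (wg _ _ V _ _ _ _) (wg _ _ W _ _ _ _) => p q; lra.
Qed.

Lemma H1_norm_convex t V W : H10 V -> H10 W -> 0 < t < 1 ->
  H1_norm (t *: V + (1 - t) *: W) <= t * H1_norm V + (1 - t) * H1_norm W.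
Proof.
move=> HV HW /andP[t0 t1]; have t1' : 0 <= 1 - t by rewrite subr_ge0 ltW.
apply: (le_trans (H1_normD A sigma h B N s0 _ _ (H10_Z A sigma B N _ _ HV) (H10_Z A sigma B N _ _ HW))).
by rewrite !H1_normZ// !ger0_norm// ltW.
Qed.

Lemma K_convex r G t V W : K G r V -> K G r W -> 0 < t < 1 -> K G r (t *: V + (1 - t) *: W).
Proof.
move=> [HV nV pV] [HW nW pW] t01; have [t0 t1] := andP t01.
have t1' : 0 < 1 - t by rewrite subr_gt0.
split.
- exact: (H10_D A sigma B N _ _ (H10_Z A sigma B N _ _ HV) (H10_Z A sigma B N _ _ HW)).
- exact: (le_lt_trans (H1_norm_convex t V W HV HW t01) (convex_lt _ _ _ _ _ t01 nV nW)).
move=> i j z x iB jB zI xI; rewrite wg_lin.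
by apply: addr_gt0; apply: mulr_gt0 => //; [exact: pV|exact: pW].
Qed.

Lemma Kbar_convex r G t V W : Kbar G r V -> Kbar G r W -> 0 < t < 1 ->
  Kbar G r (t *: V + (1 - t) *: W).
Proof.
move=> [HV cV] [HW cW] t01; have [t0 t1] := andP t01.
have HZ := H10_D A sigma B N _ _ (H10_Z A sigma B N t _ HV) (H10_Z A sigma B N (1 - t) _ HW).
split; [exact: HZ|move=> e e0].
have [V' [KV' HV' dV]] := cV e e0; have [W' [KW' HW' dW]] := cW e e0.
exists (t *: V' + (1 - t) *: W'); split.
- exact: K_convex.
- exact: (H10_D A sigma B N _ _ (H10_Z A sigma B N t _ HV') (H10_Z A sigma B N (1 - t) _ HW')).
rewrite convex_diff2.
apply: (le_lt_trans (H1_norm_convex t _ _ (H10_B A sigma B N _ _ HV' HV) (H10_B A sigma B N _ _ HW' HW) t01)).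
exact: convex_lt t01 dV dW.
Qed.

(** The bound is used at the convex combination [Z], towards [V] and towards [W]; both increments
    are multiples of [V - W], so one value of the gradient enters with opposite signs. *)
Lemma gradient_strict_convexity G F l g (S : set (sdfun R N)) : 0 < g ->
  (forall V, S V -> H10 V) ->
  (forall V W t, S V -> S W -> 0 < t < 1 -> S (t *: V + (1 - t) *: W)) ->
  (forall V, S V -> H10 (frechet (J G F l g) V)) ->
  (forall W1 W2, S W1 -> S W2 ->
    8^-1 * L2_norm A sigma h B (W2 - W1) ^+ 2 + g * H1_norm (W2 - W1) ^+ 2 <=
    J G F l g W2 - J G F l g W1 - H1_dot (frechet (J G F l g) W1) (W2 - W1)) ->
  strictly_convex_on A sigma h B S (J G F l g).
Proof.
move=> g0 SH cS HF bound V W t SV SW t01; have SZ := cS V W t SV SW t01.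
split=> // dVW; set Z := t *: V + (1 - t) *: W in SZ *.
have HV := SH V SV; have HW := SH W SW; have HD := H10_B A sigma B N _ _ HV HW.
have [EV EW] := convex_diff _ _ t V W; rewrite -/Z in EV EW.
have BV := bound Z V SZ SV; have BW := bound Z W SZ SW.
have dotZ c : H1_dot (frechet (J G F l g) Z) (c *: (V - W)) =
    c * H1_dot (frechet (J G F l g) Z) (V - W).
  by rewrite H1_dotC (H1_dotZl A sigma h B N s0 c _ _ HD (HF Z SZ)) H1_dotC.
move: BV BW; rewrite EV EW !dotZ !H1_normZ// !exprMn normrN !real_normK ?num_real//.
rewrite -!exprMn; apply: strict_convexity_arith => //;
  by apply: mulr_ge0 => //; exact: sqr_ge0.
Qed.

End AdmissibleSets.

(** * Reduction to one value of the shift *)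

Section BasisShift.
Context {R : realType}.
Variables (A sigma h : R) (B N : nat) (a b : R).

Lemma Psi_indep_fun : Psi a = Psi b. Proof. by apply/funext => n; exact: Psi_indep. Qed.

Lemma J_indep (G : sdfun R N) F l g : J A sigma h B a G F l g = J A sigma h B b G F l g.
Proof.
by apply/funext => W; rewrite /J /residual (MN_indep a b) /P /flux /u /wg /fser /expansion Psi_indep_fun.
Qed.

Lemma K_indep (G : sdfun R N) r : K A sigma h B a G r = K A sigma h B b G r.
Proof. by rewrite /K /wg /expansion Psi_indep_fun. Qed.

Lemma Kbar_indep (G : sdfun R N) r : Kbar A sigma h B a G r = Kbar A sigma h B b G r.
Proof. by rewrite /Kbar K_indep. Qed.

End BasisShift.

Theorem theorem8p1 (R : realType) (A sigma : R) (N : nat) (h0 h : R) (B : nat)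
    (r normG normF : R)
    (hA : 0 < A) (hsigma : 0 < sigma) (hN : (1 <= N)%N)
    (hh0 : 0 < h0 < 1) (hh : h0 <= h < 1) (hB : h^-1 = B%:R) (hr : 0 < r) :
  (forall (a : R) (G : sdfun R N) (F : 'I_N -> nat -> nat -> R)
      (lambda gamma : R) (W : sdfun R N),
    0 < a -> CN_space A sigma B G ->
    CN_norm A sigma B G = normG -> CN_norm A sigma B (const_z F) = normF ->
    0 < lambda -> 0 < gamma < 1 -> K A sigma h B a G (2 * r) W ->
    frechet_differentiable A sigma h B (J A sigma h B a G F lambda gamma) W)
  /\
  (forall lambda : R, 0 < lambda -> exists2 C : R, 0 < C &
    forall (a : R) (G : sdfun R N) (F : 'I_N -> nat -> nat -> R)
      (gamma : R) (W1 W2 : sdfun R N),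
    0 < a -> CN_space A sigma B G ->
    CN_norm A sigma B G = normG -> CN_norm A sigma B (const_z F) = normF ->
    0 < gamma < 1 ->
    K A sigma h B a G (2 * r) W1 -> K A sigma h B a G (2 * r) W2 ->
    let J' := frechet A sigma h B (J A sigma h B a G F lambda gamma) in
    H1_norm A sigma h B (J' W2 - J' W1) <= C * H1_norm A sigma h B (W2 - W1))
  /\
  (exists2 lambda0 : R, 1 < lambda0 &
    forall (a : R) (G : sdfun R N) (F : 'I_N -> nat -> nat -> R)
      (lambda gamma : R),
    0 < a -> CN_space A sigma B G ->
    CN_norm A sigma B G = normG -> CN_norm A sigma B (const_z F) = normF ->
    lambda0 <= lambda -> 0 < gamma < 1 ->
    let Jlg := J A sigma h B a G F lambda gamma in
    let J' := frechet A sigma h B Jlg in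
    strictly_convex_on A sigma h B (Kbar A sigma h B a G r) Jlg /\
    forall W1 W2 : sdfun R N,
      Kbar A sigma h B a G r W1 -> Kbar A sigma h B a G r W2 ->
      frechet_differentiable A sigma h B Jlg W1 /\
      8^-1 * L2_norm A sigma h B (W2 - W1) ^+ 2
        + gamma * H1_norm A sigma h B (W2 - W1) ^+ 2
      <= Jlg W2 - Jlg W1 - H1_dot A sigma h B (J' W1) (W2 - W1)).
Proof.
have [h00 _] := andP hh0; have [h0h h1] := andP hh.
have hp : 0 < h := lt_le_trans h00 h0h.
have r2 : 0 <= 2 * r by rewrite mulr_ge0// ltW.
(* The constants must be chosen before [a], so everything is built for the shift 1. With radius
   [2 * r], one ball serves all three claims. *)
pose frechetJ := @frechet_DJ R A sigma h B N 1 hA hsigma hp h1 hB (2 * r) normG normF.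
split; [|split].
- move=> a G F l g W _ CG EG EF _ _; rewrite (K_indep _ _ _ _ _ a 1) (J_indep _ _ _ _ _ a 1).
  move=> /K_nonneg_ball KW; exists (frechet A sigma h B (J A sigma h B 1 G F l g) W).
  exact: (proj1 (frechetJ l g G F W r2 (And3 CG EG EF) KW)).
- move=> l _.
  have [C C0 HC] := lipschitz_derivative A sigma h B N 1 hA hsigma hp h1 hB (2 * r) normG normF l r2.
  exists C => // a G F g W1 W2 _ CG EG EF g01.
  rewrite !(K_indep _ _ _ _ _ a 1) (J_indep _ _ _ _ _ a 1).
  move=> /K_nonneg_ball K1 /K_nonneg_ball K2.
  exact: (HC G F g W1 W2 (And3 CG EG EF) g01 K1 K2).
have [l0 l01 H] := convexity_bound A sigma h B N 1 hA hsigma hp h1 hB (2 * r) normG normF r2.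
exists l0; [exact: l01|move=> a G F l g _ CG EG EF ll /andP[g0 _]].
rewrite (Kbar_indep _ _ _ _ _ a 1) (J_indep _ _ _ _ _ a 1) => Jlg J'.
have ball W : Kbar A sigma h B 1 G r W -> nonneg_ball A sigma h B N 1 (2 * r) G W.
  exact: Kbar_nonneg_ball.
have D : data A sigma B N normG normF G F by split.
have FW W (KW : Kbar A sigma h B 1 G r W) : is_frechet A sigma h B Jlg W (J' W).
  exact: (proj1 (frechetJ l g G F W r2 D (ball W KW))).
have bound W1 W2 (K1 : Kbar A sigma h B 1 G r W1) (K2 : Kbar A sigma h B 1 G r W2) :
    8^-1 * L2_norm A sigma h B (W2 - W1) ^+ 2 + g * H1_norm A sigma h B (W2 - W1) ^+ 2 <=
    Jlg W2 - Jlg W1 - H1_dot A sigma h B (J' W1) (W2 - W1).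
  exact: (H G F l g W1 W2 D ll (ball W1 K1) (ball W2 K2)).
split; last by move=> W1 W2 K1 K2; split; [exists (J' W1); exact: FW|exact: bound].
apply: gradient_strict_convexity.
- exact: hsigma.
- exact: g0.
- by move=> V [].
- by move=> V W t KV KW; exact: Kbar_convex.
- by move=> V KV; have [] := FW V KV.
exact: bound.
Qed.
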